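(* Let $d\in\{1,2,3\}$, let $D\ge1$ be an integer, let $I=[t_0,T]$ and $J=[0,M]^d$ with $0<t_0<T$ and $M\in(0,2\pi)$, and let $D_0=[(4-d)/8]^{-1}+d\,[1\wedge((4-d)/2)]^{-1}$. Let $V=(v_1,\dots,v_D)$ be the $D$-dimensional random field on $[0,T]\times\mathbb{T}^d$ whose components are independent copies of $$v(t,x)=\int_{\mathbb{T}^d}G(t;x,z)v_0(z)\,dz+\int_0^t\int_{\mathbb{T}^d}G(t-r;x,z)\,W(dr,dz),$$ where $v_0$ is a fixed initial condition. If $D>D_0$, then every point $z\in\mathbb{R}^D$ is polar for $V$ (that is, $\{z\}$ is polar); if $D<D_0$, then every point $z\in\mathbb{R}^D$ is nonpolar for $V$.
   Context: A Borel set $A\subset\mathbb{R}^D$ is called polar for $V$ if $P(V(I\times J)\cap A\ne\emptyset)=0$, and nonpolar otherwise. $\mathbb{N}=\{0,1,2,\dots\}$; $\mathbb{T}^d=(\mathbb{R}/2\pi\mathbb{Z})^d$ with Lebesgue measure. For $k\in\mathbb{N}^d$, $\lambda_k=\sum_{j=1}^d k_j^4$ and $n(k)$ is the number of null components of $k$. For $t>0$, $$G(t;x,y)=\sum_{k\in\mathbb{N}^d}\frac{e^{-\lambda_k t}}{2^{n(k)}\pi^d}\prod_{j=1}^d\cos(k_j(x_j-y_j)),$$ called in the paper the Green's function of the biharmonic heat operator on $\mathbb{T}^d$. $W$ is a space-time white noise on $[0,T]\times\mathbb{T}^d$ and the stochastic integral is a Wiener integral. The function $v_0:\mathbb{T}^d\to\mathbb{R}$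 is fixed and such that $z\mapsto G(t;x,z)v_0(z)$ belongs to $L^1(\mathbb{T}^d)$ for every $(t,x)\in(0,T]\times\mathbb{T}^d$. $V$ is taken in a version with continuous sample paths on $I\times J$. $a\wedge b=\min(a,b)$. *)

(* Defs.v *)
From HB Require Import structures.
From mathcomp Require Import all_boot all_order all_algebra.
From mathcomp Require Import all_classical all_reals all_analysis.

Set Implicit Arguments.
Unset Strict Implicit.
Unset Printing Implicit Defensive.

Import Order.TTheory GRing.Theory Num.Theory.
Import numFieldNormedType.Exports.
Import HBSimple.

Local Open Scope classical_set_scope.
Local Open Scope ring_scope.

Section lebesgue_tuple.
Variable R : realType.
Local Notation mR := (measurableTypeR R).

Definition tuple_pair n (p : mR * n.-tuple mR) : n.+1.-tuple mR :=
  [tuple of p.1 :: p.2].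

Lemma measurable_tuple_pair n :
  measurable_fun [set: mR * n.-tuple mR] (@tuple_pair n).
Proof. by apply: measurable_cons. Qed.

Section step.
Variables (n : nat) (mu : {sigma_finite_measure set (n.-tuple mR) -> \bar R}).

Definition lebesgue_cons : set (n.+1.-tuple mR) -> \bar R :=
  pushforward (lebesgue_measure \x mu)%E (@tuple_pair n).

Let measurable_preimage (A : set (n.+1.-tuple mR)) :
  measurable A -> measurable (@tuple_pair n @^-1` A).
Proof.
by move=> mA; rewrite -[X in measurable X]setTI; exact: measurable_tuple_pair.
Qed.

Let lebesgue_cons0 : lebesgue_cons set0 = 0%E.
Proof. by rewrite /lebesgue_cons /pushforward preimage_set0 measure0. Qed.

Let lebesgue_cons_ge0 A : (0 <= lebesgue_cons A)%E.
Proof. by rewrite /lebesgue_cons /pushforward; exact: measure_ge0. Qed.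

Let lebesgue_cons_sigma_additive : semi_sigma_additive lebesgue_cons.
Proof.
move=> F mF tF mUF; rewrite /lebesgue_cons /pushforward preimage_bigcup.
apply: measure_semi_sigma_additive => [i||].
- exact: measurable_preimage.
- move/trivIsetP : tF => tF; apply/trivIsetP => /= i j _ _ ij.
  by rewrite -preimage_setI tF // preimage_set0.
- by rewrite -preimage_bigcup; exact: measurable_preimage.
Qed.

HB.instance Definition _ := isMeasure.Build _ _ _ lebesgue_cons
  lebesgue_cons0 lebesgue_cons_ge0 lebesgue_cons_sigma_additive.

Lemma lebesgue_cons_sigma_finite : sigma_finite setT lebesgue_cons.
Proof.
have /sigma_finiteP[F [FT ndF Foo]] := sigma_finiteT (@lebesgue_measure R).
have /sigma_finiteP[G [GT ndG Goo]] := sigma_finiteT mu.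
pose uncons (x : n.+1.-tuple mR) : mR * n.-tuple mR :=
  (thead x, [tuple of behead x]).
have muncons : measurable_fun setT uncons.
  apply/measurable_fun_pairP; split => /=.
    exact: measurable_tnth.
  exact: measurable_behead.
have unconsK p : uncons (tuple_pair p) = p.
  by case: p => a x; congr pair; apply/val_inj.
exists (fun i => uncons @^-1` (F i `*` G i)).
  rewrite -preimage_bigcup; apply/esym/seteqP; split => // x _.
  have : [set: mR] (uncons x).1 by [].
  rewrite FT => -[i _ Fi].
  have : [set: n.-tuple mR] (uncons x).2 by [].
  rewrite GT => -[j _ Gj].
  exists (maxn i j) => //; split => /=.
    by move: Fi; exact/subsetPset/ndF/leq_maxl.
  by move: Gj; exact/subsetPset/ndG/leq_maxr.
move=> i; have [mF Fi] := Foo i; have [mG Gi] := Goo i; split.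
  by rewrite -[X in measurable X]setTI; apply: muncons => //; exact: measurableX.
rewrite /lebesgue_cons /pushforward -comp_preimage.
rewrite (_ : uncons \o _ = id); last by apply/funext => p /=; rewrite unconsK.
by rewrite preimage_id product_measure1E // lte_mul_pinfty // ge0_fin_numE.
Qed.

HB.instance Definition _ := Measure_isSigmaFinite.Build _ _ _
  lebesgue_cons lebesgue_cons_sigma_finite.

End step.

(** Lebesgue measure on R^n as an iterated product, with R^n as [n.-tuple R]. *)
Fixpoint lebesgue_tuple n : {sigma_finite_measure set (n.-tuple mR) -> \bar R} :=
  match n with
  | 0 => \d_ [tuple]
  | n'.+1 => lebesgue_cons (lebesgue_tuple n')
  end.

End lebesgue_tuple.

(** Points of the torus (R / 2 pi Z)^d are represented by their representatives
    in [0, 2 pi)^d, which carries the restriction of the d-dimensional Lebesgue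
    measure [lebesgue_tuple d]. *)
Definition torus (R : realType) d : set (d.-tuple R) :=
  [set x | forall j, 0 <= tnth x j < 2 * pi].

Definition box (R : realType) d (M : R) : set (d.-tuple R) :=
  [set x | forall j, 0 <= tnth x j <= M].

Section green.
Variables (R : realType) (d : nat).
Implicit Types (t : R) (x y : d.-tuple R) (k : 'I_d -> nat).

Definition eigenvalue4 k : R := \sum_j (k j)%:R ^+ 4.

Definition num_null k : nat := #|[set j | k j == 0%N]%SET|.

Definition green_term t x y k : R :=
  expR (- (eigenvalue4 k * t)) / (2 ^+ num_null k * pi ^+ d) *
  \prod_j cos ((k j)%:R * (tnth x j - tnth y j)).

(** The series over N^d is absolutely convergent for t > 0; it is summed here
    along the cubes {0, .., N - 1}^d. *)
Definition green t x y : R :=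
  limn (fun N => \sum_(k : {ffun 'I_d -> 'I_N}) green_term t x y (fun j => k j)).

End green.

Section white_noise.
Context {dsp} {Om : measurableType dsp} {R : realType}.
Variables (P : probability Om R) (T : R) (d : nat).
Local Notation mR := (measurableTypeR R).
Local Notation st := (mR * d.-tuple mR)%type.

(** A degenerate Gaussian law is a Dirac mass; [normal_prob m 0] is not. *)
Definition gaussian_rv (X : Om -> R) : Prop :=
  measurable_fun setT X /\
  exists m s : R, forall B, measurable B ->
    P (X @^-1` B) = if s == 0 then \d_m B else normal_prob m s B.

Definition st_measure : set st -> \bar R :=
  (lebesgue_measure \x lebesgue_tuple R d)%E.

Definition spacetime : set st := [set` `[0, T]] `*` @torus R d.

(** Space-time white noise as a random set function: a centered Gaussian
    process indexed by the Borel subsets of [0, T] x T^d with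
    E[W(A) W(B)] = |A `&` B|. *)
Record white_noise (W : set st -> Om -> R) : Prop := {
  white_noise_gaussian : forall n (A : 'I_n -> set st) (a : 'I_n -> R),
    (forall i, measurable (A i) /\ A i `<=` spacetime) ->
    gaussian_rv (fun w => \sum_i a i * W (A i) w);
  white_noise_mean : forall A, measurable A -> A `<=` spacetime ->
    ('E_P[W A] = 0)%E;
  white_noise_cov : forall A B, measurable A -> A `<=` spacetime ->
    measurable B -> B `<=` spacetime ->
    ('E_P[(fun w => W A w * W B w)%R] = st_measure (A `&` B))%E }.

Definition simple_wiener (W : set st -> Om -> R) (h : {sfun st >-> R})
    (w : Om) : R :=
  \sum_(c \in range h) c * W (spacetime `&` h @^-1` [set c]) w.

(** [X] is a version of the Wiener integral of [f] against [W]: the limit in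
    L^2(Om) of the integrals of simple functions converging to [f] in
    L^2([0, T] x T^d). *)
Definition is_wiener_integral (W : set st -> Om -> R) (f : st -> R)
    (X : Om -> R) : Prop :=
  [/\ measurable_fun spacetime f,
      (\int[st_measure]_(p in spacetime) ((f p) ^+ 2)%:E < +oo)%E,
      measurable_fun setT X &
      exists h : nat -> {sfun st >-> R},
        (\int[st_measure]_(p in spacetime) ((f p - h n p) ^+ 2)%:E
           @[n --> \oo] --> 0)%E /\
        ('E_P[(fun w => (X w - simple_wiener W (h n) w) ^+ 2)%R]
           @[n --> \oo] --> 0)%E].

(** The random field v is only prescribed for t in (0, T], since the kernel
    is not defined at t = 0. *)
Definition biharmonic_field (W : set st -> Om -> R) (v0 : d.-tuple R -> R)
    (v : R -> d.-tuple R -> Om -> R) : Prop :=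
  forall t x, 0 < t <= T -> torus x ->
    measurable_fun setT (v t x) /\
    exists2 X : Om -> R,
      is_wiener_integral W
        (fun p => if (p.1 : R) < t then green (t - p.1) x p.2 else 0) X &
      {ae P, forall w, v t x w =
        \int[lebesgue_tuple R d]_(z in @torus R d) (green t x z * v0 z) + X w}.

End white_noise.

Section random_fields.
Context {R : realType} {d : nat}.

Definition same_law {dsp dsp'} {Om : measurableType dsp}
    {Om' : measurableType dsp'} (P : probability Om R) (P' : probability Om' R)
    (T : R) (u : R -> d.-tuple R -> Om -> R) (v : R -> d.-tuple R -> Om' -> R)
    : Prop :=
  forall n (t : 'I_n -> R) (x : 'I_n -> d.-tuple R) (B : set (n.-tuple R)),
    (forall i, 0 < t i <= T /\ torus (x i)) -> measurable B ->
    P [set w | B [tuple u (t i) (x i) w | i < n]] =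
    P' [set w | B [tuple v (t i) (x i) w | i < n]].

Context {dsp} {Om : measurableType dsp}.
Variables (P : probability Om R) (T : R).

Definition field_sigma (v : R -> d.-tuple R -> Om -> R) : set (set Om) :=
  <<s [set E | exists t x (B : set R),
         [/\ 0 < t <= T, torus x, measurable B & E = v t x @^-1` B]] >>.

Definition independent_fields D (v : 'I_D -> R -> d.-tuple R -> Om -> R)
    : Prop :=
  forall E : 'I_D -> set Om, (forall i, field_sigma (v i) (E i)) ->
    fine (P (\bigcap_i E i)) = \prod_i fine (P (E i)).

(** [v] consists of independent copies of the field [u], defined on a possibly
    different probability space. *)
Definition independent_copies {dsp'} {Om' : measurableType dsp'}
    (P' : probability Om' R) (u : R -> d.-tuple R -> Om' -> R)
    D (v : 'I_D -> R -> d.-tuple R -> Om -> R) : Prop :=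
  [/\ forall i t x, 0 < t <= T -> torus x -> measurable_fun setT (v i t x),
      forall i, same_law P' P T u (v i) &
      independent_fields v].

(** Tuples carry no topology in the library, hence the detour by row vectors. *)
Definition continuous_paths (I : set R) (J : set (d.-tuple R))
    (v : R -> d.-tuple R -> Om -> R) : Prop :=
  forall w, {within [set p : R * 'rV[R]_d |
                       I p.1 /\ J [tuple p.2 ord0 j | j < d]],
    continuous (fun p : R * 'rV[R]_d => v p.1 [tuple p.2 ord0 j | j < d] w)}.

(** [negligible] is nullity for the completion of [P]: for a general Borel set
    [A], the event below need not belong to the sigma-algebra of [Om]. *)
Definition polar D (I : set R) (J : set (d.-tuple R))
    (V : R -> d.-tuple R -> Om -> D.-tuple R) (A : set (D.-tuple R)) : Prop :=
  P.-negligible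
    [set w | [set V p.1 p.2 w | p in I `*` J] `&` A !=set0].

Definition nonpolar D (I : set R) (J : set (d.-tuple R))
    (V : R -> d.-tuple R -> Om -> D.-tuple R) (A : set (D.-tuple R)) : Prop :=
  ~ polar I J V A.

End random_fields.

Definition critical_dim (R : realType) (d : nat) : R :=
  ((4 - d%:R) / 8)^-1 + d%:R * (Num.min 1 ((4 - d%:R) / 2))^-1.

(* Main.v *)
(** The kernel G is the product over the coordinates of one-dimensional kernels
    [g r u = (1 / 2 + sum_{k >= 1} exp (- k ^ 4 r) cos (k u)) / pi], and
    [g r 0] is of order [L = r ^ (- 1 / 4)] for small [r], with derivatives
    bounded by powers of [L]. Since these kernels form a convolution semigroup,
    the L^2 norms of the combinations of kernels defining the variances of
    [a v(t, x) + b v(s, y)] are one-dimensional integrals of products of values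
    of [g]. This gives, with [rho = max(|t - s| ^ (1 / 4), |x - y|)],
    - [Var (v(t, x) - v(s, y)) <= C (|t - s| ^ al + |x - y| ^ (2 th))] for
      [al < 1 - d / 4] and [th <= 1], [th < (4 - d) / 2];
    - [Var (v(t, x) - c v(s, y)) >= k rho ^ (4 - d)] for all [c], which bounds
      below the covariance determinant of the pair (v(t, x), v(s, y)).

    Polarity: if V hits z then either some increment between neighbouring levels
    of a dyadic grid, of meshes [2 ^ (- p n)] in time and [2 ^ (- q n)] in space,
    is abnormally large, or some vertex of level n is sent within a multiple of
    [2 ^ (- (r - 1) n)] of z. The second event has probability at most a multiple of
    [2 ^ (p n + d q n - (r - 1) n D)], and [p + d q < (r - 1) D] can be achieved
    when [D] exceeds the critical dimension.

    Nonpolarity: on a grid with [N ^ 4] times and [N] points per space direction,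
    the number of vertices sent within [N ^ (- (4 - d) / 2)] of z has a second
    moment comparable to the square of its mean when [(4 - d) D < 2 (4 + d)]. So
    this number is positive with probability bounded below, hence infinitely
    often with positive probability, and V then hits z by compactness. *)

Require Import Defs.
From HB Require Import structures.
From mathcomp Require Import all_boot all_order all_algebra.
From mathcomp Require Import all_classical all_reals all_analysis.
From mathcomp Require Import measurable_realfun.
From mathcomp Require Import zify ring lra.

Set Implicit Arguments.
Unset Strict Implicit.
Unset Printing Implicit Defensive.

Import Order.TTheory GRing.Theory Num.Theory.
Import numFieldNormedType.Exports.

Local Open Scope classical_set_scope.
Local Open Scope ring_scope.

(** * Calculus of the normal density *)

(** The obstacle is that the field is given only through Wiener integrals, that is through [L^2]
    limits of simple integrals, and that no joint density of two values is at hand. Cosine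
    transforms do pass to such limits, so the law of a pair is carried by the integrals of
    [cos (a v(t, x) + b v(s, y) + c)], and probabilities of small balls are recovered by comparing
    indicators with Gaussian bumps.

    Uniformity in [c] of the lower bound on [Var (v(t, x) - c v(s, y))] is what makes it a bound on
    a determinant: at [c = Cov / Var] it is a conditional variance. In time it comes from the noise
    that falls between the two times, in space from the decorrelation of two kernels at a distance
    comparable to their width.

    For [d = 1] the lower exponent [4 - d = 3] exceeds the upper one, [2 th <= 2], and the second
    moment argument asks for [D < 10 / 3] where the critical dimension is [11 / 3]. The theorem
    survives because no integer separates the two. *)

Section real_derivatives.
Variable R : realType.
Implicit Types (f g F : R -> R) (x a b c : R).

Lemma is_derive_fun_cst c x : is_derive x 1 (fun _ : R => c) 0.
Proof. exact: is_derive_cst. Qed.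

Lemma is_derive_fun_id x : is_derive x 1 (fun y : R => y) 1.
Proof. exact: is_derive_id. Qed.

Lemma is_derive_funD f g x a b : is_derive x 1 f a -> is_derive x 1 g b ->
  is_derive x 1 (fun y => f y + g y) (a + b).
Proof. by move=> fa gb; exact: is_deriveD. Qed.

Lemma is_derive_funM f g x a b : is_derive x 1 f a -> is_derive x 1 g b ->
  is_derive x 1 (fun y => f y * g y) (a * g x + f x * b).
Proof.
move=> fa gb; have := @is_deriveM R R^o f g x 1 a b fa gb.
by move/is_derive_eq; apply; rewrite /GRing.scale/= addrC mulrC.
Qed.

Lemma is_derive_fun_comp g f x a b : is_derive (f x) 1 g a ->
  is_derive x 1 f b -> is_derive x 1 (fun y => g (f y)) (a * b).
Proof. by move=> ga fb; exact: (is_derive1_comp ga fb). Qed.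

Lemma is_derive_continuous f g : (forall x, is_derive x 1 f (g x)) ->
  continuous f.
Proof.
move=> fg x; apply: differentiable_continuous; apply/derivable1_diffP.
exact: (@ex_derive _ _ _ _ _ _ _ (fg x)).
Qed.

Lemma integral_itv_is_derive f F a b : a <= b -> continuous f ->
  (forall x, is_derive x 1 F (f x)) ->
  (\int[lebesgue_measure]_(x in `[a, b]) (f x)%:E = (F b - F a)%:E)%E.
Proof.
rewrite le_eqVlt => /predU1P[<- _ _|ab cf dF].
  by rewrite set_itv1 integral_set1 subrr.
have cF := is_derive_continuous dF.
rewrite EFinB; apply: continuous_FTC2 => //.
- exact: continuous_subspaceT.
- split=> [x _||].
  + exact: (@ex_derive _ _ _ _ _ _ _ (dF x)).
  + exact/cvg_at_right_filter/cF.
  + exact/cvg_at_left_filter/cF.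
- by move=> x _; rewrite derive1E; exact: (@derive_val _ _ _ _ _ _ _ (dF x)).
Qed.

End real_derivatives.

Section dominated_convergence_real.
Context d (T : measurableType d) (R : realType) (mu : {measure set T -> \bar R}).
Variables (D : set T) (mD : measurable D).
Variables (f_ : nat -> T -> R) (f g : T -> R).
Hypothesis mf_ : forall n, measurable_fun D (f_ n).
Hypothesis f_f : forall x, D x -> f_ n x @[n --> \oo] --> f x.
Hypothesis intg : mu.-integrable D (EFin \o g).
Hypothesis f_g : forall n x, D x -> `|f_ n x| <= g x.

Lemma dominated_cvg_integrable : mu.-integrable D (EFin \o f).
Proof.
have mf : measurable_fun D f by exact: measurable_fun_cvg mf_ f_f.
apply: (le_integrable mD _ _ intg); first exact/measurable_EFinP.
move=> x Dx /=; rewrite lee_fin.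
have h : `|f_ n x| @[n --> \oo] --> `|f x| by apply: cvg_norm; exact: f_f.
have g0 : 0 <= g x by apply: le_trans (f_g 0 Dx).
rewrite (ger0_norm g0) -(cvg_lim _ h)//; apply: limr_le; first by apply/cvg_ex; eexists; exact: h.
by apply: nearW => n; exact: f_g.
Qed.

Lemma dominated_cvg_integral :
  (\int[mu]_(x in D) (f_ n x)%:E)%E @[n --> \oo] --> (\int[mu]_(x in D) (f x)%:E)%E.
Proof.
have mf : measurable_fun D f by exact: measurable_fun_cvg mf_ f_f.
have [||||_ _] := @dominated_convergence _ _ R mu D mD (fun n => EFin \o f_ n)
  (EFin \o f) (EFin \o g) _ _ _ intg.
- by move=> n; exact/measurable_EFinP.
- exact/measurable_EFinP.
- by apply: aeW => x Dx; apply: cvg_EFin; [exact: nearW|exact: f_f].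
- by apply: aeW => x n Dx; rewrite lee_fin; exact: f_g.
- exact.
Qed.

Lemma dominated_cvg_Rintegral :
  \int[mu]_(x in D) f_ n x @[n --> \oo] --> \int[mu]_(x in D) f x.
Proof.
rewrite /Rintegral; apply: fine_cvg; rewrite fineK; first exact: dominated_cvg_integral.
by apply: integrable_fin_num => //; exact: dominated_cvg_integrable.
Qed.

End dominated_convergence_real.

Section integral_line.
Variable R : realType.
Implicit Types (f F : R -> R) (x : R).

(** Replaces integration by parts on the line: the second moment and the cosine transform of the
    normal density follow by exhibiting an integrand as the derivative of a function that vanishes
    at both ends. The integral is the limit of those over [[-n, n]], dominated by [|f|]. *)
Lemma integral_line_is_derive f F : continuous f ->
  (forall x, is_derive x 1 F (f x)) ->
  lebesgue_measure.-integrable setT (EFin \o f) ->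
  F n%:R @[n --> \oo] --> 0 -> F (- n%:R) @[n --> \oo] --> 0 ->
  (\int[lebesgue_measure]_x (f x)%:E = 0)%E.
Proof.
move=> cf dF intf F0 F0'.
have mf := measurable_int lebesgue_measure intf.
have mfr : measurable_fun [set: R] f by exact/measurable_EFinP.
have := @dominated_cvg_integral _ _ R lebesgue_measure setT measurableT
  (fun n : nat => f \_ `[- n%:R, n%:R]) f (fun x => `|f x|) _ _ _ _.
move=> cvf.
have <- : limn (fun n => \int[lebesgue_measure]_x
    ((f \_ `[- n%:R, n%:R]) x)%:E)%E = (\int[lebesgue_measure]_x (f x)%:E)%E.
  apply/cvg_lim => //; apply: cvf.
  - by move=> n; apply: (measurable_restrictT f _).1 => //; exact: measurable_funTS.
  - move=> x _; apply: cvg_near_cst; near=> n.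
    rewrite patchE ifT// inE/= in_itv/= -ler_norml.
    by near: n; exact: nbhs_infty_ger.
  - by have := integrable_abse intf.
  - by move=> n x _; rewrite patchE; case: ifPn => //= _; rewrite normr0.
apply/cvg_lim => //.
have E n : (\int[lebesgue_measure]_x ((f \_ `[- n%:R, n%:R]) x)%:E =
    (F n%:R - F (- n%:R))%:E)%E.
  rewrite -(@integral_itv_is_derive _ f F)// ?ge0_cp// [RHS]integral_mkcond.
  by apply: eq_integral => x _; rewrite restrict_EFin.
rewrite (eq_cvg _ _ E); apply: cvg_EFin; first by near=> n.
rewrite /comp/=.
by rewrite -[X in _ --> X](subrr 0); apply: cvgB.
Unshelve. all: by end_near. Qed.

End integral_line.

(** * Tails, second moment and cosine transform of the normal density *)

Section normal_density_calculus.
Variable R : realType.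
Implicit Types (m s a x c u : R).
Local Notation mu := (@lebesgue_measure R).

Lemma is_derive_normal_pdf m s x : s != 0 ->
  is_derive x 1 (normal_pdf m s) (- ((x - m) / s ^+ 2 * normal_pdf m s x)).
Proof.
move=> s0; rewrite normal_pdfE// /normal_fun.
have d1 : is_derive x 1 (fun y => y - m) (1 + 0).
  exact: is_derive_funD (is_derive_fun_id _) (is_derive_fun_cst _ _).
have d2 : is_derive x 1 (fun y => - (y - m) ^+ 2 / (s ^+ 2 *+ 2))
    (- ((x - m) / s ^+ 2)).
  have -> : (fun y => - (y - m) ^+ 2 / (s ^+ 2 *+ 2)) =
      (fun y => (y - m) * (y - m) * - (s ^+ 2 *+ 2)^-1).
    by apply/funext => y; rewrite mulrN mulNr expr2.
  by apply: is_derive_eq; rewrite /GRing.scale/=; field.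
have d3 := is_derive_fun_comp (is_derive_expR _) d2.
apply: is_derive_eq (is_derive_funM (is_derive_fun_cst (normal_peak s) x) d3) _.
by ring.
Qed.

(** Splits off half of the Gaussian decay, keeping an integrable density. *)
Lemma normal_pdf_sqrt2 m s x : s != 0 -> normal_pdf m s x =
  Num.sqrt 2 * expR (- ((x - m) ^+ 2 / (4 * s ^+ 2))) *
  normal_pdf m (Num.sqrt 2 * s) x.
Proof.
move=> s0; have s20 : Num.sqrt 2 != 0 :> R by rewrite gt_eqF// sqrtr_gt0.
rewrite !normal_pdfE ?mulf_neq0// /normal_peak /normal_fun.
rewrite exprMn sqr_sqrtr// -[in X in _ = _ * (X^-1 * _)]mulrA -[in X in _ = _ * (X^-1 * _)]mulrnAr.
rewrite sqrtrM//; set a := Num.sqrt 2; set b := Num.sqrt (s ^+ 2 * _ *+ 2).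
have b0 : b != 0.
  by rewrite gt_eqF// sqrtr_gt0 mulrn_wgt0// mulr_gt0 ?pi_gt0// exprn_even_gt0.
have -> : - (x - m) ^+ 2 / (s ^+ 2 *+ 2) = - ((x - m) ^+ 2 / (4 * s ^+ 2)) +
    - (x - m) ^+ 2 / (2 * s ^+ 2 *+ 2) by field.
by rewrite expRD; field; rewrite b0.
Qed.

Let sqrt2_le2 : Num.sqrt 2 <= 2 :> R.
Proof. by rewrite -ler_sqr ?nnegrE// sqr_sqrtr//; lra. Qed.

(** With [y = (x - m) ^ 2 / (4 s ^ 2)], the factor [exp (- y)] split off by [normal_pdf_sqrt2]
    absorbs [y], since [y exp (- y) <= 1]; the constant is [4 sqrt 2 <= 8]. *)
Lemma sqr_normal_pdf_le m s x : s != 0 ->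
  (x - m) ^+ 2 * normal_pdf m s x <=
  8 * s ^+ 2 * normal_pdf m (Num.sqrt 2 * s) x.
Proof.
move=> s0; rewrite normal_pdf_sqrt2// mulrA ler_wpM2r ?normal_pdf_ge0//.
set y := (x - m) ^+ 2 / (4 * s ^+ 2).
have s2 : 0 < s ^+ 2 by rewrite exprn_even_gt0.
have -> : (x - m) ^+ 2 = 4 * s ^+ 2 * y by rewrite /y; field.
have ye : y * expR (- y) <= 1.
  rewrite expRN ler_pdivrMr ?expR_gt0// mul1r.
  by apply: le_trans (expR_ge1Dx y); rewrite lerDr.
rewrite mulrACA; apply: (@le_trans _ _ (4 * s ^+ 2 * Num.sqrt 2 * 1)).
  by rewrite ler_wpM2l// mulr_ge0 ?sqrtr_ge0// mulr_ge0// ltW.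
rewrite mulr1 (_ : 8 = 4 * 2)//; last by ring.
by rewrite mulrAC ler_wpM2r// ?ler_wpM2l// ltW.
Qed.

Lemma normal_pdf_tail s u x : s != 0 -> 0 <= u -> u <= `|x| ->
  normal_pdf 0 s x <=
  2 * expR (- (u ^+ 2 / (4 * s ^+ 2))) * normal_pdf 0 (Num.sqrt 2 * s) x.
Proof.
move=> s0 u0 ux; rewrite normal_pdf_sqrt2// ler_wpM2r ?normal_pdf_ge0//.
rewrite subr0 ler_pM// ?expR_ge0// ler_expR lerN2 ler_wpM2r//.
  by rewrite invr_ge0 mulr_ge0// sqr_ge0.
by rewrite -[leRHS]real_normK ?num_real// ler_sqr ?nnegrE.
Qed.

(** On the tail the factor split off is at most [exp (- u ^ 2 / (4 s ^ 2))], and the density that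
    remains has integral at most one; [2] bounds [sqrt 2]. *)
Lemma normal_prob_tail s u : s != 0 -> 0 <= u ->
  (normal_prob 0 s [set x : R | (u < `|x|)%R] <=
   (2 * expR (- (u ^+ 2 / (4 * s ^+ 2))))%:E)%E.
Proof.
move=> s0 u0; set k := 2 * _.
have s20 : Num.sqrt 2 != 0 :> R by rewrite gt_eqF// sqrtr_gt0.
have mD : measurable [set x : R | u < `|x|].
  have : measurable_fun [set: R] (fun x : R => u < `|x|).
    by apply: measurable_fun_ltr => //; exact: measurableT_comp.
  by move=> /(_ measurableT [set true] I); rewrite setTI.
have k0 : 0 <= k by rewrite mulr_ge0// expR_ge0.
rewrite /normal_prob.
apply: (@le_trans _ _ (\int[mu]_(x in [set x : R | (u < `|x|)%R])
    (k * normal_pdf 0 (Num.sqrt 2 * s) x)%:E)%E).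
  apply: ge0_le_integral => //.
  - by move=> x _; rewrite lee_fin normal_pdf_ge0.
  - by apply/measurable_EFinP/measurable_funTS; exact: measurable_normal_pdf.
  - apply/measurable_EFinP/measurable_funTS/measurable_funM => //.
    exact: measurable_normal_pdf.
  - by move=> x /= ux; rewrite lee_fin; exact: normal_pdf_tail (ltW ux).
under eq_integral do rewrite EFinM.
rewrite ge0_integralZl//; last 2 first.
  by apply/measurable_EFinP/measurable_funTS; exact: measurable_normal_pdf.
  by move=> x _; rewrite lee_fin normal_pdf_ge0.
rewrite -[leRHS]mule1; apply: lee_pmul => //.
  by apply: integral_ge0 => x _; rewrite lee_fin normal_pdf_ge0.
rewrite -[leRHS](@integral_normal_pdf _ 0 (Num.sqrt 2 * s)).
apply: ge0_subset_integral => //.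
- by apply/measurable_EFinP; exact: measurable_normal_pdf.
- by move=> x _; rewrite lee_fin normal_pdf_ge0.
Qed.

Lemma integrable_sqr_normal_pdf m s : s != 0 ->
  mu.-integrable setT (fun x => ((x - m) ^+ 2 * normal_pdf m s x)%:E).
Proof.
move=> s0; have h := integrableZl measurableT (8 * s ^+ 2)
  (integrable_normal_pdf m (Num.sqrt 2 * s)).
apply: le_integrable h => //.
- apply/measurable_EFinP/measurable_funM; last exact: measurable_normal_pdf.
  by apply: measurable_funX; exact: measurable_funB.
- move=> x _ /=; rewrite lee_fin ger0_norm; last first.
    by apply: mulr_ge0; [exact: sqr_ge0|exact: normal_pdf_ge0].
  by rewrite (le_trans _ (ler_norm _))// sqr_normal_pdf_le.
Qed.

(** The bound on [(y - m) ^ 2] times the density leaves a decay in [1 / (n - |m|)]. The condition on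
    [x] is met both by [n] and by [- n], the two ends needed for integrals over the line. *)
Lemma cvg_affine_normal_pdf m s k (x : nat -> R) : s != 0 ->
  (forall n, n%:R - `|m| <= `|x n - m|) ->
  ((x n - m) + k) * normal_pdf m s (x n) @[n --> \oo] --> 0.
Proof.
move=> s0 xn; set K := 8 * s ^+ 2 * normal_peak (Num.sqrt 2 * s).
have s20 : Num.sqrt 2 * s != 0 by rewrite mulf_neq0// gt_eqF// sqrtr_gt0.
have pdfK y : (y - m) ^+ 2 * normal_pdf m s y <= K.
  apply: le_trans (sqr_normal_pdf_le _ _ s0) _.
  by rewrite ler_wpM2l ?normal_pdf_ub// mulr_ge0 ?sqr_ge0.
have K0 : 0 <= K by apply: le_trans (pdfK m); rewrite subrr expr0n/= mul0r.
apply/norm_cvg0P.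
have inv0 : ((1 + `|k|) * K) * (n%:R - `|m|)^-1 @[n --> \oo] --> 0.
  rewrite -[X in _ --> X](mulr0 ((1 + `|k|) * K)); apply: cvgMr.
  have np : \forall n \near \oo, (0 : R) < n%:R - `|m|.
    by near=> n; rewrite subr_gt0; near: n; exact: nbhs_infty_gtr.
  apply/(gtr0_cvgV0 np); apply/cvgryPge => A; near=> n.
  by rewrite lerBrDr; near: n; exact: nbhs_infty_ger.
apply: (@squeeze_cvgr _ _ _ _ (cst 0) _ _ _ _ _ inv0); last exact: cvg_cst.
near=> n; rewrite normr_ge0/= normrM [X in _ * X]ger0_norm ?normal_pdf_ge0//.
have n1 : 1 <= n%:R - `|m|.
  by rewrite lerBrDr; near: n; exact: nbhs_infty_ger.
have y1 := le_trans n1 (xn n).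
have y0 : 0 < `|x n - m| by apply: lt_le_trans y1.
rewrite ler_pdivlMr ?(lt_le_trans _ n1)//.
apply: (@le_trans _ _ ((1 + `|k|) * (`|x n - m| ^+ 2 * normal_pdf m s (x n)))); last first.
  by rewrite real_normK ?num_real// ler_wpM2l// addr_ge0.
rewrite mulrAC mulrA ler_wpM2r ?normal_pdf_ge0// expr2 mulrA ler_pM//.
  by rewrite subr_ge0 -subr_ge0 (le_trans _ n1).
apply: le_trans (ler_normD _ _) _; rewrite mulrDl mul1r lerD2l.
by rewrite ler_peMr.
Unshelve. all: by end_near. Qed.

Lemma continuous_normal_pdfM m s (g : R -> R) : s != 0 -> continuous g ->
  continuous (fun x => g x * normal_pdf m s x).
Proof.
move=> s0 cg x; apply: cvgM; first exact: cg.
exact: continuous_normal_pdf.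
Qed.

(** The integrand minus [k] times the density is the derivative of [- s ^ 2 ((x - m) + 2 (m + c))]
    times the density. The shift [c] is what allows [centered_gaussian_law] to identify [m] and [s]
    from second moments. *)
Lemma integral_sqr_normal_pdf m s c : s != 0 ->
  (\int[mu]_x ((x + c) ^+ 2 * normal_pdf m s x)%:E =
   (s ^+ 2 + (m + c) ^+ 2)%:E)%E.
Proof.
move=> s0; set k := s ^+ 2 + (m + c) ^+ 2.
have intm : mu.-integrable setT (fun x => ((x + c) ^+ 2 * normal_pdf m s x)%:E).
  have h := integrableD measurableT
    (integrableZl measurableT 2 (integrable_sqr_normal_pdf m s0))
    (integrableZl measurableT (2 * (m + c) ^+ 2) (integrable_normal_pdf m s)).
  apply: le_integrable h => //.
    apply/measurable_EFinP/measurable_funM; last exact: measurable_normal_pdf.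
    by apply: measurable_funX; exact: measurable_funD.
  move=> x _ /=; rewrite lee_fin.
  rewrite ger0_norm; last first.
    by apply: mulr_ge0; [exact: sqr_ge0|exact: normal_pdf_ge0].
  rewrite (le_trans _ (ler_norm _))// mulrA -mulrDl ler_wpM2r ?normal_pdf_ge0//.
  rewrite (_ : x + c = (x - m) + (m + c)); last by ring.
  have := sqr_ge0 ((x - m) - (m + c)); nra.
have intk := integrableZl measurableT k (integrable_normal_pdf m s).
have : (\int[mu]_x (((x + c) ^+ 2 - k) * normal_pdf m s x)%:E = 0)%E.
  apply: (@integral_line_is_derive _
    (fun x => ((x + c) ^+ 2 - k) * normal_pdf m s x) (fun x => - s ^+ 2 * (((x - m) + 2 * (m + c)) * normal_pdf m s x))).
  - apply: continuous_normal_pdfM => // x; apply: cvgB; last exact: cvg_cst.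
    by apply: (@cvgM _ _ _ _ (fun x => x + c)); apply: cvgD => //; exact: cvg_cst.
  - move=> x; have dp := is_derive_normal_pdf m x s0.
    have d1 : is_derive x 1 (fun y => (y - m) + 2 * (m + c)) (1 + 0 + 0).
      by apply: is_derive_funD (is_derive_fun_cst _ _).
    apply: is_derive_eq (is_derive_funM (is_derive_fun_cst (- s ^+ 2) x) (is_derive_funM d1 dp)) _.
    by rewrite /k; field.
  - have h := integrableB measurableT intm intk; apply: eq_integrable h => // x _.
    by rewrite /= mulrBl.
  - rewrite -[X in _ --> X](mulr0 (- s ^+ 2)); apply: cvgMr.
    apply: cvg_affine_normal_pdf => // n.
    by rewrite -[X in X - _]ger0_norm//; exact: lerB_dist.
  - rewrite -[X in _ --> X](mulr0 (- s ^+ 2)); apply: cvgMr.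
    apply: cvg_affine_normal_pdf => // n.
    rewrite -[X in X - _]ger0_norm// -[X in X - _ <= _]normrN; exact: lerB_dist.
under eq_integral do rewrite mulrBl EFinB EFinM.
rewrite integralB//; under [X in (_ - X)%E]eq_integral do rewrite EFinM.
rewrite integralZl//; last exact: integrable_normal_pdf.
rewrite integral_normal_pdf mule1.
have := integrable_fin_num measurableT intm.
under eq_integral do rewrite EFinM.
by case: (\int[mu]_x _)%E => // r _ /eqP; rewrite -EFinB eqe subr_eq0 => /eqP ->.
Qed.

Lemma integrable_bounded_normal_pdf m s (g : R -> R) M :
  measurable_fun setT g -> (forall x, `|g x| <= M) ->
  mu.-integrable setT (fun x => (g x * normal_pdf m s x)%:E).
Proof.
move=> mg gM; have h := integrableZl measurableT M (integrable_normal_pdf m s).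
apply: le_integrable h => //.
  by apply/measurable_EFinP/measurable_funM => //; exact: measurable_normal_pdf.
move=> x _ /=; rewrite lee_fin !normrM ler_wpM2r// (le_trans (gM _))//.
exact: ler_norm.
Qed.

Lemma cvg_normal_pdf m s (x : nat -> R) : s != 0 ->
  (forall n, n%:R - `|m| <= `|x n - m|) ->
  normal_pdf m s (x n) @[n --> \oo] --> 0.
Proof.
move=> s0 xn; rewrite -[X in _ --> X](subrr 0).
rewrite (_ : (fun n => _) = (fun n => ((x n - m + 1) * normal_pdf m s (x n)) -
    ((x n - m + 0) * normal_pdf m s (x n)))); last by apply/funext => n; ring.
by apply: cvgB; exact: cvg_affine_normal_pdf.
Qed.

Let affine_continuous a c : continuous (fun x : R => a * x + c).
Proof.
by move=> x; apply: cvgD; [exact: mulrl_continuous|exact: cvg_cst].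
Qed.

Let phi s c a := \int[mu]_x (cos (a * x + c) * normal_pdf 0 s x).

Let integrable_cos s c a : s != 0 ->
  mu.-integrable setT (fun x => (cos (a * x + c) * normal_pdf 0 s x)%:E).
Proof.
move=> s0; apply: (@integrable_bounded_normal_pdf _ _ (fun x => cos (a * x + c)) 1).
  apply: continuous_measurable_fun => x.
  by apply: (continuous_comp (f := fun x => a * x + c)); [exact: affine_continuous|exact: continuous_cos].
by move=> x; rewrite ler_norml cos_geN1 cos_le1.
Qed.

(** The differential equation of the Gaussian characteristic function. Differentiation under the
    integral produces [x sin (a x + c)], which is exchanged for [s ^ 2 a cos (a x + c)] by means of
    the primitive [s ^ 2 sin (a x + c)] times the density. *)
Let is_derive_phi s c a : s != 0 -> is_derive a 1 (phi s c) (- (s ^+ 2 * a * phi s c a)).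
Proof.
move=> s0; pose f b x := cos (b * x + c) * normal_pdf 0 s x.
have df (b x : R) : is_derive b 1 (f ^~ x) (- (x * sin (b * x + c) * normal_pdf 0 s x)).
  have d1 : is_derive b 1 (fun b : R => b * x + c) x.
    by apply: is_derive_eq; rewrite /GRing.scale/=; ring.
  have d2 := is_derive_fun_comp (is_derive_cos _) d1.
  apply: is_derive_eq (is_derive_funM d2 (is_derive_fun_cst (normal_pdf 0 s x) b)) _.
  by ring.
have intG : mu.-integrable setT (EFin \o (fun x => (1 + x ^+ 2) * normal_pdf 0 s x)).
  have h := integrableD measurableT (integrable_normal_pdf 0 s) (integrable_sqr_normal_pdf 0 s0).
  apply: eq_integrable h => // x _ /=.
  by rewrite subr0 -EFinD mulrDl mul1r.
have Ia : `]a - 1, a + 1[%classic a by rewrite /= in_itv/=; apply/andP; split; lra.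
have h1 : forall x : R, `]a - 1, a + 1[%classic x -> mu.-integrable setT (EFin \o f x).
  by move=> x _; exact: integrable_cos.
have h2 : forall x y : R, `]a - 1, a + 1[%classic x -> setT y -> derivable (f ^~ y) x 1.
  by move=> x y _ _; exact: (@ex_derive _ _ _ _ _ _ _ (df x y)).
have d1f (x y : R) : partial1of2 f x y = - (y * sin (x * y + c) * normal_pdf 0 s y).
  by rewrite partial1of2E; exact: (@derive_val _ _ _ _ _ _ _ (df x y)).
have h3 : forall x y : R, `]a - 1, a + 1[%classic x -> setT y ->
    `|partial1of2 f x y| <= (1 + y ^+ 2) * normal_pdf 0 s y.
  move=> x y _ _; rewrite d1f normrN !normrM [X in _ * _ * X]ger0_norm ?normal_pdf_ge0//.
  rewrite ler_wpM2r ?normal_pdf_ge0//.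
  apply: (@le_trans _ _ (`|y| * 1)).
    by rewrite ler_wpM2l// ler_norml sin_geN1 sin_le1.
  rewrite mulr1 -[y ^+ 2]real_normK ?num_real//.
  have := sqr_ge0 (`|y| - 1); have := normr_ge0 y; nra.
have h4 : forall y : R, 0 <= (1 + y ^+ 2) * normal_pdf 0 s y.
  by move=> y; rewrite mulr_ge0 ?normal_pdf_ge0// addr_ge0// sqr_ge0.
have ex := derivable_under_integral measurableT Ia h1 h2 h4 intG h3.
have va := differentiation_under_integral measurableT Ia h1 h2 h4 intG h3.
apply: DeriveDef; first exact: ex.
rewrite -derive1E va.
have intS : mu.-integrable setT (fun x => (x * sin (a * x + c) * normal_pdf 0 s x)%:E).
  have := @measurable_int _ _ _ mu _ _ intG; move=> _.
  apply: le_integrable intG => //.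
    apply/measurable_EFinP/measurable_funM; last exact: measurable_normal_pdf.
    apply: measurable_funM => //; apply: continuous_measurable_fun => x.
    by apply: (continuous_comp (f := fun x => a * x + c)); [exact: affine_continuous|exact: continuous_sin].
  move=> x _ /=; rewrite lee_fin -normrN -d1f (le_trans (h3 _ _ Ia I))//.
  exact: ler_norm.
have intC := integrableZl measurableT (s ^+ 2 * a) (integrable_cos c a s0).
have : (\int[mu]_x ((s ^+ 2 * a * cos (a * x + c) - x * sin (a * x + c)) * normal_pdf 0 s x)%:E = 0)%E.
  apply: (@integral_line_is_derive _
    (fun x => (s ^+ 2 * a * cos (a * x + c) - x * sin (a * x + c)) * normal_pdf 0 s x)
    (fun x => s ^+ 2 * sin (a * x + c) * normal_pdf 0 s x)).
  - have cax : continuous (fun x : R => a * x + c) by exact: affine_continuous.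
    apply: continuous_normal_pdfM => // x; apply: cvgB.
      apply: cvgMr; apply: (continuous_comp (f := fun x => a * x + c)); first exact: cax.
      exact: continuous_cos.
    apply: cvgM; first exact: cvg_id.
    apply: (continuous_comp (f := fun x => a * x + c)); first exact: cax.
    exact: continuous_sin.
  - move=> x; have dp := is_derive_normal_pdf 0 x s0.
    have d1 : is_derive x 1 (fun y : R => a * y + c) a.
      by apply: is_derive_eq; rewrite /GRing.scale/=; ring.
    have d2 := is_derive_fun_comp (is_derive_sin _) d1.
    have d3 := is_derive_funM (is_derive_fun_cst (s ^+ 2) x) d2.
    apply: is_derive_eq (is_derive_funM d3 dp) _.
    by field.
  - have h := integrableB measurableT intC intS; apply: eq_integrable h => // x _.
    by rewrite /= -EFinM -EFinB mulrBl mulrA.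
  - apply/norm_cvg0P; have h : s ^+ 2 * normal_pdf 0 s n%:R @[n --> \oo] --> 0.
      rewrite -[X in _ --> X](mulr0 (s ^+ 2)); apply: cvgMr.
      by apply: cvg_normal_pdf => // n; rewrite normr0 !subr0 ger0_norm.
    apply: (@squeeze_cvgr _ _ _ _ (cst 0) _ _ _ _ _ h); last exact: cvg_cst.
    near=> n; rewrite normr_ge0/= 2!normrM [X in _ * X]ger0_norm ?normal_pdf_ge0//.
    rewrite ler_wpM2r ?normal_pdf_ge0// [X in X * _]ger0_norm ?sqr_ge0//.
    rewrite ler_piMr ?sqr_ge0//.
    by rewrite ler_norml sin_geN1 sin_le1.
  - apply/norm_cvg0P; have h : s ^+ 2 * normal_pdf 0 s (- n%:R) @[n --> \oo] --> 0.
      rewrite -[X in _ --> X](mulr0 (s ^+ 2)); apply: cvgMr.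
      by apply: cvg_normal_pdf => // n; rewrite normr0 !subr0 normrN ger0_norm.
    apply: (@squeeze_cvgr _ _ _ _ (cst 0) _ _ _ _ _ h); last exact: cvg_cst.
    near=> n; rewrite normr_ge0/= 2!normrM [X in _ * X]ger0_norm ?normal_pdf_ge0//.
    rewrite ler_wpM2r ?normal_pdf_ge0// [X in X * _]ger0_norm ?sqr_ge0//.
    rewrite ler_piMr ?sqr_ge0//.
    by rewrite ler_norml sin_geN1 sin_le1.
move=> h0; have : \int[mu]_x (s ^+ 2 * a * (cos (a * x + c) * normal_pdf 0 s x) -
    x * sin (a * x + c) * normal_pdf 0 s x) = 0.
  rewrite /Rintegral -[RHS]/(fine 0%E) -h0; congr fine.
  by apply: eq_integral => x _; congr EFin; ring.
rewrite RintegralB// RintegralZl//; last exact: integrable_cos.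
move=> /eqP; rewrite subr_eq0 => /eqP E0.
rewrite /phi E0.
under eq_Rintegral do rewrite d1f -mulN1r.
by rewrite RintegralZl// mulN1r.
Unshelve. all: by end_near. Qed.

Lemma Rintegral_cos_normal_pdf s a c : s != 0 ->
  \int[mu]_x (cos (a * x + c) * normal_pdf 0 s x) = cos c * expR (- (s ^+ 2 * a ^+ 2 / 2)).
Proof.
(* [psi] divides [phi] by the expected solution; its derivative vanishes and its value at [0] is
   [cos c]. *)
move=> s0; pose psi b := phi s c b * expR (s ^+ 2 * b ^+ 2 / 2).
have dpsi (b : R) : is_derive b 1 psi 0.
  have d1 : is_derive b 1 (fun b => s ^+ 2 * b ^+ 2 / 2) (s ^+ 2 * b).
    by apply: is_derive_eq; rewrite /GRing.scale/=; field.
  have d2 := is_derive_fun_comp (is_derive_expR _) d1.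
  apply: is_derive_eq (is_derive_funM (is_derive_phi c b s0) d2) _.
  by ring.
have := is_derive_0_is_cst a 0 dpsi; rewrite /psi /phi.
rewrite [in RHS]expr0n/= mulr0 mul0r expR0 mulr1.
rewrite -[in RHS]/(\int[mu]_x (cos (0 * x + c) * normal_pdf 0 s x)).
have -> : \int[mu]_x (cos (0 * x + c) * normal_pdf 0 s x) = cos c.
  under eq_Rintegral do rewrite mul0r add0r.
  rewrite RintegralZl//; last exact: integrable_normal_pdf.
  by rewrite /Rintegral integral_normal_pdf/= mulr1.
move=> h; rewrite expRN.
apply: (mulIf (lt0r_neq0 (expR_gt0 (s ^+ 2 * a ^+ 2 / 2)))).
by rewrite mulfVK ?gt_eqF ?expR_gt0.
Qed.

End normal_density_calculus.

Section lipschitz_cos.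
Variable R : realType.

Lemma MVT_lipschitz (f df : R -> R) (K x y : R) :
  (forall z : R, is_derive z 1 f (df z)) -> (forall z, `|df z| <= K) ->
  `|f x - f y| <= K * `|x - y|.
Proof.
move=> d1 dK; wlog : x y / y <= x => [h|yx].
  have [/h//|/ltW/h] := leP y x.
  by rewrite distrC [X in _ * X]distrC.
have [c _ ->] := MVT_segment yx (fun z _ => d1 z)
   (continuous_subspaceT (is_derive_continuous d1)).
by rewrite normrM ler_wpM2r.
Qed.

Lemma lipschitz_cos (x y : R) : `|cos x - cos y| <= `|x - y|.
Proof.
rewrite -[leRHS]mul1r; apply: (@MVT_lipschitz _ (fun z => - sin z)) => z.
by rewrite normrN ler_norml sin_geN1 sin_le1.
Qed.

End lipschitz_cos.

Lemma measurable_norm_gt d (T : measurableType d) (R : realType) (X : T -> R) (u : R) : measurable_fun setT X ->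
  measurable [set w | (u < `|X w|)%R].
Proof.
move=> mX; have : measurable_fun setT (fun w => u < `|X w|).
  by apply: measurable_fun_ltr => //; exact: measurableT_comp.
by move=> /(_ measurableT [set true] I); rewrite setTI.
Qed.

Section bounded_integral.
Context d (T : measurableType d) (R : realType) (P : probability T R).

Lemma bounded_integrable (f : T -> R) (M : R) : measurable_fun setT f ->
  (forall x, `|f x| <= M) -> P.-integrable setT (EFin \o f).
Proof.
move=> mf fM; apply: measurable_bounded_integrable => //.
  by rewrite (@le_lt_trans _ _ 1%E)// ?probability_le1// ltry.
by exists M; split; [exact: num_real|move=> N MN x _; exact: le_trans (fM x) (ltW MN)].
Qed.

Lemma Rintegral_probability_cst (M : R) : \int[P]_x M = M.
Proof.
rewrite /Rintegral integral_cst// [X in (_ * X)%E](_ : _ = 1%E) ?mule1//.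
exact: probability_setT.
Qed.

Lemma Rintegral_le_bounded (f : T -> R) (M : R) : measurable_fun setT f ->
  (forall x, `|f x| <= M) -> `|\int[P]_x f x| <= M.
Proof.
move=> mf fM; have intf := bounded_integrable mf fM.
apply: le_trans (le_normr_Rintegral _ intf) _ => //.
apply: (@le_trans _ _ (\int[P]_x M)).
  apply: le_Rintegral => //; first exact: integrable_norm.
  by apply: (@bounded_integrable (cst M) `|M|).
by rewrite Rintegral_probability_cst.
Qed.

End bounded_integral.

Section normal_integral.
Variable R : realType.
Implicit Types (m s a x c u : R) (f : R -> R).
Local Notation mu := (@lebesgue_measure R).

(** The Radon-Nikodym derivative of [normal_prob] coincides almost everywhere with the explicit
    density, both having the same integral over every measurable set. *)
Lemma ge0_integral_normal_prob m s (f : R -> \bar R) :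
  measurable_fun setT f -> (forall x, 0 <= f x)%E ->
  (\int[normal_prob m s]_x f x = \int[mu]_x (f x * (normal_pdf m s x)%:E))%E.
Proof.
move=> mf f0; have nm : normal_prob m s `<< mu := @normal_prob_dominates R m s.
rewrite -(Radon_Nikodym_SigmaFinite.change_of_variables nm)//.
have mg := measurable_int mu (Radon_Nikodym_SigmaFinite.f_integrable nm).
apply: ae_eq_integral => //.
- exact: emeasurable_funM.
- by apply: emeasurable_funM => //; apply/measurable_EFinP; exact: measurable_normal_pdf.
- apply: ae_eqe_mul2l; apply: integral_ae_eq => //.
  + exact: Radon_Nikodym_SigmaFinite.f_integrable.
  + by apply/measurable_EFinP; exact: measurable_normal_pdf.
  + by move=> E _ mE; rewrite -Radon_Nikodym_SigmaFinite.f_integral.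
Qed.

Lemma Rintegral_normal_prob m s f (M : R) : measurable_fun setT f ->
  (forall x, `|f x| <= M) ->
  \int[normal_prob m s]_x f x = \int[mu]_x (f x * normal_pdf m s x).
Proof.
move=> mf fM.
have intf : (normal_prob m s).-integrable setT (EFin \o f).
  exact: (@bounded_integrable _ _ _ (normal_prob m s) f M).
have intM : (normal_prob m s).-integrable setT (EFin \o cst M).
  by apply: (@bounded_integrable _ _ _ (normal_prob m s) (cst M) `|M|).
(* Adding the bound [M] makes the integrand nonnegative; it is subtracted again afterwards. *)
have : \int[normal_prob m s]_x (f x + M) = \int[mu]_x ((f x + M) * normal_pdf m s x).
  rewrite /Rintegral ge0_integral_normal_prob//.
  - by apply/measurable_EFinP; exact: measurable_funD.
  - by move=> x; rewrite lee_fin -lerBlDr sub0r; have := fM x; rewrite ler_norml => /andP[].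
rewrite RintegralD// Rintegral_probability_cst.
under [in RHS]eq_Rintegral do rewrite mulrDl.
rewrite RintegralD//; last 2 first.
- exact: integrable_bounded_normal_pdf fM.
- apply: (@integrable_bounded_normal_pdf _ m s (cst M) `|M|) => //.
- rewrite RintegralZl//; last exact: integrable_normal_pdf.
  by rewrite [X in M * X]/Rintegral integral_normal_pdf/= mulr1; exact: addIr.
Qed.

End normal_integral.

(** * Centered Gaussian variables of prescribed variance *)

Section gaussian_variable.
Context d (Om : measurableType d) (R : realType) (P : probability Om R).
Implicit Types (X Y S : Om -> R) (q c u : R).

Lemma ge0_integral_law X (nu : {measure set (measurableTypeR R) -> \bar R}) (f : R -> \bar R) :
  measurable_fun setT X ->
  (forall B : set (measurableTypeR R), measurable B -> P (X @^-1` B) = nu B) ->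
  measurable_fun [set: measurableTypeR R] f -> (forall x, 0 <= f x)%E ->
  (\int[P]_w f (X w) = \int[nu]_x f x)%E.
Proof.
move=> mX lawX mf f0.
pose Xm : {mfun Om >-> measurableTypeR R} := 
  HB.pack X (@isMeasurableFun.Build _ _ Om (measurableTypeR R) X mX).
rewrite -[LHS]/(\int[P]_w (f \o Xm) w)%E -ge0_integral_distribution//.
by apply: eq_measure_integral => A mA _; exact: lawX.
Qed.

Lemma measurable_neq0 X : measurable_fun setT X -> measurable [set w | X w != 0].
Proof.
move=> mX; have -> : [set w | X w != 0] = setT `&` X @^-1` [set~ 0].
  by rewrite setTI; apply/seteqP; split => w /= /eqP.
by apply: mX => //; apply: measurableC; exact: measurable_set1.
Qed.

Lemma sqr_integrable X q : measurable_fun setT X ->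
  (\int[P]_w (X w ^+ 2)%:E = q%:E)%E ->
  P.-integrable setT (fun w => (X w ^+ 2)%:E).
Proof.
move=> mX Xq; apply/integrableP; split.
  by apply/measurable_EFinP; exact: measurable_funX.
under eq_integral do rewrite /= ger0_norm ?sqr_ge0//.
by rewrite Xq ltry.
Qed.

Lemma sqr_integrable1 X : measurable_fun setT X ->
  P.-integrable setT (fun w => (X w ^+ 2)%:E) -> P.-integrable setT (EFin \o X).
Proof.
move=> mX X2.
have h := integrableD measurableT (@bounded_integrable _ _ _ P (cst 1) 1 _ _) X2.
apply: le_integrable (h _ _) => //; first exact/measurable_EFinP.
move=> w _ /=; rewrite lee_fin [leRHS]ger0_norm ?addr_ge0 ?sqr_ge0//.
rewrite -[X w ^+ 2]real_normK ?num_real//.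
have := sqr_ge0 (`|X w| - 1); have := normr_ge0 (X w); nra.
by move=> w; rewrite normr1.
Qed.

(** Computing the second moment of [X + c] both from the hypotheses and from the law gives
    [q + c ^ 2 = s ^ 2 + (m + c) ^ 2], without [s ^ 2] when the law is a Dirac mass. The values
    [c = 0] and [c = 1] force [m = 0] and determine [q]. *)
Lemma centered_gaussian_law X q : gaussian_rv P X -> ('E_P[X] = 0)%E ->
  (\int[P]_w (X w ^+ 2)%:E = q%:E)%E ->
  (q = 0 /\ P [set w | X w != 0] = 0%E) \/
  (exists s, [/\ s != 0, s ^+ 2 = q &
     forall B : set (measurableTypeR R), measurable B -> P (X @^-1` B) = normal_prob 0 s B]).
Proof.
move=> [mX [m [s lawX]]] X0 Xq.
have X2 := sqr_integrable mX Xq.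
have X1 := sqr_integrable1 mX X2.
have shift c : (\int[P]_w ((X w + c) ^+ 2)%:E = (q + c ^+ 2)%:E)%E.
  have -> : (\int[P]_w ((X w + c) ^+ 2)%:E =
      \int[P]_w ((X w ^+ 2)%:E + ((2 * c)%:E * (X w)%:E + (c ^+ 2)%:E)))%E.
    apply: eq_integral => w _; rewrite -EFinM -!EFinD; congr EFin; ring.
  rewrite integralD//; last first.
    apply: integrableD => //; first exact: integrableZl.
    by apply: (@bounded_integrable _ _ _ P (cst (c ^+ 2)) `|c ^+ 2|).
  rewrite Xq integralD//; last 2 first.
  - exact: integrableZl.
  - by apply: (@bounded_integrable _ _ _ P (cst (c ^+ 2)) `|c ^+ 2|).
  rewrite integralZl// integral_cst//.
  move: X0; rewrite unlock => ->; rewrite mule0 add0e.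
  by rewrite [X in (_ * X)%E](_ : _ = 1%E) ?mule1 ?EFinD//; exact: probability_setT.
have [s0|s0] := eqVneq s 0.
  left; have lawX' (f : R -> \bar R) : measurable_fun [set: measurableTypeR R] f ->
      (forall x, 0 <= f x)%E -> (\int[P]_w f (X w) = f m)%E.
    move=> mf f0; rewrite (@ge0_integral_law X \d_(m : measurableTypeR R) f)//.
      by rewrite integral_dirac// diracT mul1e.
    by move=> B mB; rewrite lawX// s0 eqxx.
  have msq c : q + c ^+ 2 = (m + c) ^+ 2.
    apply/EFin_inj; rewrite -shift (lawX' (fun x => ((x + c) ^+ 2)%:E))//.
      by apply/measurable_EFinP/measurable_funX/measurable_funD.
    by move=> x; rewrite lee_fin sqr_ge0.
  have m0 : m = 0 by have := msq 0; have := msq 1; nra.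
  split; first by have := msq 0; rewrite m0 expr0n/= !addr0 expr0n.
  have -> : [set w | X w != 0] = X @^-1` [set~ 0] by apply/seteqP; split => w /= /eqP.
  rewrite lawX ?s0 ?eqxx//; last by apply: measurableC; exact: measurable_set1.
  by rewrite m0 diracE memNset//= => /(_ erefl).
right; exists s.
have lawX' (B : set (measurableTypeR R)) : measurable B -> P (X @^-1` B) = normal_prob m s B.
  by move=> mB; rewrite lawX// (negbTE s0).
have msq c : q + c ^+ 2 = s ^+ 2 + (m + c) ^+ 2.
  have mf : measurable_fun [set: measurableTypeR R] (fun x : R => ((x + c) ^+ 2)%:E).
    by apply/measurable_EFinP/measurable_funX/measurable_funD.
  have f0 (x : R) : (0 <= ((x + c) ^+ 2)%:E)%E by rewrite lee_fin sqr_ge0.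
  apply/EFin_inj; rewrite -shift (ge0_integral_law mX lawX' mf f0).
  by rewrite ge0_integral_normal_prob// -integral_sqr_normal_pdf.
have m0 : m = 0 by have := msq 0; have := msq 1; nra.
by split => //; [have := msq 0; rewrite m0 expr0n/= !addr0 expr0n/= addr0|rewrite -m0].
Qed.

(** The bound is in terms of some positive [q'] above the variance: the variance itself may vanish,
    and a common [q'] serves a whole approximating sequence. *)
Lemma gaussian_tail X q q' u : gaussian_rv P X -> ('E_P[X] = 0)%E ->
  (\int[P]_w (X w ^+ 2)%:E = q%:E)%E -> q <= q' -> 0 < q' -> 0 <= u ->
  (P [set w | (u < `|X w|)%R] <= (2 * expR (- (u ^+ 2 / (4 * q'))))%:E)%E.
Proof.
move=> gX X0 Xq qq' q'0 u0.
have mX : measurable_fun setT X by case: gX.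
have mD : measurable [set x : measurableTypeR R | (u < `|x|)%R].
  exact: (@measurable_norm_gt _ (measurableTypeR R) R (fun x => x) u).
have mXD := measurable_norm_gt u mX.
have [[_ PX0]|[s [s0 sq lawX]]] := centered_gaussian_law gX X0 Xq.
  apply: (@le_trans _ _ 0%E); last by rewrite lee_fin mulr_ge0 ?expR_ge0.
  rewrite -PX0 le_measure ?inE//; first exact: measurable_neq0.
  by move=> w /=; apply: contraTneq => ->; rewrite normr0 -leNgt.
rewrite -[X in P X]/(X @^-1` [set x : R | u < `|x|]) lawX//.
apply: le_trans (normal_prob_tail s0 u0) _.
rewrite lee_fin ler_wpM2l// ler_expR lerN2 ler_wpM2l ?sqr_ge0// lef_pV2 ?posrE.
- by rewrite sq ler_wpM2l.
- exact: mulr_gt0.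
- by rewrite mulr_gt0// exprn_even_gt0.
Qed.

Lemma gaussian_cos X q c : gaussian_rv P X -> ('E_P[X] = 0)%E ->
  (\int[P]_w (X w ^+ 2)%:E = q%:E)%E ->
  \int[P]_w cos (X w + c) = cos c * expR (- (q / 2)).
Proof.
move=> gX X0 Xq; have mX : measurable_fun setT X by case: gX.
have mcos : measurable_fun setT (fun x : R => cos (x + c)).
  apply: continuous_measurable_fun => x.
  apply: (continuous_comp (f := fun x => x + c)); last exact: continuous_cos.
  by apply: cvgD => //; exact: cvg_cst.
have cos1 (x : R) : `|cos x| <= 1 by rewrite ler_norml cos_geN1 cos_le1.
have [[-> PX0]|[s [s0 sq lawX]]] := centered_gaussian_law gX X0 Xq.
  rewrite mul0r oppr0 expR0 mulr1 -[RHS](Rintegral_probability_cst P).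
  congr fine; apply: ae_eq_integral => //.
  - by apply/measurable_EFinP; exact: (measurableT_comp mcos mX).
  - exists [set w | X w != 0]; split => //.
      exact: measurable_neq0.
    by move=> w /=; apply: contra_not_neq => -> _; rewrite add0r.
have : \int[P]_w (cos (X w + c) + 1) = \int[normal_prob 0 s]_x (cos (x + c) + 1).
  congr fine; apply: (@ge0_integral_law X (normal_prob 0 s) (fun x => (cos (x + c) + 1)%:E)) => //.
    by apply/measurable_EFinP; exact: measurable_funD.
rewrite !RintegralD//; last 4 first.
- by apply: (@bounded_integrable _ _ _ (normal_prob 0 s) (fun x => cos (x + c)) 1).
- by apply: (@bounded_integrable _ _ _ (normal_prob 0 s) (cst 1) 1) => // x; rewrite normr1.
- by apply: (@bounded_integrable _ _ _ P (fun w => cos (X w + c)) 1) => //; exact: (measurableT_comp mcos mX).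
- by apply: (@bounded_integrable _ _ _ P (cst 1) 1) => // x; rewrite normr1.
rewrite !Rintegral_probability_cst => /addIr ->.
rewrite (Rintegral_normal_prob _ _ mcos (fun x => cos1 _)).
have := Rintegral_cos_normal_pdf 1 c s0; rewrite expr1n mulr1 sq => <-.
by apply: eq_Rintegral => x _; rewrite mul1r.
Qed.

End gaussian_variable.

(** * Small balls *)

Section L2_limits.
Context d (Om : measurableType d) (R : realType) (P : probability Om R).
Variables (Y : Om -> R) (S : nat -> Om -> R) (q_ : nat -> R) (q : R).
Hypotheses (mY : measurable_fun setT Y) (mS : forall n, measurable_fun setT (S n)).
Hypothesis q_q : q_ n @[n --> \oo] --> q.
Hypothesis S_Y : (\int[P]_w ((Y w - S n w) ^+ 2)%:E)%E @[n --> \oo] --> 0%E.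

Let m2 n : measurable_fun setT (fun w => (Y w - S n w) ^+ 2).
Proof. by apply: measurable_funX; exact: measurable_funB. Qed.

Let near_small (e : R) : 0 < e ->
  \forall n \near \oo, (\int[P]_w ((Y w - S n w) ^+ 2)%:E <= e%:E)%E.
Proof.
move=> e0; have [fS f0] := (fine_cvgP _ _).1 S_Y.
near=> n; rewrite -[leLHS]fineK; last by near: n.
rewrite lee_fin -[leLHS]subr0 (le_trans (ler_norm _))// distrC.
by near: n; exact: (cvgrPdist_le _ _).1 f0 _ e0.
Unshelve. all: by end_near. Qed.

(** The cosine is 1-Lipschitz, so convergence in [L^2] carries the transforms, and nothing else
    about the laws, to the limit. *)
Lemma L2_limit_cos c :
  (forall n, \int[P]_w cos (S n w + c) = cos c * expR (- (q_ n / 2))) ->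
  \int[P]_w cos (Y w + c) = cos c * expR (- (q / 2)).
Proof.
move=> Scos; have cos1 (x : R) : `|cos x| <= 1 by rewrite ler_norml cos_geN1 cos_le1.
have mcos (Z : Om -> R) : measurable_fun setT Z -> measurable_fun setT (fun w => cos (Z w + c)).
  move=> mZ; have : measurable_fun setT (fun x : R => cos (x + c)).
    apply: continuous_measurable_fun => x.
    apply: (continuous_comp (f := fun x => x + c)); last exact: continuous_cos.
    by apply: cvgD => //; exact: cvg_cst.
  by move=> mc; exact: (measurableT_comp mc mZ).
have icos (Z : Om -> R) : measurable_fun setT Z -> P.-integrable setT (EFin \o (fun w => cos (Z w + c))).
  by move=> mZ; apply: (@bounded_integrable _ _ _ P _ 1) => //; exact: mcos.
have lim1 : \int[P]_w cos (S n w + c) @[n --> \oo] --> \int[P]_w cos (Y w + c).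
  apply/cvgrPdist_le => e e0; have e20 : 0 < e / 2 by rewrite divr_gt0.
  have ee : 0 < (e / 2) ^+ 2 by rewrite exprn_gt0.
  near=> n; have hn : (\int[P]_w ((Y w - S n w) ^+ 2)%:E <= ((e / 2) ^+ 2)%:E)%E.
    by near: n; exact: near_small.
  have i2 : P.-integrable setT (EFin \o (fun w => (Y w - S n w) ^+ 2)).
    apply/integrableP; split; first exact/measurable_EFinP.
    under eq_integral do rewrite /= ger0_norm ?sqr_ge0//.
    exact: le_lt_trans hn (ltry _).
  have i3 : P.-integrable setT (EFin \o (fun w => (e / 2)^-1 * (Y w - S n w) ^+ 2)).
    by apply: eq_integrable (integrableZl measurableT (e / 2)^-1 i2) => // w _; rewrite /= EFinM.
  have i4 : P.-integrable setT (EFin \o cst (e / 2)).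
    by apply: (@bounded_integrable _ _ _ P _ `|e / 2|).
  rewrite -RintegralB//; try exact: icos.
  apply: le_trans (le_normr_Rintegral _ _) _ => //.
    by have := integrableB measurableT (icos _ mY) (icos _ (mS n)); under eq_fun do rewrite -EFinB.
  (* The pointwise inequality [a <= b + a ^ 2 / b] with [b = e / 2] takes the place of the
     Cauchy-Schwarz inequality. *)
  apply: (@le_trans _ _ (\int[P]_w (e / 2 + (e / 2)^-1 * (Y w - S n w) ^+ 2))).
    apply: le_Rintegral => //.
    - exact: (integrable_norm (integrableB measurableT (icos _ mY) (icos _ (mS n)))).
    - exact: (integrableD measurableT i4 i3).
    - move=> w _; apply: le_trans (lipschitz_cos _ _) _.
      rewrite opprD addrACA subrr addr0 -[X in _ <= _ + _ * X]real_normK ?num_real//.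
      set a := `|_|; set b := e / 2; have b0 : b != 0 by rewrite gt_eqF.
      rewrite -(ler_pM2l e20) -/b mulrDr mulVKf//.
      have := sqr_ge0 (b - a); have := sqr_ge0 a; have := sqr_ge0 b; nra.
  rewrite RintegralD// Rintegral_probability_cst RintegralZl//.
  rewrite [leRHS](_ : e = e / 2 + e / 2); last by field.
  rewrite lerD2l ler_pdivrMl// -expr2 -lee_fin fineK//.
  exact: integrable_fin_num.
have lim2 : cos c * expR (- (q_ n / 2)) @[n --> \oo] --> cos c * expR (- (q / 2)).
  apply: cvgMl_tmp; apply: (cvg_comp _ expR); last exact: continuous_expR.
  by apply: cvgN; exact: cvgMr_tmp.
rewrite -(cvg_lim _ lim2)//; apply/esym/cvg_lim => //.
by under eq_fun do rewrite -Scos.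
Unshelve. all: by end_near. Qed.

(** If [|Y| > u] then [|S n| > u / 2] or [|Y - S n| > u / 2]; Chebyshev's inequality makes the
    second event as unlikely as desired. Halving [u] turns [4 q'] into [16 q'], and the strict
    inequality [q < q'] ensures [q_ n <= q'] eventually. *)
Lemma L2_limit_tail (q' u : R) : q < q' -> 0 < q' -> 0 < u ->
  (forall n, q_ n <= q' -> (P [set w | (u / 2 < `|S n w|)%R] <=
     (2 * expR (- ((u / 2) ^+ 2 / (4 * q'))))%:E)%E) ->
  (P [set w | (u < `|Y w|)%R] <= (2 * expR (- (u ^+ 2 / (16 * q'))))%:E)%E.
Proof.
move=> qq' q'0 u0 Stail; apply/lee_addgt0Pr => e e0.
have e1 : 0 < e * (u / 2) ^+ 2 by rewrite mulr_gt0// exprn_gt0// divr_gt0.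
have [N _ HN] : \forall n \near \oo, (q_ n <= q') /\
    (\int[P]_w ((Y w - S n w) ^+ 2)%:E <= (e * (u / 2) ^+ 2)%:E)%E.
  apply: filterS2 (near_small e1) (cvgr_lt _ q_q _ qq') => n h1 h2.
  by split => //; exact: ltW.
have /= [hq h2] := HN N (leqnn N).
have mY' := measurable_norm_gt u mY.
have mS' := measurable_norm_gt (u / 2) (mS N).
have mD' := measurable_norm_gt (u / 2) (measurable_funB mY (mS N)).
apply: (@le_trans _ _ (P ([set w | (u / 2 < `|S N w|)%R] `|` [set w | (u / 2 < `|Y w - S N w|)%R]))).
  apply: le_measure; rewrite ?inE//; first exact: measurableU.
  move=> w /= uY; apply: contrapT => /not_orP[] /negP; rewrite -leNgt => h3 /negP; rewrite -leNgt => h4.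
  move: uY; rewrite -[Y w](subrK (S N w)) => /lt_le_trans /(_ (ler_normD _ _)).
  by move: h3 h4; lra.
apply: (le_trans (measureU2 _ mS' mD')); apply: leeD.
  apply: le_trans (Stail _ hq) _; rewrite lee_fin ler_wpM2l// ler_expR lerN2.
  by rewrite le_eqVlt; apply/orP; left; apply/eqP; field; rewrite gt_eqF.
have u2 : 0 < (u / 2) ^+ 2 by rewrite exprn_gt0// divr_gt0.
rewrite -(@lee_pmul2l _ ((u / 2) ^+ 2)%:E)//.
rewrite -EFinM [X in (_ <= X%:E)%E]mulrC; apply: le_trans h2.
rewrite -integral_cst// [leLHS](_ : _ = \int[P]_(w in [set w | (u / 2 < `|Y w - S N w|)%R]) ((u / 2) ^+ 2)%:E)%E//.
apply: (@le_trans _ _ (\int[P]_(w in [set w | (u / 2 < `|Y w - S N w|)%R]) ((Y w - S N w) ^+ 2)%:E)%E).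
  apply: ge0_le_integral => //.
  - by move=> w _; rewrite lee_fin ltW.
  - by apply/measurable_EFinP/measurable_funTS.
  - move=> w /= /ltW h; rewrite lee_fin -[leRHS]real_normK ?num_real//.
    by rewrite ler_sqr ?nnegrE// divr_ge0// ltW.
apply: ge0_subset_integral => //; first exact/measurable_EFinP.
by move=> w _; rewrite lee_fin sqr_ge0.
Qed.

End L2_limits.

(** * Expectations of Gaussian bumps through cosine transforms *)

Section gaussian_bump.
Context d (Om : measurableType d) (R : realType) (P : probability Om R).
Local Notation N := (normal_prob (0 : R) 1).
Implicit Types (Y B : Om -> R).

Let cos1 (x : R) : `|cos x| <= 1.
Proof. by rewrite ler_norml cos_geN1 cos_le1. Qed.

Let mcos : measurable_fun [set: R] (cos : R -> R).
Proof. by apply: continuous_measurable_fun; exact: continuous_cos. Qed.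

(** The bump [exp (- y ^ 2 / 2)] is an average of cosines, so that its expectation at
    a random variable is determined by the characteristic function: no density
    of the variable is needed, and degenerate laws are not a special case. *)
Lemma gauss_bump_cos (y : R) : \int[N]_x cos (x * y) = expR (- (y ^+ 2 / 2)).
Proof.
have h : measurable_fun [set: R] (fun x : R => cos (x * y)).
  apply: (measurableT_comp mcos); exact: measurable_funM.
rewrite (Rintegral_normal_prob _ _ h (fun x => cos1 _)).
have := Rintegral_cos_normal_pdf y 0 (oner_neq0 R).
rewrite expr1n cos0 !mul1r => <-.
by apply: eq_Rintegral => x _; rewrite addr0 mulrC [y * x]mulrC mulrC.
Qed.

Let fourier_kernel B Y (p : Om * measurableTypeR R) := B p.1 * cos (p.2 * Y p.1).

Let measurable_fourier_kernel B Y : measurable_fun setT B -> measurable_fun setT Y ->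
  measurable_fun setT (fourier_kernel B Y).
Proof.
move=> mB mY; apply: measurable_funM; first exact: (measurableT_comp mB measurable_fst).
apply: (measurableT_comp mcos); apply: measurable_funM; first exact: measurable_snd.
exact: (measurableT_comp mY measurable_fst).
Qed.

Let fourier_kernel1 B Y p : (forall w, `|B w| <= 1) -> `|fourier_kernel B Y p| <= 1.
Proof.
by move=> B1; rewrite /fourier_kernel normrM -[leRHS]mulr1 ler_pM.
Qed.

Let integrable_fourier_kernel B Y : measurable_fun setT B -> (forall w, `|B w| <= 1) ->
  measurable_fun setT Y ->
  (P \x N)%E.-integrable setT (EFin \o fourier_kernel B Y).
Proof.
move=> mB B1 mY; apply: measurable_bounded_integrable => //.
- have : (((P \x N) (setT `*` setT)) < +oo)%E.
    rewrite product_measure1E// lte_mul_pinfty//; first exact: fin_num_measure.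
    exact: (le_lt_trans (probability_le1 N measurableT) (ltry _)).
  by rewrite setXTT.
- exact: measurable_fourier_kernel.
exists 1; split; [exact: num_real|move=> M M1 p _].
exact: le_trans (fourier_kernel1 _ _ B1) (ltW M1).
Qed.

Let fourier_innerE B Y x : measurable_fun setT B -> (forall w, `|B w| <= 1) ->
  measurable_fun setT Y ->
  (\int[P]_w (EFin \o fourier_kernel B Y) (w, x) =
   (\int[P]_w (B w * cos (x * Y w)))%:E)%E.
Proof.
move=> mB B1 mY; rewrite fineK//; apply: integrable_fin_num => //.
apply: (@bounded_integrable _ _ _ P (fun w => fourier_kernel B Y (w, x)) 1) => [|w].
  apply: measurable_funM => //.
  by apply: (measurableT_comp mcos); exact: measurable_funM.
exact: fourier_kernel1.
Qed.

Lemma measurable_fourier B Y : measurable_fun setT B -> (forall w, `|B w| <= 1) ->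
  measurable_fun setT Y ->
  measurable_fun [set: measurableTypeR R] (fun x => \int[P]_w (B w * cos (x * Y w))).
Proof.
move=> mB B1 mY; apply/measurable_EFinP.
have := measurable_fubini_G (integrable_fourier_kernel mB B1 mY).
by apply: eq_measurable_fun => x _; rewrite /fubini_G fourier_innerE.
Qed.

(** Fubini's theorem with the auxiliary normal variable [x]. The bounded weight [B] makes a second
    application possible when a product of two bumps is expanded. *)
Lemma bump_fourier B Y : measurable_fun setT B -> (forall w, `|B w| <= 1) ->
  measurable_fun setT Y ->
  \int[P]_w (B w * expR (- (Y w ^+ 2 / 2))) =
  \int[N]_x \int[P]_w (B w * cos (x * Y w)).
Proof.
move=> mB B1 mY.
have := Fubini (integrable_fourier_kernel mB B1 mY).
have -> : (\int[P]_x \int[N]_y (EFin \o fourier_kernel B Y) (x, y))%E =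
    (\int[P]_w (B w * expR (- (Y w ^+ 2 / 2)))%:E)%E.
  apply: eq_integral => w _; rewrite -gauss_bump_cos -RintegralZl//; last first.
    apply: (@bounded_integrable _ _ _ N (fun x => cos (x * Y w)) 1) => //.
    by apply: (measurableT_comp mcos); exact: measurable_funM.
  rewrite fineK//; apply: integrable_fin_num => //.
  apply: (@bounded_integrable _ _ _ N (fun x => fourier_kernel B Y (w, x)) 1) => [|x].
    exact: (measurableT_comp (measurable_fourier_kernel mB mY) (measurable_pair1 w)).
  exact: fourier_kernel1.
have -> : (\int[N]_y \int[P]_x (EFin \o fourier_kernel B Y) (x, y))%E =
    (\int[N]_x (\int[P]_w (B w * cos (x * Y w)))%:E)%E.
  by apply: eq_integral => x _; exact: fourier_innerE.
by move=> /(congr1 fine).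
Qed.

End gaussian_bump.

Section gaussian_quadratic.
Variable R : realType.
Local Notation N := (normal_prob (0 : R) 1).
Implicit Types A B x : R.

Let sqrt1D_neq0 A : 0 <= A -> Num.sqrt (1 + A) != 0.
Proof. by move=> A0; rewrite gt_eqF// sqrtr_gt0 ltr_wpDr. Qed.

(** Completion of the square: a normal density tilted by a quadratic exponential is again a normal
    density, up to its total mass. *)
Lemma normal_pdf_quadratic A B x : 0 <= A ->
  expR (- (A * x ^+ 2 / 2 + B * x)) * normal_pdf 0 1 x =
  (Num.sqrt (1 + A))^-1 * expR (B ^+ 2 / (2 * (1 + A))) *
  normal_pdf (- (B / (1 + A))) (Num.sqrt (1 + A))^-1 x.
Proof.
move=> A0; have s0 := sqrt1D_neq0 A0; have A1 : 1 + A != 0 by rewrite gt_eqF// ltr_wpDr.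
rewrite !normal_pdfE ?oner_neq0 ?invr_neq0// /normal_peak /normal_fun.
rewrite exprVn sqr_sqrtr ?addr_ge0// expr1n mul1r subr0.
rewrite -[_^-1 * pi *+ 2]mulrnAr [in RHS]sqrtrM ?invr_ge0 ?addr_ge0// sqrtrV ?addr_ge0//.
set p := Num.sqrt (pi *+ 2); have p0 : p != 0 by rewrite gt_eqF// sqrtr_gt0 mulrn_wgt0// pi_gt0.
have -> : expR (- (A * x ^+ 2 / 2 + B * x)) * (p^-1 * expR (- x ^+ 2 / 2)) =
   p^-1 * (expR (- (A * x ^+ 2 / 2 + B * x)) * expR (- x ^+ 2 / 2)) by ring.
have -> : (Num.sqrt (1 + A))^-1 * expR (B ^+ 2 / (2 * (1 + A))) *
   (((Num.sqrt (1 + A))^-1 * p)^-1 * expR (- (x - - (B / (1 + A))) ^+ 2 / ((1 + A)^-1 *+ 2))) =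
   p^-1 * (expR (B ^+ 2 / (2 * (1 + A))) * expR (- (x - - (B / (1 + A))) ^+ 2 / ((1 + A)^-1 *+ 2))).
  by field; rewrite p0.
by rewrite -!expRD; congr (_ * expR _); field.
Qed.

Lemma measurable_exp_quadratic A B :
  measurable_fun [set: measurableTypeR R] (fun x => expR (- (A * x ^+ 2 / 2 + B * x))).
Proof.
apply: continuous_measurable_fun.
apply: (@is_derive_continuous _ _ (fun x => - (A * x + B) * expR (- (A * x ^+ 2 / 2 + B * x)))) => x.
have d1 : is_derive x 1 (fun x : R => - (A * x ^+ 2 / 2 + B * x)) (- (A * x + B)).
  by apply: is_derive_eq; rewrite /GRing.scale/=; field.
apply: is_derive_eq (is_derive_fun_comp (is_derive_expR _) d1) _.
by rewrite mulrC.
Qed.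

Lemma integral_normal_quadratic A B : 0 <= A ->
  (\int[N]_x (expR (- (A * x ^+ 2 / 2 + B * x)))%:E =
   ((Num.sqrt (1 + A))^-1 * expR (B ^+ 2 / (2 * (1 + A))))%:E)%E.
Proof.
move=> A0; rewrite ge0_integral_normal_prob//; last first.
  by apply/measurable_EFinP; exact: measurable_exp_quadratic.
under eq_integral do rewrite -EFinM normal_pdf_quadratic// EFinM.
by rewrite integralZl ?integral_normal_pdf ?mule1//; exact: integrable_normal_pdf.
Qed.

End gaussian_quadratic.

Section gaussian_small_balls.
Context d (Om : measurableType d) (R : realType) (P : probability Om R).
Local Notation N := (normal_prob (0 : R) 1).
Implicit Types (Y : Om -> R).

Let cos1 (x : R) : `|cos x| <= 1.
Proof. by rewrite ler_norml cos_geN1 cos_le1. Qed.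

Let mcos : measurable_fun [set: R] (cos : R -> R).
Proof. by apply: continuous_measurable_fun; exact: continuous_cos. Qed.

Let mexp : measurable_fun [set: R] (fun x : R => expR (- (x ^+ 2 / 2))).
Proof.
apply: measurableT_comp => //; apply: measurableT_comp => //.
by apply: measurable_funM => //; exact: measurable_funX.
Qed.

Let exp1 (x : R) : `|expR (- (x ^+ 2 / 2))| <= 1.
Proof.
by rewrite ger0_norm ?expR_ge0// -[leRHS]expR0 ler_expR oppr_le0 divr_ge0 ?sqr_ge0.
Qed.

(** Up to the factor [sqrt (2 pi)], the right-hand side is the density at [0] of a normal law of
    mean [m] and variance [1 + A], the law of [Y] plus an independent standard normal variable. *)
Lemma Rintegral_bump1 Y (m A : R) : measurable_fun setT Y -> 0 <= A ->
  (forall a c, \int[P]_w cos (a * Y w + c) =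
     cos (a * m + c) * expR (- (a ^+ 2 * A / 2))) ->
  \int[P]_w expR (- (Y w ^+ 2 / 2)) =
  (Num.sqrt (1 + A))^-1 * expR (- (m ^+ 2 / (2 * (1 + A)))).
Proof.
move=> mY A0 Ycos.
have -> : \int[P]_w expR (- (Y w ^+ 2 / 2)) =
   \int[P]_w (cst 1 w * expR (- (Y w ^+ 2 / 2))).
  by apply: eq_Rintegral => w _; rewrite mul1r.
rewrite bump_fourier//; last by move=> w; rewrite normr1.
have E x : \int[P]_w (cst 1 w * cos (x * Y w)) = cos (m * x + 0) * expR (- (A * x ^+ 2 / 2 + 0 * x)).
  transitivity (\int[P]_w cos (x * Y w + 0)).
    by apply: eq_Rintegral => w _; rewrite mul1r addr0.
  by rewrite Ycos; congr (cos _ * expR (- _)); ring.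
under eq_Rintegral do rewrite E.
have s0 : Num.sqrt (1 + A) != 0 by rewrite gt_eqF// sqrtr_gt0 ltr_wpDr.
rewrite (@Rintegral_normal_prob _ _ _ _ 1); last 2 first.
- apply: measurable_funM; first by apply: (measurableT_comp mcos); apply: measurable_funD => //; exact: measurable_funM.
  exact: measurable_exp_quadratic.
- move=> x; rewrite normrM -[leRHS]mulr1 ler_pM// ger0_norm ?expR_ge0//.
  by rewrite -[leRHS]expR0 ler_expR oppr_le0 mul0r addr0 divr_ge0// mulr_ge0// sqr_ge0.
under eq_Rintegral do rewrite -mulrA normal_pdf_quadratic// mul0r oppr0 expr0n/= mul0r expR0 mulr1 mulrCA.
rewrite RintegralZl//; last first.
  apply: (@integrable_bounded_normal_pdf _ _ _ _ 1); last by [].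
  by apply: (measurableT_comp mcos); apply: measurable_funD => //; exact: measurable_funM.
rewrite Rintegral_cos_normal_pdf ?invr_neq0// cos0 mul1r; congr (_ * expR (- _)).
by rewrite exprVn sqr_sqrtr ?addr_ge0//; field; rewrite gt_eqF// ltr_wpDr.
Qed.

(** The right-hand side is the exact value for centered variables, with the determinant of the
    covariance matrix plus the identity. Means enter only through cosines, which are bounded by one;
    what remains is a Gaussian integral, computed in one variable after the other. *)
Lemma Rintegral_bump2_le Y1 Y2 (m1 m2 A B C : R) :
  measurable_fun setT Y1 -> measurable_fun setT Y2 ->
  0 <= A -> 0 <= C -> B ^+ 2 <= A * C ->
  (forall a b c, \int[P]_w cos (a * Y1 w + b * Y2 w + c) =
     cos (a * m1 + b * m2 + c) *
     expR (- ((a ^+ 2 * A + 2 * a * b * B + b ^+ 2 * C) / 2))) ->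
  \int[P]_w (expR (- (Y1 w ^+ 2 / 2)) * expR (- (Y2 w ^+ 2 / 2))) <=
  (Num.sqrt ((1 + A) * (1 + C) - B ^+ 2))^-1.
Proof.
move=> mY1 mY2 A0 C0 BAC Ycos.
have mE2 : measurable_fun setT (fun w => expR (- (Y2 w ^+ 2 / 2))) := measurableT_comp mexp mY2.
have mC1 x : measurable_fun setT (fun w => cos (x * Y1 w)).
  by apply: (measurableT_comp mcos); exact: measurable_funM.
have C1p : 0 < 1 + C by rewrite ltr_wpDr.
(* The Schur complement: the coefficient of [x ^ 2] once [y] has been integrated out. *)
pose A' := A - B ^+ 2 / (1 + C).
have A'0 : 0 <= A'.
  rewrite /A' subr_ge0 ler_pdivrMr// mulrDr mulr1; apply: le_trans BAC _.
  by rewrite lerDr.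
pose k := (Num.sqrt (1 + C))^-1.
have inner x y : \int[P]_w (cos (x * Y1 w) * cos (y * Y2 w)) <=
    2^-1 * (expR (- (C * y ^+ 2 / 2 + x * B * y)) +
            expR (- (C * y ^+ 2 / 2 + - (x * B) * y))) * expR (- (x ^+ 2 * A / 2)).
  have -> : \int[P]_w (cos (x * Y1 w) * cos (y * Y2 w)) =
     \int[P]_w (2^-1 * (cos (x * Y1 w + y * Y2 w + 0) + cos (x * Y1 w + (- y) * Y2 w + 0))).
    apply: eq_Rintegral => w _; by rewrite !addr0 mulNr cosD cosB; field.
  have mc a b : measurable_fun setT (fun w => cos (a * Y1 w + b * Y2 w + 0)).
    apply: (measurableT_comp mcos); apply: measurable_funD => //.
    by apply: measurable_funD; exact: measurable_funM.
  have ic a b : P.-integrable setT (EFin \o (fun w => cos (a * Y1 w + b * Y2 w + 0))).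
    by apply: (@bounded_integrable _ _ _ P _ 1).
  rewrite RintegralZl//; last exact: (integrableD measurableT (ic _ _) (ic _ _)).
  rewrite RintegralD// !Ycos -[leRHS]mulrA; apply: ler_wpM2l => //.
  rewrite [leRHS]mulrDl -!expRD; apply: lerD.
    apply: le_trans (ler_norm _) _; rewrite normrM (ger0_norm (expR_ge0 _)).
    rewrite -[leRHS]mul1r; apply: ler_pM => //; rewrite ?expR_ge0//.
    by rewrite ler_expR le_eqVlt; apply/orP; left; apply/eqP; field.
  apply: le_trans (ler_norm _) _; rewrite normrM (ger0_norm (expR_ge0 _)).
  rewrite -[leRHS]mul1r; apply: ler_pM => //; rewrite ?expR_ge0//.
  by rewrite ler_expR le_eqVlt; apply/orP; left; apply/eqP; field.
have B1 w : `|expR (- (Y2 w ^+ 2 / 2))| <= 1 by exact: exp1.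
have -> : \int[P]_w (expR (- (Y1 w ^+ 2 / 2)) * expR (- (Y2 w ^+ 2 / 2))) =
  \int[P]_w (expR (- (Y2 w ^+ 2 / 2)) * expR (- (Y1 w ^+ 2 / 2))).
  by apply: eq_Rintegral => w _; rewrite mulrC.
rewrite bump_fourier//.
have mid x : \int[P]_w (expR (- (Y2 w ^+ 2 / 2)) * cos (x * Y1 w)) <=
    k * expR (- (A' * x ^+ 2 / 2 + 0 * x)).
  have -> : \int[P]_w (expR (- (Y2 w ^+ 2 / 2)) * cos (x * Y1 w)) =
    \int[P]_w (cos (x * Y1 w) * expR (- (Y2 w ^+ 2 / 2))).
    by apply: eq_Rintegral => w _; rewrite mulrC.
  rewrite bump_fourier//.
  have iq b : N.-integrable setT (EFin \o (fun y => expR (- (C * y ^+ 2 / 2 + b * y)))).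
    apply/integrableP; split.
      by apply/measurable_EFinP; exact: measurable_exp_quadratic.
    under eq_integral do rewrite /= ger0_norm ?expR_ge0//.
    by rewrite integral_normal_quadratic// ltry.
  have iq2 := integrableD measurableT (iq (x * B)) (iq (- (x * B))).
  have iq3 := integrableZl measurableT (2^-1) iq2.
  have iq4 := integrableZr measurableT (expR (- (x ^+ 2 * A / 2))) iq3.
  apply: (@le_trans _ _ (\int[N]_y (2^-1 * (expR (- (C * y ^+ 2 / 2 + x * B * y)) +
            expR (- (C * y ^+ 2 / 2 + - (x * B) * y))) * expR (- (x ^+ 2 * A / 2))))).
    apply: le_Rintegral => //.
    apply: (@bounded_integrable _ _ _ N (fun y => \int[P]_w (cos (x * Y1 w) * cos (y * Y2 w))) 1).
      exact: measurable_fourier.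
    move=> y; apply: Rintegral_le_bounded.
      apply: measurable_funM => //.
      by apply: (measurableT_comp mcos); exact: measurable_funM.
    by move=> w; rewrite normrM -[leRHS]mulr1 ler_pM.
  rewrite RintegralZr// RintegralZl// RintegralD//.
  have half (z : R) : 2^-1 * (z + z) = z by field.
  rewrite /Rintegral !integral_normal_quadratic//= sqrrN half -[leLHS]mulrA -expRD.
  rewrite ler_wpM2l ?invr_ge0 ?sqrtr_ge0// ler_expR /A' le_eqVlt; apply/orP; left; apply/eqP.
  by field; rewrite gt_eqF.
apply: (@le_trans _ _ (\int[N]_x (k * expR (- (A' * x ^+ 2 / 2 + 0 * x))))).
  apply: le_Rintegral => //.
    apply: (@bounded_integrable _ _ _ N (fun x => \int[P]_w (expR (- (Y2 w ^+ 2 / 2)) * cos (x * Y1 w))) 1).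
      exact: measurable_fourier.
    move=> x; apply: Rintegral_le_bounded; first exact: measurable_funM.
    by move=> w; rewrite normrM -[leRHS]mulr1 ler_pM.
  apply: (@bounded_integrable _ _ _ N (fun x => k * expR (- (A' * x ^+ 2 / 2 + 0 * x))) k).
    apply: measurable_funM => //.
    exact: measurable_exp_quadratic.
  move=> x; rewrite normrM ger0_norm ?invr_ge0 ?sqrtr_ge0// ler_piMr ?invr_ge0 ?sqrtr_ge0//.
  rewrite ger0_norm ?expR_ge0// -[leRHS]expR0 ler_expR oppr_le0 mul0r addr0.
  by rewrite divr_ge0// mulr_ge0// sqr_ge0.
rewrite RintegralZl//; last first.
  apply: (@bounded_integrable _ _ _ N (fun x => expR (- (A' * x ^+ 2 / 2 + 0 * x))) 1).
    exact: measurable_exp_quadratic.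
  move=> x; rewrite ger0_norm ?expR_ge0// -[leRHS]expR0 ler_expR oppr_le0 mul0r addr0.
  by rewrite divr_ge0// mulr_ge0// sqr_ge0.
rewrite /Rintegral integral_normal_quadratic//= expr0n/= mul0r expR0 mulr1 -invfM.
rewrite -sqrtrM; last exact: ltW.
by rewrite (_ : (1 + C) * (1 + A') = (1 + A) * (1 + C) - B ^+ 2)// /A'; field; rewrite gt_eqF.
Qed.

Lemma Rintegral_indic_prob (D : set Om) : measurable D ->
  \int[P]_w \1_D w = fine (P D).
Proof. by move=> mD; rewrite /Rintegral integral_indic// setIT. Qed.

Let bounded_indic (D : set Om) : measurable D -> P.-integrable setT (EFin \o \1_D).
Proof.
move=> mD; apply: (@bounded_integrable _ _ _ P _ 1) => //.
by move=> w; rewrite indicE; case: (_ \in _); rewrite ?normr1 ?normr0.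
Qed.

Lemma prob_le_Rintegral (D : set Om) (f : Om -> R) : measurable D ->
  P.-integrable setT (EFin \o f) -> (forall w, 0 <= f w) -> (forall w, D w -> 1 <= f w) ->
  fine (P D) <= \int[P]_w f w.
Proof.
move=> mD intf f0 f1; rewrite -Rintegral_indic_prob//; apply: le_Rintegral => //.
  exact: bounded_indic.
move=> w _; rewrite indicE; case: (boolP (w \in D)) => [/set_mem/f1//|_].
exact: f0.
Qed.

Lemma Rintegral_le_prob (D : set Om) (f : Om -> R) : measurable D ->
  P.-integrable setT (EFin \o f) -> (forall w, f w <= 1) -> (forall w, ~ D w -> f w <= 0) ->
  \int[P]_w f w <= fine (P D).
Proof.
move=> mD intf f1 f0; rewrite -Rintegral_indic_prob//; apply: le_Rintegral => //.
  exact: bounded_indic.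
move=> w _; rewrite indicE; case: (boolP (w \in D)) => [_|/negP h]; first exact: f1.
by apply: f0 => Dw; apply: h; rewrite inE.
Qed.

Let mscale (v : Om -> R) (z s : R) : measurable_fun setT v ->
  measurable_fun setT (fun w => (v w - z) / s).
Proof. by move=> mv; apply: measurable_funM => //; exact: measurable_funB. Qed.

Lemma measurable_ball (v : Om -> R) (z e : R) : measurable_fun setT v ->
  measurable [set w | (`|v w - z| <= e)%R].
Proof.
move=> mv; have := measurable_norm_gt e (measurable_funB mv (measurable_cst z)).
move=> /measurableC; congr (measurable _); apply/seteqP; split => w /=.
  by move/negP; rewrite -leNgt.
by move=> h; apply/negP; rewrite -leNgt.
Qed.

Section one_point.
Variables (v : Om -> R) (m A : R).
Hypotheses (mv : measurable_fun setT v) (A0 : 0 < A).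
Hypothesis vcos : forall a c, \int[P]_w cos (a * v w + c) =
  cos (a * m + c) * expR (- (a ^+ 2 * A / 2)).

Let ibump (z s : R) : P.-integrable setT (EFin \o (fun w => expR (- (((v w - z) / s) ^+ 2 / 2)))).
Proof.
apply: (@bounded_integrable _ _ _ P _ 1); last by move=> w; exact: exp1.
exact: (measurableT_comp mexp (mscale z s mv)).
Qed.

Lemma Rintegral_bump_scaled (z s : R) : 0 < s ->
  \int[P]_w expR (- (((v w - z) / s) ^+ 2 / 2)) =
  s / Num.sqrt (s ^+ 2 + A) * expR (- ((m - z) ^+ 2 / (2 * (s ^+ 2 + A)))).
Proof.
move=> s0; have s20 : 0 < s ^+ 2 by rewrite exprn_gt0.
rewrite (@Rintegral_bump1 _ ((m - z) / s) (A / s ^+ 2)); last 3 first.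
- exact: mscale.
- by rewrite divr_ge0// ltW.
- move=> a c.
  rewrite (_ : \int[P]_w _ = \int[P]_w cos (a / s * v w + (c - a * z / s))).
    by rewrite vcos; congr (cos _ * expR (- _)); field; rewrite gt_eqF.
  by apply: eq_Rintegral => w _; congr cos; field; rewrite gt_eqF.
have -> : 1 + A / s ^+ 2 = (s ^+ 2 + A) / s ^+ 2 by field; rewrite gt_eqF.
rewrite sqrtrM ?addr_ge0 ?ltW// sqrtrV ?ltW// sqrtr_sqr gtr0_norm// invfM invrK [_^-1 * s]mulrC.
congr (_ * expR (- _)); field.
by apply/andP; split; rewrite gt_eqF// addr_gt0.
Qed.

(** Since [2 exp (- y ^ 2 / 2) >= 1] for [|y| <= 1], twice the bump of width [e] dominates the
    indicator of the ball. *)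
Lemma small_ball_upper (z e : R) : 0 < e ->
  fine (P [set w | (`|v w - z| <= e)%R]) <= 2 * e / Num.sqrt A.
Proof.
move=> e0; apply: (@le_trans _ _ (\int[P]_w (2 * expR (- (((v w - z) / e) ^+ 2 / 2))))).
  apply: prob_le_Rintegral.
  - exact: measurable_ball.
  - exact: (integrableZl measurableT 2 (ibump z e)).
  - by move=> w; rewrite mulr_ge0// expR_ge0.
  - move=> w /= we; rewrite -ler_pdivrMl// mulr1.
    apply: le_trans (expR_ge1Dx _); rewrite -(@ler_pM2l _ 2)// divff// mulrDr mulr1 mulrN mulrC.
    rewrite divfK// lerBrDl -lerBrDr (_ : 2 - 1 = 1); last by ring.
    rewrite -[leRHS](expr1n _ 2) -[leLHS]real_normK ?num_real// lerXn2r ?nnegrE//.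
    by rewrite normrM normfV (gtr0_norm e0) ler_pdivrMr// mul1r.
rewrite RintegralZl//.
rewrite Rintegral_bump_scaled// -[leRHS]mulrA ler_wpM2l// -[leRHS]mulr1 ler_pM//.
- by rewrite divr_ge0 ?sqrtr_ge0// ltW.
- rewrite ler_wpM2l ?(ltW e0)// lef_pV2 ?posrE ?sqrtr_gt0// ?ler_sqrt ?lerDr ?sqr_ge0//.
  + by rewrite addr_ge0 ?sqr_ge0// ltW.
  + by rewrite ltr_wpDl ?sqr_ge0.
- rewrite -[leRHS]expR0 ler_expR oppr_le0 divr_ge0 ?sqr_ge0// mulr_ge0// addr_ge0 ?sqr_ge0//.
  exact: ltW.
Qed.

(** Here [s0] and [s1] enclose the variance and [mu] bounds the distance from the mean to the
    target, so that [b] bounds the Gaussian exponent. The denominator is [2 K sqrt (1 + s1)] for the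
    [K] of [small_ball_lower]. *)
Definition small_ball_const (s0 s1 mu : R) : R :=
  let b := mu ^+ 2 / (2 * s0) in
  expR (- b) / (2 * (2 * Num.sqrt (b + 2)) * Num.sqrt (1 + s1)).

Lemma small_ball_const_gt0 (s0 s1 mu : R) : 0 < s0 -> 0 <= s1 -> 0 < small_ball_const s0 s1 mu.
Proof.
move=> s00 s10; rewrite /small_ball_const divr_gt0 ?expR_gt0//.
have b0 : 0 <= mu ^+ 2 / (2 * s0) by rewrite divr_ge0 ?sqr_ge0// mulr_ge0// ltW.
apply: mulr_gt0; last by rewrite sqrtr_gt0 ltr_wpDr.
by rewrite !mulr_gt0// sqrtr_gt0 ltr_wpDl.
Qed.

(** For [K = 2 sqrt (b + 2)] and [s = e / K], the indicator of [|y| <= e] dominates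
    [exp (- y ^ 2 / (2 s ^ 2)) - exp (- K ^ 2 / 4) exp (- y ^ 2 / (4 s ^ 2))]. *)
Lemma small_ball_lower (s0 s1 mu z e : R) : 0 < e -> e <= 1 -> 0 < s0 -> s0 <= A -> A <= s1 ->
  `|m - z| <= mu ->
  small_ball_const s0 s1 mu * e <= fine (P [set w | (`|v w - z| <= e)%R]).
Proof.
move=> e0 e1 s00 s0A As1 mz; rewrite /small_ball_const; set b := mu ^+ 2 / (2 * s0).
have b0 : 0 <= b by rewrite divr_ge0 ?sqr_ge0// mulr_ge0// ltW.
set K := 2 * Num.sqrt (b + 2); pose s := e / K.
have K2 : K ^+ 2 = 4 * (b + 2).
  by rewrite /K exprMn sqr_sqrtr ?addr_ge0//; congr (_ * _); ring.
have K1 : 1 <= K.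
  rewrite -(@ler_pXn2r _ 2) ?nnegrE ?mulr_ge0 ?sqrtr_ge0// K2 expr1n; lra.
have Kgt0 : 0 < K by apply: lt_le_trans K1.
have sgt0 : 0 < s by rewrite divr_gt0.
have s1' : s <= 1 by rewrite ler_pdivrMr// mul1r (le_trans e1).
have s2gt0 : 0 < Num.sqrt 2 * s by rewrite mulr_gt0// sqrtr_gt0.
pose f w := expR (- (((v w - z) / s) ^+ 2 / 2)) -
  expR (- (K ^+ 2 / 4)) * expR (- (((v w - z) / (Num.sqrt 2 * s)) ^+ 2 / 2)).
have sq2 y : (y / (Num.sqrt 2 * s)) ^+ 2 / 2 = (y / s) ^+ 2 / 4.
  by rewrite invfM mulrA [_ / _ / s]mulrAC exprMn exprVn sqr_sqrtr//; field; rewrite gt_eqF.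
have i2 := integrableZl measurableT (expR (- (K ^+ 2 / 4))) (ibump z (Num.sqrt 2 * s)).
apply: le_trans (@Rintegral_le_prob _ f _ _ _ _); last 4 first.
- exact: measurable_ball.
- exact: (integrableB measurableT (ibump z s) i2).
- move=> w; rewrite lerBlDr (le_trans (le_trans (ler_norm _) (exp1 _)))// lerDl.
  by rewrite mulr_ge0 ?expR_ge0.
- move=> w /= /negP; rewrite -ltNge => ew.
  rewrite subr_le0 sq2 -expRD ler_expR.
  have : K ^+ 2 <= ((v w - z) / s) ^+ 2.
    rewrite -[leRHS]real_normK ?num_real// lerXn2r ?nnegrE ?(ltW Kgt0)//.
    rewrite normrM normfV (gtr0_norm sgt0) ler_pdivlMr// /s mulrCA divff ?gt_eqF// mulr1.
    exact: ltW.
  by move=> h; lra.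
rewrite RintegralB//.
rewrite RintegralZl//.
rewrite !Rintegral_bump_scaled//.
have sA : 0 < s ^+ 2 + A by rewrite ltr_wpDl ?sqr_ge0.
have h1 : expR (- b) <= expR (- ((m - z) ^+ 2 / (2 * (s ^+ 2 + A)))).
  rewrite ler_expR lerN2 /b ler_pM ?sqr_ge0 ?invr_ge0 ?mulr_ge0 ?(ltW sA)//.
    by rewrite -[leLHS]real_normK ?num_real// lerXn2r ?nnegrE// (le_trans _ mz).
  by rewrite lef_pV2 ?posrE ?mulr_gt0// ler_pM2l// (le_trans s0A)// lerDr sqr_ge0.
pose k := s / Num.sqrt (s ^+ 2 + A).
have k0 : 0 < k by rewrite divr_gt0// sqrtr_gt0.
have sq22 : Num.sqrt 2 <= 3 / 2 :> R.
  by rewrite -(@ler_pXn2r _ 2) ?nnegrE ?sqrtr_ge0// sqr_sqrtr//; lra.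
have h2 : Num.sqrt 2 * s / Num.sqrt ((Num.sqrt 2 * s) ^+ 2 + A) *
   expR (- ((m - z) ^+ 2 / (2 * ((Num.sqrt 2 * s) ^+ 2 + A)))) <= 3 / 2 * k.
  rewrite -[leRHS]mulr1; apply: ler_pM; rewrite ?expR_ge0//.
  - by rewrite divr_ge0 ?sqrtr_ge0// ltW.
  - rewrite -mulrA; apply: ler_pM => //.
      by apply: divr_ge0; [exact: ltW|exact: sqrtr_ge0].
    apply: ler_wpM2l; first exact: ltW.
    rewrite lef_pV2 ?posrE ?sqrtr_gt0//.
      by apply: ler_wsqrtr; rewrite lerD2r [(Num.sqrt 2 * s) ^+ 2]exprMn sqr_sqrtr// ler_peMl ?sqr_ge0//; lra.
    by rewrite ltr_wpDl ?sqr_ge0.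
  - rewrite -[leRHS]expR0 ler_expR oppr_le0 divr_ge0 ?sqr_ge0// mulr_ge0// addr_ge0 ?sqr_ge0//.
    exact: ltW.
(* The choice of [K] gives [K ^ 2 / 4 = b + 2], and [exp 2 >= 3]. Multiplied by the [3 / 2 * k] of
   [h2], the subtracted bump costs at most half of the first one. *)
have h3 : expR (- (K ^+ 2 / 4)) <= expR (- b) * 3^-1.
  have -> : - (K ^+ 2 / 4) = - b + - 2 by rewrite K2; field.
  rewrite expRD ler_wpM2l ?expR_ge0// expRN lef_pV2 ?posrE ?expR_gt0//.
  by apply: le_trans (expR_ge1Dx _); lra.
have kk' : s / Num.sqrt (1 + s1) <= k.
  apply: ler_wpM2l; first exact: ltW.
  rewrite lef_pV2 ?posrE ?sqrtr_gt0//.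
    rewrite ler_sqrt ?addr_ge0// ?(le_trans (ltW A0))// lerD//.
    by rewrite -[leRHS](expr1n _ 2) lerXn2r ?nnegrE// ltW.
  by rewrite ltr_wpDr// (le_trans (ltW A0)).
apply: (@le_trans _ _ (k * expR (- b) / 2)).
  apply: (@le_trans _ _ (s / Num.sqrt (1 + s1) * expR (- b) / 2)).
    rewrite le_eqVlt; apply/orP; left; apply/eqP; rewrite /s; field.
    by rewrite (gt_eqF Kgt0)/= gt_eqF// sqrtr_gt0 ltr_wpDr// (le_trans (ltW A0)).
  by rewrite ler_wpM2r// ler_wpM2r ?expR_ge0.
have X0 : 0 <= Num.sqrt 2 * s / Num.sqrt ((Num.sqrt 2 * s) ^+ 2 + A) *
   expR (- ((m - z) ^+ 2 / (2 * ((Num.sqrt 2 * s) ^+ 2 + A)))).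
  by rewrite mulr_ge0 ?expR_ge0// divr_ge0 ?sqrtr_ge0// ltW.
have h4 := ler_pM (expR_ge0 _) X0 h3 h2.
have h5 := ler_wpM2l (ltW k0) h1.
rewrite -/k; apply: le_trans (lerB h5 h4).
by rewrite le_eqVlt; apply/orP; left; apply/eqP; field.
Qed.

End one_point.

(** The pair is rescaled by [e] and each ball is dominated by twice a bump. Of the determinant that
    appears, only [e ^ 2 A] and [A C - B ^ 2] are kept: the first is useful on the diagonal, where
    the second vanishes. *)
Lemma two_small_balls_upper (v1 v2 : Om -> R) (m1 m2 A B C z1 z2 e : R) :
  measurable_fun setT v1 -> measurable_fun setT v2 ->
  0 < A -> 0 <= C -> B ^+ 2 <= A * C ->
  (forall a b c, \int[P]_w cos (a * v1 w + b * v2 w + c) =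
     cos (a * m1 + b * m2 + c) *
     expR (- ((a ^+ 2 * A + 2 * a * b * B + b ^+ 2 * C) / 2))) -> 0 < e ->
  fine (P ([set w | (`|v1 w - z1| <= e)%R] `&` [set w | (`|v2 w - z2| <= e)%R])) <=
  4 * e ^+ 2 / Num.sqrt (e ^+ 2 * A + (A * C - B ^+ 2)).
Proof.
move=> mv1 mv2 A0 C0 BAC vcos e0; have e20 : 0 < e ^+ 2 by rewrite exprn_gt0.
pose f w := expR (- (((v1 w - z1) / e) ^+ 2 / 2)) * expR (- (((v2 w - z2) / e) ^+ 2 / 2)).
have bump1 (y : R) : `|y| <= e -> 1 <= 2 * expR (- ((y / e) ^+ 2 / 2)).
  move=> ye; rewrite -ler_pdivrMl// mulr1.
  apply: le_trans (expR_ge1Dx _); rewrite -(@ler_pM2l _ 2)// divff// mulrDr mulr1 mulrN mulrC.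
  rewrite divfK// lerBrDl -lerBrDr (_ : 2 - 1 = 1); last by ring.
  rewrite -[leRHS](expr1n _ 2) -[leLHS]real_normK ?num_real// lerXn2r ?nnegrE//.
  by rewrite normrM normfV (gtr0_norm e0) ler_pdivrMr// mul1r.
have intf : P.-integrable setT (EFin \o f).
  apply: (@bounded_integrable _ _ _ P _ 1).
    by apply: measurable_funM; [exact: (measurableT_comp mexp (mscale z1 e mv1))|
      exact: (measurableT_comp mexp (mscale z2 e mv2))].
  by move=> w; rewrite normrM -[leRHS]mulr1 ler_pM.
apply: (@le_trans _ _ (\int[P]_w (4 * f w))).
  apply: prob_le_Rintegral.
  - by apply: measurableI; exact: measurable_ball.
  - exact: (integrableZl measurableT 4 intf).
  - by move=> w; rewrite !mulr_ge0// expR_ge0.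
  - move=> w [/= /bump1 h1 /bump1 h2].
    have := ler_pM ler01 ler01 h1 h2; rewrite mulr1 => /le_trans; apply.
    by rewrite /f le_eqVlt; apply/orP; left; apply/eqP; ring.
rewrite RintegralZl// -[leRHS]mulrA ler_wpM2l//.
apply: le_trans (@Rintegral_bump2_le (fun w => (v1 w - z1) / e) (fun w => (v2 w - z2) / e)
  ((m1 - z1) / e) ((m2 - z2) / e) (A / e ^+ 2) (B / e ^+ 2) (C / e ^+ 2) _ _ _ _ _ _) _.
- exact: mscale.
- exact: mscale.
- by rewrite divr_ge0// ltW.
- by rewrite divr_ge0// ltW.
- rewrite (_ : A / e ^+ 2 * (C / e ^+ 2) = (A * C) / e ^+ 2 ^+ 2); last by field; rewrite gt_eqF.
  by rewrite expr_div_n ler_pM2r// invr_gt0 exprn_gt0.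
- move=> a b c.
  rewrite (_ : \int[P]_w _ = \int[P]_w cos (a / e * v1 w + b / e * v2 w + (c - a * z1 / e - b * z2 / e))).
    by rewrite vcos; congr (cos _ * expR (- _)); field; rewrite gt_eqF.
  by apply: eq_Rintegral => w _; congr cos; field; rewrite gt_eqF.
set D := e ^+ 2 * A + _; have D0 : 0 < D by rewrite ltr_pwDl ?mulr_gt0// subr_ge0.
have E : (1 + A / e ^+ 2) * (1 + C / e ^+ 2) - (B / e ^+ 2) ^+ 2 =
    (D + (e ^+ 2 * e ^+ 2 + e ^+ 2 * C)) / (e ^+ 2) ^+ 2 by rewrite /D; field; rewrite gt_eqF.
have S0 : 0 <= e ^+ 2 * e ^+ 2 + e ^+ 2 * C.
  by apply: addr_ge0; apply: mulr_ge0; rewrite // ltW.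
rewrite E sqrtrM; last by rewrite addr_ge0// ltW.
rewrite sqrtrV ?sqr_ge0// sqrtr_sqr (gtr0_norm e20) invfM invrK mulrC ler_wpM2l ?(ltW e20)//.
rewrite lef_pV2 ?posrE ?sqrtr_gt0//; last by rewrite ltr_pwDl.
by apply: ler_wsqrtr; rewrite lerDl.
Qed.

End gaussian_small_balls.

(** * The one-dimensional kernel *)

Section finite_sum_integral.
Context d (T : measurableType d) (R : realType) (mu : {measure set T -> \bar R}).
Variables (D : set T) (mD : measurable D).

Lemma integrable_sum_real (I : Type) (s : seq I) (f : I -> T -> R) :
  (forall i, mu.-integrable D (EFin \o f i)) ->
  mu.-integrable D (EFin \o (fun x => \sum_(i <- s) f i x)).
Proof.
move=> intf; have h := integrable_sum mD s (fun i _ => intf i).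
by apply: eq_integrable (h xpredT) => // x _; rewrite /= sumEFin.
Qed.

Lemma Rintegral_sum (I : Type) (s : seq I) (f : I -> T -> R) :
  (forall i, mu.-integrable D (EFin \o f i)) ->
  \int[mu]_(x in D) (\sum_(i <- s) f i x) = \sum_(i <- s) \int[mu]_(x in D) f i x.
Proof.
move=> intf; elim: s => [|i s IH].
  rewrite big_nil; under eq_Rintegral do rewrite big_nil.
  by rewrite /Rintegral integral0.
under eq_Rintegral do rewrite big_cons.
by rewrite big_cons RintegralD ?IH//; exact: integrable_sum_real.
Qed.

End finite_sum_integral.

Section series_bounds.
Variable R : realType.
Implicit Types (a b : nat -> R) (B : R).

Lemma dominated_series_cvg a b B : (forall k, `|a k| <= b k) ->
  (forall N, \sum_(k < N) b k <= B) -> cvgn (series a).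
Proof.
move=> ab bB; apply: normed_cvg; apply: nondecreasing_is_cvgn.
  by apply: nondecreasing_series => n _ _ /=.
exists B => _ [n _ <-].
rewrite -[X in X <= _]/(\sum_(0 <= k < n) `|a k|) big_mkord; apply: le_trans (bB n).
exact: ler_sum.
Qed.

Lemma dominated_series_le a b B : (forall k, `|a k| <= b k) ->
  (forall N, \sum_(k < N) b k <= B) -> `|limn (series a)| <= B.
Proof.
move=> ab bB; have ca := dominated_series_cvg ab bB.
rewrite -(cvg_lim _ (cvg_norm ca))//; apply: limr_le.
  by apply: is_cvg_norm.
apply: nearW => n; rewrite /series/= big_mkord; apply: le_trans (bB n).
apply: le_trans (ler_norm_sum _ _ _) _; exact: ler_sum.
Qed.

Lemma series_ge a B N0 : cvgn (series a) ->
  (forall N, (N0 <= N)%N -> B <= \sum_(k < N) a k) -> B <= limn (series a).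
Proof.
move=> ca aB; apply: limr_ge => //.
by exists N0 => // n /= Nn; rewrite /series/= big_mkord; exact: aB.
Qed.

End series_bounds.

(** * Sums over frequencies with quartic exponential weights *)

Section theta_sums.
Variable R : realType.
Implicit Types (L r u : R) (k N : nat).

(** Trades the quartic exponential for [1 / (1 + y ^ 2)], whose sums telescope after comparison,
    with a factor [y ^ (2 m)] to spare. *)
Lemma expR4_ge (y : R) (m : nat) : (m <= 2)%N ->
  (y ^+ 2) ^+ m * (1 + y ^+ 2) <= 2 * expR (y ^+ 4).
Proof.
move=> m2; rewrite (_ : y ^+ 4 = (y ^+ 2) ^+ 2); last by rewrite -exprM.
set z := y ^+ 2; have z0 : 0 <= z by exact: sqr_ge0.
have e2 := expR_ge1Dxn 1 (sqr_ge0 z); have e1 := expR_ge1Dx (z ^+ 2).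
have f2 : (2`!)%:R = 2 :> R by [].
rewrite f2 in e2; case: m m2 => [|[|[|//]]] _.
- by rewrite expr0 mul1r; have := sqr_ge0 (z - 1); nra.
- by rewrite expr1; have := sqr_ge0 (z - 1); nra.
- have h : z ^+ 3 <= 2 + z ^+ 4 / 2.
    have [z2|z2] := leP z 2; first by have := sqr_ge0 (z ^+ 2 - z - 2^-1); nra.
    have z20 : 0 <= z - 2 by rewrite subr_ge0 ltW.
    by have := mulr_ge0 (exprn_ge0 3 z0) z20; lra.
  by have : (z ^+ 2) ^+ 2 = z ^+ 4; [rewrite -exprM|nra].
Qed.

(** Each term is at most [2 L ^ 2 / ((L + k - 1) (L + k))], because
    [(L + k) ^ 2 <= 2 (L ^ 2 + k ^ 2)]. *)
Lemma sum_inv_telescope L N : 0 < L ->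
  \sum_(1 <= k < N.+1) (1 + (k%:R / L) ^+ 2)^-1 <= 2 * L.
Proof.
move=> L0; apply: (@le_trans _ _ (\sum_(1 <= k < N.+1)
   (2 * L ^+ 2 * ((L + k.-1%:R)^-1 - (L + k%:R)^-1)))).
  rewrite !big_nat; apply: ler_sum => k /andP[k1 _].
  have k0 : 0 <= k%:R :> R by [].
  have kp0 : 0 <= k.-1%:R :> R by [].
  have -> : k%:R = k.-1%:R + 1 :> R by rewrite -[in LHS](prednK k1) -natr1.
  set j : R := k.-1%:R in kp0 *.
  have h : 0 < 1 + ((j + 1) / L) ^+ 2 by rewrite ltr_pwDl// sqr_ge0.
  rewrite -[leLHS]mul1r ler_pdivrMr//.
  have -> : 2 * L ^+ 2 * ((L + j)^-1 - (L + (j + 1))^-1) * (1 + ((j + 1) / L) ^+ 2) =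
    2 * (L ^+ 2 + (j + 1) ^+ 2) / ((L + j) * (L + (j + 1))).
    by field; rewrite !gt_eqF//; lra.
  rewrite ler_pdivlMr; last by apply: mulr_gt0; lra.
  have := sqr_ge0 (L - (j + 1)); nra.
rewrite -mulr_sumr big_add1 /=.
have tele : \sum_(0 <= i < N) ((L + i%:R)^-1 - (L + i.+1%:R)^-1) = L^-1 - (L + N%:R)^-1.
  elim: N => [|N IH]; first by rewrite big_geq// addr0 subrr.
  by rewrite big_nat_recr//= IH addrA subrK.
rewrite tele (_ : 2 * L = 2 * L ^+ 2 * L^-1); last by field; rewrite gt_eqF.
rewrite ler_wpM2l//; first by rewrite mulr_ge0// sqr_ge0.
by rewrite lerBlDr lerDl invr_ge0 addr_ge0// ltW.
Qed.

(** The zero frequency is left out: for [m = 0] it contributes [1], which no multiple of [L] bounds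
    when [L] is small. *)
Lemma sum_exp_quartic_le (m : nat) L N : (m <= 2)%N -> 0 < L ->
  \sum_(k < N) (k != 0%N :> nat)%:R * (k%:R ^+ 2) ^+ m * expR (- (k%:R / L) ^+ 4) <=
  4 * L * (L ^+ 2) ^+ m.
Proof.
move=> m2 L0; apply: (@le_trans _ _ (\sum_(k < N.+1)
    (k != 0%N :> nat)%:R * (k%:R ^+ 2) ^+ m * expR (- (k%:R / L) ^+ 4))).
  rewrite big_ord_recr/= lerDl; apply: mulr_ge0; last exact: expR_ge0.
  by apply: mulr_ge0 => //; apply: exprn_ge0; exact: sqr_ge0.
rewrite big_ord_recl/= !mul0r add0r.
apply: (@le_trans _ _ (\sum_(1 <= k < N.+1)
    (2 * (L ^+ 2) ^+ m * (1 + (k%:R / L) ^+ 2)^-1))).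
  rewrite big_add1/= big_mkord; apply: ler_sum => i _.
  rewrite mul1r /bump leq0n add1n; set y := i.+1%:R / L.
  have -> : (i.+1%:R ^+ 2) ^+ m = (L ^+ 2) ^+ m * (y ^+ 2) ^+ m.
    by rewrite -exprMn -exprMn /y mulrC divfK ?gt_eqF.
  rewrite expRN ler_pdivrMr ?expR_gt0// [2 * _]mulrC -!mulrA ler_wpM2l//.
    by rewrite exprn_ge0// sqr_ge0.
  have h := expR4_ge y m2.
  have h0 : 0 < 1 + y ^+ 2 by rewrite ltr_pwDl// sqr_ge0.
  by rewrite mulrCA [_^-1 * _]mulrC ler_pdivlMr.
rewrite -mulr_sumr.
rewrite (_ : 4 * L * (L ^+ 2) ^+ m = 2 * (L ^+ 2) ^+ m * (2 * L)); last by ring.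
by rewrite ler_wpM2l ?sum_inv_telescope// mulr_ge0// exprn_ge0// sqr_ge0.
Qed.

End theta_sums.

Section cos_bounds.
Variable R : realType.
Implicit Types x : R.

Lemma norm_sin_le x : `|sin x| <= `|x|.
Proof.
have := @MVT_lipschitz _ sin cos 1 x 0 (@is_derive_sin R) _; rewrite sin0 !subr0 mul1r.
by apply => z; rewrite ler_norml cos_geN1 cos_le1.
Qed.

Lemma one_sub_cosE x : 1 - cos x = 2 * sin (x / 2) ^+ 2.
Proof.
have {1}-> : x = x / 2 + x / 2 by field.
by rewrite cosD -!expr2; have := cos2Dsin2 (x / 2); lra.
Qed.

Lemma one_sub_cos_le x : 1 - cos x <= x ^+ 2 / 2.
Proof.
rewrite one_sub_cosE; have h : sin (x / 2) ^+ 2 <= (x / 2) ^+ 2.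
  rewrite -[leLHS]real_normK ?num_real// -[leRHS]real_normK ?num_real//.
  by rewrite lerXn2r ?nnegrE// norm_sin_le.
by move: h; rewrite expr_div_n; lra.
Qed.

Lemma one_sub_cos_ge x : `|x| <= 1 -> x ^+ 2 / 4 <= 1 - cos x.
Proof.
move=> x1; rewrite one_sub_cosE.
have x20 : 0 <= `|x| / 2 by rewrite divr_ge0.
have [c /= /andP[c0 c1]] := @MVT_segment R sin cos 0 (`|x| / 2) x20 (fun z _ => is_derive_sin z)
  (continuous_subspaceT (@continuous_sin R)).
rewrite sin0 !subr0 => sE.
(* The intermediate point is at most [1 / 2]; the resulting factor [2 (7 / 8) ^ 2 / 4] exceeds
   [1 / 4]. *)
have cc : 7 / 8 <= cos c.
  have := one_sub_cos_le c; have : c ^+ 2 <= 1 / 4.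
    have c12 : c <= 1 / 2 by move: c1; rewrite bnd_simp => /le_trans; apply; lra.
    by move: c0; rewrite bnd_simp => c0; nra.
  lra.
have -> : sin (x / 2) ^+ 2 = sin (`|x| / 2) ^+ 2.
  have [x0|x0] := leP 0 x; first by rewrite ger0_norm.
  by rewrite ltr0_norm// mulNr sinN sqrrN.
rewrite sE exprMn expr_div_n real_normK ?num_real//.
have := sqr_ge0 x; have : (7 / 8) ^+ 2 <= cos c ^+ 2 by rewrite lerXn2r ?nnegrE//; lra.
nra.
Qed.

Lemma cos_ge0_small x : `|x| <= 1 -> 0 <= cos x.
Proof.
move=> x1; have := one_sub_cos_le x; have : x ^+ 2 <= 1.
  by rewrite -[leLHS]real_normK ?num_real// expr_le1.
lra.
Qed.

End cos_bounds.

(** * Size, regularity, gaps and convolution of the one-dimensional kernel *)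

Section heat_kernel1.
Variable R : realType.
Implicit Types (L r u x y : R) (k N : nat).

Definition kernel1_coef k : R := ((if k == 0%N then 2 else 1) * pi)^-1.

Definition kernel1_term r u k : R :=
  expR (- (k%:R ^+ 4 * r)) * kernel1_coef k * cos (k%:R * u).

Definition kernel1 r u : R := limn (series (kernel1_term r u)).

Lemma kernel1_coef_gt0 k : 0 < kernel1_coef k.
Proof. by rewrite invr_gt0 mulr_gt0 ?pi_gt0//; case: ifP. Qed.

Lemma kernel1_coef_le k : (k != 0%N)%:R * kernel1_coef k <= 2^-1 * (k != 0%N)%:R.
Proof.
rewrite mulrC; apply: ler_wpM2r => //.
rewrite lef_pV2 ?posrE ?mulr_gt0 ?pi_gt0//; last by case: ifP.
have := @pi_ge2 R; case: ifP => _; lra.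
Qed.

Lemma cos_abs_le1 (x : R) : `|cos x| <= 1.
Proof. by rewrite ler_norml cos_geN1 cos_le1. Qed.

(** With [L = r ^ (- 1 / 4)], the frequencies that matter are those up to [L]. *)
Lemma kernel1_scale r : 0 < r -> exists2 L, 0 < L & r = (L ^+ 4)^-1.
Proof.
move=> r0; exists (r `^ (- 4^-1)); first exact: powR_gt0.
by rewrite -powR_mulrn ?powR_ge0// -powRrM mulNr mulVf// -powRN opprK powRr1// ltW.
Qed.

Lemma kernel1_decay k L : k%:R ^+ 4 * (L ^+ 4)^-1 = (k%:R / L) ^+ 4.
Proof. by rewrite expr_div_n. Qed.

(** The nonzero spectral weights times [k ^ (2 m)]: [m = 0] measures the size of the kernel, [m = 1]
    its variation in space and [m = 2] its variation in time. *)
Let weight (m : nat) r k : R :=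
  (k != 0%N)%:R * (k%:R ^+ 2) ^+ m * (expR (- (k%:R ^+ 4 * r)) * kernel1_coef k).

Let weight_ge0 m r k : 0 <= weight m r k.
Proof.
apply: mulr_ge0; last by rewrite mulr_ge0 ?expR_ge0// ltW ?kernel1_coef_gt0.
by apply: mulr_ge0 => //; apply: exprn_ge0; exact: sqr_ge0.
Qed.

Let weight_sum m L N : (m <= 2)%N -> 0 < L ->
  \sum_(k < N) weight m (L ^+ 4)^-1 k <= 2 * L * (L ^+ 2) ^+ m.
Proof.
move=> m2 L0; have -> : 2 * L * (L ^+ 2) ^+ m = 2^-1 * (4 * L * (L ^+ 2) ^+ m) by field.
apply: le_trans (ler_wpM2l _ (sum_exp_quartic_le N m2 L0)) => //.
rewrite mulr_sumr; apply: ler_sum => k _; rewrite /weight kernel1_decay.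
have := kernel1_coef_le k; have [->|k0] := eqVneq (k : nat) 0%N.
  by rewrite !mul0r mulr0.
rewrite mulr1 !mul1r => ck; set A := (k%:R ^+ 2) ^+ m; set E := expR _.
have AE : 0 <= A * E by rewrite mulr_ge0 ?expR_ge0// exprn_ge0// sqr_ge0.
by rewrite mulrA [leRHS]mulrC ler_wpM2l.
Qed.

Let term0_sum L N : 0 < L -> \sum_(k < N) kernel1_term (L ^+ 4)^-1 0 k <= 1 + 2 * L.
Proof.
move=> L0; apply: (@le_trans _ _ (\sum_(k < N) ((k == 0%N :> nat)%:R * kernel1_coef k) +
   \sum_(k < N) weight 0 (L ^+ 4)^-1 k)).
  rewrite -big_split/=; apply: ler_sum => k _.
  rewrite /kernel1_term /weight mulr0 cos0 mulr1 expr0 mulr1.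
  have [->|k0] := eqVneq (k : nat) 0%N; last by rewrite mul0r add0r mul1r.
  by rewrite expr0n/= mul0r oppr0 expR0 !mul1r mul0r addr0.
apply: lerD; last by have := @weight_sum 0 L N isT L0; rewrite expr0 mulr1.
case: N => [|N]; first by rewrite big_ord0.
rewrite big_ord_recl/= big1 ?addr0 ?mul1r; last by move=> i _; rewrite mul0r.
rewrite /kernel1_coef eqxx -[leRHS]invr1 lef_pV2 ?posrE ?mulr_gt0 ?pi_gt0//.
by have := @pi_ge2 R; lra.
Qed.

Lemma kernel1_term_le r u k : `|kernel1_term r u k| <= kernel1_term r 0 k.
Proof.
rewrite /kernel1_term mulr0 cos0 mulr1 normrM ger0_norm; last first.
  by rewrite mulr_ge0 ?expR_ge0// ltW ?kernel1_coef_gt0.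
by rewrite ler_piMr ?cos_abs_le1// mulr_ge0 ?expR_ge0// ltW ?kernel1_coef_gt0.
Qed.

Lemma kernel1_cvg r u : 0 < r -> cvgn (series (kernel1_term r u)).
Proof.
move=> /kernel1_scale[L L0 ->]; apply: dominated_series_cvg.
  exact: kernel1_term_le.
by move=> N; exact: term0_sum.
Qed.

Lemma kernel1_cvg_sum r u : 0 < r ->
  \sum_(k < N) kernel1_term r u k @[N --> \oo] --> kernel1 r u.
Proof.
move=> r0; rewrite -(_ : series (kernel1_term r u) = fun N => \sum_(k < N) kernel1_term r u k).
  exact: kernel1_cvg.
by apply/funext => N; rewrite /series/= big_mkord.
Qed.

Lemma kernel1_0_le L : 0 < L -> kernel1 (L ^+ 4)^-1 0 <= 1 + 2 * L.
Proof.
move=> L0; apply: le_trans (ler_norm _) _; apply: dominated_series_le.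
  exact: kernel1_term_le.
by move=> N; exact: term0_sum.
Qed.

Lemma kernel1_partial_le0 r N : 0 < r -> \sum_(k < N) kernel1_term r 0 k <= kernel1 r 0.
Proof.
move=> r0; apply: (series_ge (N0 := N)); first exact: kernel1_cvg.
move=> M NM; rewrite -!(big_mkord xpredT (kernel1_term r 0)).
rewrite (big_cat_nat (leq0n N) NM)/= lerDl sumr_ge0// => k _.
by rewrite (le_trans _ (kernel1_term_le _ 0 _)).
Qed.

Lemma kernel1_le0 r u : 0 < r -> `|kernel1 r u| <= kernel1 r 0.
Proof.
move=> r0; apply: dominated_series_le; first exact: kernel1_term_le.
by move=> N; exact: kernel1_partial_le0.
Qed.

(** The contribution of the zero frequency, which does not decay in time; it keeps the variances of
    the field away from zero. *)
Lemma kernel1_0_ge r : 0 < r -> (2 * pi)^-1 <= kernel1 r 0.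
Proof.
move=> r0; apply: le_trans (kernel1_partial_le0 1 r0).
rewrite big_ord1 /kernel1_term/= expr0n/= mul0r oppr0 expR0 mul1r mulr0 cos0 mulr1.
by rewrite /kernel1_coef eqxx.
Qed.

Let kernel1_linear (a b : R) r u r' u' : 0 < r -> 0 < r' ->
  limn (series (fun k => a * kernel1_term r u k + b * kernel1_term r' u' k)) =
  a * kernel1 r u + b * kernel1 r' u'.
Proof.
move=> r0 r'0; apply/cvg_lim => //.
have -> : series (fun k => a * kernel1_term r u k + b * kernel1_term r' u' k) =
  (fun N => a * series (kernel1_term r u) N + b * series (kernel1_term r' u') N).
  by apply/funext => N; rewrite /series/= !mulr_sumr -big_split.
apply: cvgD; apply: cvgMl_tmp; exact: kernel1_cvg.
Qed.

Let kernel1_sub_le (a b : R) r u r' u' (w : nat -> R) (B : R) : 0 < r -> 0 < r' ->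
  (forall k, `|a * kernel1_term r u k + b * kernel1_term r' u' k| <= w k) ->
  (forall N, \sum_(k < N) w k <= B) -> `|a * kernel1 r u + b * kernel1 r' u'| <= B.
Proof.
move=> r0 r'0 hw hB; rewrite -kernel1_linear//; exact: dominated_series_le hw hB.
Qed.

Let kernel1_sub_ge (a b : R) r u r' u' (B : R) N0 : 0 < r -> 0 < r' ->
  (forall N, (N0 <= N)%N -> B <= \sum_(k < N) (a * kernel1_term r u k + b * kernel1_term r' u' k)) ->
  B <= a * kernel1 r u + b * kernel1 r' u'.
Proof.
move=> r0 r'0 hB; rewrite -kernel1_linear//; apply: (series_ge (N0 := N0)) => //.
have -> : series (fun k => a * kernel1_term r u k + b * kernel1_term r' u' k) =
  (fun N => a * series (kernel1_term r u) N + b * series (kernel1_term r' u') N).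
  by apply/funext => N; rewrite /series/= !mulr_sumr -big_split.
by apply: is_cvgD; apply: is_cvgMl_tmp; exact: kernel1_cvg.
Qed.

(** Termwise [1 - cos (k u) <= (k u) ^ 2 / 2], and the weights [m = 1] sum to order [L ^ 3]. In
    [kernel1_time_le] the analogue is [1 - exp (- k ^ 4 h) <= k ^ 4 h]. *)
Lemma kernel1_space_le L u : 0 < L ->
  kernel1 (L ^+ 4)^-1 0 - kernel1 (L ^+ 4)^-1 u <= u ^+ 2 * L ^+ 3.
Proof.
move=> L0; set r := (L ^+ 4)^-1; have r0 : 0 < r by rewrite invr_gt0 exprn_gt0.
rewrite -[kernel1 r 0]mul1r -mulN1r; apply: le_trans (ler_norm _) _.
apply: (@kernel1_sub_le _ _ _ _ _ _ (fun k => u ^+ 2 / 2 * weight 1 r k)) => //.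
  move=> k; set e := expR (- (k%:R ^+ 4 * r)) * kernel1_coef k.
  have e0 : 0 <= e by rewrite /e mulr_ge0 ?expR_ge0// ltW ?kernel1_coef_gt0.
  have -> : 1 * kernel1_term r 0 k + -1 * kernel1_term r u k = e * (1 - cos (k%:R * u)).
    by rewrite /kernel1_term mulr0 cos0 /e; ring.
  rewrite /weight expr1 -/e; have [->|k0] := eqVneq k 0%N.
    by rewrite mul0r cos0 subrr mulr0 normr0 !mul0r mulr0.
  rewrite normrM (ger0_norm e0) ger0_norm ?subr_ge0 ?cos_le1//.
  rewrite (_ : _ * (_ * e) = e * ((k%:R * u) ^+ 2 / 2)); last by rewrite /=; field.
  by rewrite ler_wpM2l// one_sub_cos_le.
move=> N; rewrite -mulr_sumr.
have := ler_wpM2l (_ : 0 <= u ^+ 2 / 2) (@weight_sum 1 L N isT L0).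
rewrite divr_ge0 ?sqr_ge0// => /(_ isT) /le_trans; apply.
by rewrite expr1 le_eqVlt; apply/orP; left; apply/eqP; field.
Qed.

Lemma kernel1_time_le L h : 0 < L -> 0 <= h ->
  0 <= kernel1 (L ^+ 4)^-1 0 - kernel1 ((L ^+ 4)^-1 + h) 0 <= 2 * h * L ^+ 5.
Proof.
move=> L0 h0; set r := (L ^+ 4)^-1; have r0 : 0 < r by rewrite invr_gt0 exprn_gt0.
have rh0 : 0 < r + h by rewrite ltr_wpDr.
have E k : 1 * kernel1_term r 0 k + -1 * kernel1_term (r + h) 0 k =
    expR (- (k%:R ^+ 4 * r)) * kernel1_coef k * (1 - expR (- (k%:R ^+ 4 * h))).
  rewrite /kernel1_term mulr0 cos0 !mulr1 mulrDr opprD expRD; ring.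
have E0 k : 0 <= 1 - expR (- (k%:R ^+ 4 * h)) <= k%:R ^+ 4 * h.
  rewrite subr_ge0 -[X in _ <= X]expR0 ler_expR oppr_le0 mulr_ge0 ?exprn_ge0//=.
  by rewrite lerBlDr -lerBlDl; exact: expR_ge1Dx.
have w0 k : 0 <= expR (- (k%:R ^+ 4 * r)) * kernel1_coef k.
  by rewrite mulr_ge0 ?expR_ge0// ltW ?kernel1_coef_gt0.
rewrite -[kernel1 r 0]mul1r -mulN1r; apply/andP; split.
  apply: (@kernel1_sub_ge _ _ _ _ _ _ _ 0%N) => // N _; apply: sumr_ge0 => k _.
  by rewrite E mulr_ge0//; have /andP[] := E0 k.
apply: le_trans (ler_norm _) _.
apply: (@kernel1_sub_le _ _ _ _ _ _ (fun k => h * weight 2 r k)) => //.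
  move=> k; rewrite E; have /andP[e1 e2] := E0 k.
  have [k0|k0] := eqVneq k 0%N.
    rewrite (_ : 1 - _ = 0); last by rewrite k0 expr0n/= mul0r oppr0 expR0 subrr.
    by rewrite mulr0 normr0 mulr_ge0.
  rewrite /weight k0 ger0_norm; last by apply: mulr_ge0.
  rewrite mul1r mulrC [leRHS]mulrA ler_wpM2r//; apply: le_trans e2 _.
  by rewrite mulrC -exprM.
move=> N; rewrite -mulr_sumr.
have := ler_wpM2l h0 (@weight_sum 2 L N isT L0) => /le_trans; apply.
by rewrite le_eqVlt; apply/orP; left; apply/eqP; ring.
Qed.

Let exp1_le4 : expR 1 <= 4 :> R.
Proof.
have h : 2^-1 <= expR (- 2^-1) :> R by apply: le_trans (expR_ge1Dx _); lra.
have h2 : expR 2^-1 <= 2 :> R.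
  by move: h; rewrite expRN lef_pV2 ?posrE ?expR_gt0.
have -> : expR 1 = expR 2^-1 * expR 2^-1 :> R by rewrite -expRD; congr expR; field.
apply: le_trans (ler_pM (expR_ge0 _) (expR_ge0 _) h2 h2) _; lra.
Qed.

Let sum_sqr_ge n : (n%:R) ^+ 3 / 3 <= \sum_(k < n.+1) k%:R ^+ 2 :> R.
Proof.
elim: n => [|n IH]; first by rewrite expr0n/= mul0r sumr_ge0// => k _; rewrite sqr_ge0.
rewrite big_ord_recr/=; apply: le_trans (lerD IH (lexx _)).
by rewrite -natr1; have : 0 <= n%:R :> R by []; set x := n%:R; nra.
Qed.

(** Both signs at once: all the terms are nonnegative, and for frequencies up to [L]
    they are at least of order [u ^ 2 k ^ 2]. *)
Lemma kernel1_gap L u (e : bool) : 1 <= L -> `|u| * L <= 1 ->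
  u ^+ 2 * L ^+ 3 / 1536 <= kernel1 (L ^+ 4)^-1 0 + (-1) ^+ e * kernel1 (L ^+ 4)^-1 u.
Proof.
move=> L1 uL; have L0 : 0 < L by apply: lt_le_trans L1.
set r := (L ^+ 4)^-1; have r0 : 0 < r by rewrite invr_gt0 exprn_gt0.
rewrite -[kernel1 r 0]mul1r.
pose n := Num.truncn L.
have /andP[nL Ln] : n%:R <= L < n.+1%:R by apply: truncn_itv; exact: ltW.
have n1 : (1 <= n)%N by rewrite -ltnS -(ltr_nat R); apply: le_lt_trans Ln.
have Ln2 : L / 2 <= n%:R.
  have : 1 <= n%:R :> R by rewrite ler1n.
  by move: Ln; rewrite -natr1; lra.
apply: (@kernel1_sub_ge _ _ _ _ _ _ _ n.+1) => // N nN.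
have pos k : 0 <= 1 * kernel1_term r 0 k + (-1) ^+ e * kernel1_term r u k.
  rewrite mul1r; apply: (@le_trans _ _ (kernel1_term r 0 k - `|kernel1_term r u k|)).
    by rewrite subr_ge0 kernel1_term_le.
  rewrite lerD2l; case: e; rewrite ?expr1 ?expr0 ?mul1r ?mulN1r.
    by rewrite lerN2 ler_norm.
  by rewrite lerNl (le_trans (ler_norm _))// normrN.
rewrite -(big_mkord xpredT (fun k => 1 * kernel1_term r 0 k + (-1) ^+ e * kernel1_term r u k)).
rewrite (big_cat_nat (leq0n n.+1) nN)/= big_mkord -[leLHS]addr0; apply: lerD; last first.
  by apply: sumr_ge0 => k _; exact: pos.
(* Origin of [1536 = 16 * 4 * 3 * 8]: exponential and coefficient are each at least [1 / 4], then
   [1 - cos y >= y ^ 2 / 4], the squares up to [n] sum to at least [n ^ 3 / 3], and [n >= L / 2]. *)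
apply: (@le_trans _ _ (\sum_(k < n.+1) (16^-1 * (u ^+ 2 / 4) * k%:R ^+ 2))).
  rewrite -mulr_sumr.
  apply: (@le_trans _ _ (16^-1 * (u ^+ 2 / 4) * (n%:R ^+ 3 / 3))); last first.
    by rewrite ler_wpM2l ?sum_sqr_ge// mulr_ge0// divr_ge0 ?sqr_ge0.
  have : (L / 2) ^+ 3 <= n%:R ^+ 3 by rewrite lerXn2r ?nnegrE ?divr_ge0 ?(ltW L0).
  rewrite expr_div_n (_ : 2 ^+ 3 = 8); last by ring.
  by have := sqr_ge0 u; set a := u ^+ 2; set b := L ^+ 3; set c := n%:R ^+ 3; nra.
apply: ler_sum => k _.
have kL : k%:R <= L by apply: le_trans nL; rewrite ler_nat -ltnS.
have ku : `|k%:R * u| <= 1.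
  rewrite normrM ger0_norm// mulrC; apply: le_trans uL.
  by rewrite ler_wpM2l.
have [k0|k0] := eqVneq (k : nat) 0%N; first by rewrite k0 expr0n/= mulr0 pos.
(* For the sign [+], [1 + cos] is at least [1 - cos] because the cosine is nonnegative on
   [|k u| <= 1]. *)
have c1 : (k%:R * u) ^+ 2 / 4 <= 1 + (-1) ^+ e * cos (k%:R * u).
  have h1 := one_sub_cos_ge ku; have h2 := cos_ge0_small ku.
  case: e {pos}; rewrite ?expr1 ?expr0 ?mul1r ?mulN1r//.
  apply: le_trans h1 _; lra.
have -> : 1 * kernel1_term r 0 k + (-1) ^+ e * kernel1_term r u k =
    expR (- (k%:R ^+ 4 * r)) * kernel1_coef k * (1 + (-1) ^+ e * cos (k%:R * u)).
  by rewrite /kernel1_term mulr0 cos0; ring.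
rewrite -mulrA; apply: ler_pM => //.
- by rewrite mulr_ge0 ?sqr_ge0// divr_ge0 ?sqr_ge0.
- rewrite (_ : 16 = 4 * 4); last by ring.
  rewrite invfM; apply: ler_pM => //.
    rewrite expRN lef_pV2 ?posrE ?expR_gt0//; apply: le_trans exp1_le4.
    rewrite ler_expR kernel1_decay expr_le1// ?divr_ge0// ?(ltW L0)//.
    by rewrite ler_pdivrMr// mul1r.
  rewrite /kernel1_coef (negbTE k0) mul1r lef_pV2 ?posrE ?pi_gt0//.
  by have := @pihalf_lt2 R; lra.
- by apply: le_trans c1; rewrite exprMn mulrC mulrA.
Qed.

(** Serves for the mean of the field, away from time zero, where the powers of [L] are immaterial:
    in space, a factor [k] is simply bounded by [k ^ 2]. *)
Lemma kernel1_lipschitz L r r' u u' : 0 < L -> (L ^+ 4)^-1 <= r -> (L ^+ 4)^-1 <= r' ->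
  `|kernel1 r u - kernel1 r' u'| <= 2 * L ^+ 5 * `|r - r'| + 2 * L ^+ 3 * `|u - u'|.
Proof.
move=> L0; set r0 := (L ^+ 4)^-1 => rr rr'.
have r00 : 0 < r0 by rewrite invr_gt0 exprn_gt0.
have rp := lt_le_trans r00 rr; have rp' := lt_le_trans r00 rr'.
rewrite -[kernel1 r u]mul1r -mulN1r.
apply: (@kernel1_sub_le _ _ _ _ _ _
   (fun k => `|r - r'| * weight 2 r0 k + `|u - u'| * weight 1 r0 k)) => //; last first.
  move=> N; rewrite big_split/= -!mulr_sumr.
  have h2 := ler_wpM2l (normr_ge0 (r - r')) (@weight_sum 2 L N isT L0).
  have h1 := ler_wpM2l (normr_ge0 (u - u')) (@weight_sum 1 L N isT L0).
  apply: le_trans (lerD h2 h1) _; rewrite expr1 le_eqVlt; apply/orP; left; apply/eqP; ring.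
move=> k; set c := kernel1_coef k; have c0 : 0 < c by exact: kernel1_coef_gt0.
pose e (s : R) := expR (- (k%:R ^+ 4 * s)).
have -> : 1 * kernel1_term r u k + -1 * kernel1_term r' u' k =
   c * ((e r - e r') * cos (k%:R * u) + e r' * (cos (k%:R * u) - cos (k%:R * u'))).
  by rewrite /kernel1_term /e /c; ring.
have e0 (s : R) : 0 <= e s by exact: expR_ge0.
have eE (s : R) : r0 <= s -> e s <= e r0.
  by move=> rs; rewrite ler_expR lerN2 ler_wpM2l// exprn_ge0.
have e1 : `|e r - e r'| <= e r0 * (k%:R ^+ 4 * `|r - r'|).
  wlog rr2 : r r' rr rr' {rp rp'} / r <= r'.
    move=> h; have [/h|/ltW/h] := leP r r'; first exact.
    by rewrite distrC [`|r' - r|]distrC; apply.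
  rewrite [`|r - r'|]distrC [`|r' - r|]ger0_norm ?subr_ge0//.
  have -> : e r - e r' = e r * (1 - expR (- (k%:R ^+ 4 * (r' - r)))).
    by rewrite mulrBr mulr1 /e -expRD; congr (_ - expR _); ring.
  have kr0 : 0 <= k%:R ^+ 4 * (r' - r) by rewrite mulr_ge0 ?exprn_ge0// subr_ge0.
  rewrite normrM ger0_norm// ger0_norm; last first.
    by rewrite subr_ge0 -[X in _ <= X]expR0 ler_expR oppr_le0.
  apply: ler_pM => //; first by rewrite subr_ge0 -[X in _ <= X]expR0 ler_expR oppr_le0.
    exact: eE.
  by rewrite lerBlDr -lerBlDl; exact: expR_ge1Dx.
have e2 : `|cos (k%:R * u) - cos (k%:R * u')| <= k%:R * `|u - u'|.
  apply: le_trans (lipschitz_cos _ _) _.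
  by rewrite -mulrBr normrM ger0_norm.
rewrite normrM (gtr0_norm c0).
apply: (@le_trans _ _ (c * (e r0 * (k%:R ^+ 4 * `|r - r'|) + e r0 * (k%:R * `|u - u'|)))).
  apply: ler_wpM2l; first exact: ltW.
  apply: le_trans (ler_normD _ _) _; apply: lerD.
    by rewrite normrM -[leRHS]mulr1; apply: ler_pM => //; exact: cos_abs_le1.
  by rewrite normrM (ger0_norm (e0 _)); apply: ler_pM => //; exact: eE.
have [k0|k0] := eqVneq k 0%N.
  have kk : k%:R = 0 :> R by rewrite k0.
  rewrite kk expr0n/= !mul0r !mulr0 addr0 mulr0.
  by apply: addr_ge0; apply: mulr_ge0 => //; exact: weight_ge0.
rewrite /weight k0 !mul1r -/c -/(e r0) expr1.
rewrite [leRHS](_ : _ = c * (e r0 * (k%:R ^+ 4 * `|r - r'|) + e r0 * (k%:R ^+ 2 * `|u - u'|))); last by ring.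
apply: ler_wpM2l; first exact: ltW.
rewrite lerD2l ler_wpM2l// ler_wpM2r// expr2 ler_peMl// ler1n lt0n k0//.
Qed.

Definition circle : set (measurableTypeR R) := `[0, 2 * pi[%classic.

Lemma measurable_circle : measurable circle.
Proof. exact: measurable_itv. Qed.

Lemma lebesgue_circle : lebesgue_measure circle = (2 * pi)%:E.
Proof.
by rewrite /circle lebesgue_measure_itv/= lte_fin mulr_gt0 ?pi_gt0//= -EFinB subr0.
Qed.

Lemma circle_integrable (f : R -> R) (M : R) : measurable_fun setT f ->
  (forall z, `|f z| <= M) -> lebesgue_measure.-integrable circle (EFin \o f).
Proof.
move=> mf fM; apply: (measurable_bounded_integrable measurable_circle).
- by have fin : (lebesgue_measure circle < +oo)%E by rewrite lebesgue_circle ltry.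
- exact: measurable_funTS.
- by exists M; split; [exact: num_real|move=> K MK z _; exact: le_trans (fM z) (ltW MK)].
Qed.

Let mcos : measurable_fun [set: R] (cos : R -> R).
Proof. by apply: continuous_measurable_fun; exact: continuous_cos. Qed.

Let integral_cos_circle (c m : R) : m != 0 -> sin (c - m * (2 * pi)) = sin c ->
  \int[lebesgue_measure]_(z in circle) cos (c - m * z) = 0.
Proof.
move=> m0 per; have p0 : 0 <= 2 * pi :> R by rewrite mulr_ge0// pi_ge0.
have ccos : continuous (fun z : R => cos (c - m * z)).
  move=> z; apply: (continuous_comp (f := fun z => c - m * z)); last exact: continuous_cos.
  by apply: cvgB; [exact: cvg_cst|exact: mulrl_continuous].
rewrite /circle Rintegral_itv_bndo_bndc; last first.
  apply: (@integrableS _ _ _ lebesgue_measure `[0, 2 * pi]) => //.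
    by apply: subset_itvl; rewrite bnd_simp.
  by apply: continuous_compact_integrable; [exact: segment_compact|exact: continuous_subspaceT].
have dF (z : R) : is_derive z 1 (fun z : R => - (sin (c - m * z) / m)) (cos (c - m * z)).
  have d1 : is_derive z 1 (fun z : R => c - m * z) (- m).
    by apply: is_derive_eq; rewrite /GRing.scale/=; ring.
  have d2 := is_derive_fun_comp (is_derive_sin _) d1.
  have := is_derive_funM d2 (is_derive_fun_cst (- m^-1) z).
  rewrite (_ : (fun y => _) = (fun z : R => - (sin (c - m * z) / m))).
    by move/is_derive_eq; apply; field.
  by apply/funext => y; rewrite mulrN.
rewrite /Rintegral (integral_itv_is_derive p0 ccos dF)/=.
by rewrite per mulr0 subr0 opprK addNr.
Qed.

Let sin_per (c : R) (n : nat) : sin (c + n%:R * (2 * pi)) = sin c.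
Proof.
by rewrite !mulr_natl periodicn//; exact: sinD2pi.
Qed.

Let cos_orthogonal (k l : nat) x y :
  \int[lebesgue_measure]_(z in circle) (cos (k%:R * (x - z)) * cos (l%:R * (y - z))) =
  if k == l then (kernel1_coef k)^-1 * cos (k%:R * (x - y)) else 0.
Proof.
have icos (c m : R) : lebesgue_measure.-integrable circle (EFin \o (fun z => cos (c - m * z))).
  apply: (circle_integrable (M := 1)); last by move=> z; exact: cos_abs_le1.
  by apply: (measurableT_comp mcos); apply: measurable_funB => //; exact: measurable_funM.
transitivity (\int[lebesgue_measure]_(z in circle) (2^-1 *
   (cos ((k%:R * x - l%:R * y) - (k%:R - l%:R) * z) + cos ((k%:R * x + l%:R * y) - (k%:R + l%:R) * z)))).
  apply: eq_Rintegral => z _.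
  rewrite (_ : _ - _ * z = k%:R * (x - z) - l%:R * (y - z)); last by ring.
  rewrite (_ : _ - (_ + _) * z = k%:R * (x - z) + l%:R * (y - z)); last by ring.
  by rewrite cosB cosD; field.
rewrite RintegralZl//; last exact: (integrableD measurable_circle (icos _ _) (icos _ _)).
rewrite RintegralD//; last exact: measurable_circle.
have perD (i j : nat) (c : R) : sin (c - (i%:R + j%:R) * (2 * pi)) = sin c.
  by rewrite -[in RHS](subrK ((i + j)%:R * (2 * pi)) c) sin_per natrD.
have perB (i j : nat) (c : R) : sin (c - (i%:R - j%:R) * (2 * pi)) = sin c.
  rewrite (_ : _ - _ = c - i%:R * (2 * pi) + j%:R * (2 * pi)); last by ring.
  by rewrite sin_per -[in RHS](subrK (i%:R * (2 * pi)) c) sin_per.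
have cstI (c : R) : \int[lebesgue_measure]_(z in circle) cos (c - 0 * z) = 2 * pi * cos c.
  under eq_Rintegral do rewrite mul0r subr0.
  have h := @integral_cst _ _ R lebesgue_measure circle measurable_circle (cos c)%:E.
  transitivity (fine ((cos c)%:E * (2 * pi)%:E)%E); last by rewrite /= mulrC.
  exact: (congr1 fine (etrans h (congr1 (fun e => (cos c)%:E * e)%E lebesgue_circle))).
have [<-|kl] := eqVneq k l.
  rewrite subrr cstI; have [k0|k0] := eqVneq k 0%N.
    by rewrite k0 !mul0r subrr !addr0 cstI cos0 /kernel1_coef eqxx invrK; field.
  rewrite integral_cos_circle//; last by rewrite -natrD pnatr_eq0 addn_eq0 (negbTE k0).
  by rewrite addr0 -mulrBr /kernel1_coef (negbTE k0) invrK mul1r; field.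
rewrite !integral_cos_circle ?addr0 ?mulr0//.
- by rewrite -natrD pnatr_eq0 addn_eq0; apply: contraNN kl => /andP[/eqP -> /eqP ->].
- by rewrite subr_eq0 eqr_nat.
exact: measurable_circle.
Qed.

Lemma measurable_kernel1 r : 0 < r -> measurable_fun setT (kernel1 r).
Proof.
move=> r0; apply: (measurable_fun_cvg (h := fun N u => \sum_(k < N) kernel1_term r u k)).
  move=> N; apply: measurable_sum => k; apply: measurable_funM => //.
  have : measurable_fun [set: R] (cos : R -> R).
    by apply: continuous_measurable_fun; exact: continuous_cos.
  by move=> mc; apply: (measurableT_comp mc); exact: measurable_funM.
by move=> u _; exact: kernel1_cvg_sum.
Qed.

(** For partial sums this is the orthogonality of the cosines, [kernel1_coef k] being the inverse of
    the squared norm of [cos (k z)]. The limit is dominated by the constant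
    [kernel1 a 0 * kernel1 b 0]. *)
Lemma kernel1_convolution a b x y : 0 < a -> 0 < b ->
  \int[lebesgue_measure]_(z in circle) (kernel1 a (x - z) * kernel1 b (y - z)) =
  kernel1 (a + b) (x - y).
Proof.
move=> a0 b0; have ab0 : 0 < a + b by rewrite addr_gt0.
have cvS r u : 0 < r -> \sum_(k < N) kernel1_term r u k @[N --> \oo] --> kernel1 r u.
  exact: kernel1_cvg_sum.
have mt r c k : measurable_fun setT (fun z : R => kernel1_term r (c - z) k).
  apply: measurable_funM => //.
  by apply: (measurableT_comp mcos); apply: measurable_funM => //; exact: measurable_funB.
have it r r' c c' k k' : lebesgue_measure.-integrable circle
    (EFin \o (fun z => kernel1_term r (c - z) k * kernel1_term r' (c' - z) k')).
  apply: (circle_integrable (M := kernel1_term r 0 k * kernel1_term r' 0 k')).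
    exact: measurable_funM.
  by move=> z; rewrite normrM ler_pM// kernel1_term_le.
have lim1 : \int[lebesgue_measure]_(z in circle) ((\sum_(k < N) kernel1_term a (x - z) k) *
      (\sum_(k < N) kernel1_term b (y - z) k)) @[N --> \oo] -->
    \int[lebesgue_measure]_(z in circle) (kernel1 a (x - z) * kernel1 b (y - z)).
  apply: (@dominated_cvg_Rintegral _ _ R lebesgue_measure circle measurable_circle _ _
    (fun=> kernel1 a 0 * kernel1 b 0)) => //.
  - by move=> N; apply: measurable_funTS; apply: measurable_funM; apply: measurable_sum => k; exact: mt.
  - by move=> z _; apply: cvgM; exact: cvS.
  - by apply: (circle_integrable (M := `|kernel1 a 0 * kernel1 b 0|)).
  - move=> N z _; rewrite normrM; apply: ler_pM => //.
      apply: le_trans (ler_norm_sum _ _ _) _; apply: le_trans (kernel1_partial_le0 N a0).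
      by apply: ler_sum => k _; exact: kernel1_term_le.
    apply: le_trans (ler_norm_sum _ _ _) _; apply: le_trans (kernel1_partial_le0 N b0).
    by apply: ler_sum => k _; exact: kernel1_term_le.
have E N : \int[lebesgue_measure]_(z in circle) ((\sum_(k < N) kernel1_term a (x - z) k) *
      (\sum_(k < N) kernel1_term b (y - z) k)) = \sum_(k < N) kernel1_term (a + b) (x - y) k.
  under eq_Rintegral do rewrite big_distrlr/=.
  rewrite Rintegral_sum; [|exact: measurable_circle|move=> k; apply: integrable_sum_real; [exact: measurable_circle|move=> l; exact: it]].
  apply: eq_bigr => k _; rewrite Rintegral_sum; [|exact: measurable_circle|by move=> l; exact: it].
  have E1 (l : 'I_N) : \int[lebesgue_measure]_(z in circle) (kernel1_term a (x - z) k * kernel1_term b (y - z) l) =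
      if l == k then kernel1_term (a + b) (x - y) k else 0.
    transitivity (expR (- (k%:R ^+ 4 * a)) * kernel1_coef k * (expR (- (l%:R ^+ 4 * b)) * kernel1_coef l) *
      \int[lebesgue_measure]_(z in circle) (cos (k%:R * (x - z)) * cos (l%:R * (y - z)))).
      rewrite -RintegralZl//; last 2 first.
      - exact: measurable_itv.
      - apply: (circle_integrable (M := 1)).
          apply: measurable_funM; apply: (measurableT_comp mcos); apply: measurable_funM => //; exact: measurable_funB.
        by move=> z; rewrite normrM -[leRHS]mulr1 ler_pM// cos_abs_le1.
      by apply: eq_Rintegral => z _; rewrite /kernel1_term; ring.
    rewrite cos_orthogonal (_ : (nat_of_ord k == l) = (l == k)); last by rewrite eq_sym.
    case: eqP => [->|_]; last exact: mulr0.
    rewrite /kernel1_term (_ : - (_ * (a + b)) = - (k%:R ^+ 4 * a) + - (k%:R ^+ 4 * b)); last by ring.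
    rewrite expRD; field.
    by rewrite gt_eqF// kernel1_coef_gt0.
  rewrite (bigD1 k)//= E1 eqxx big1 ?addr0// => l lk.
  by rewrite E1 (negbTE lk).
have := cvS (a + b) (x - y) ab0; rewrite -(cvg_lim _ lim1)// => h.
apply/cvg_lim => //; by under eq_fun do rewrite E.
Qed.

End heat_kernel1.

(** * The Green's function as a product *)

Section product_integrals.
Context d1 d2 (T1 : measurableType d1) (T2 : measurableType d2) (R : realType).
Variables (m1 : {sigma_finite_measure set T1 -> \bar R})
  (m2 : {sigma_finite_measure set T2 -> \bar R}) (A : set T1) (B : set T2).
Hypotheses (mA : measurable A) (mB : measurable B).

Let patch_setX (f : T1 * T2 -> \bar R) x y :
  (f \_ (A `*` B)) (x, y) = if x \in A then ((fun y => f (x, y)) \_ B) y else 0%E.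
Proof. by rewrite !patchE in_setX; case: (x \in A); case: (y \in B). Qed.

Lemma ge0_integral_setX (f : T1 * T2 -> \bar R) : measurable_fun (A `*` B) f ->
  (forall p, (A `*` B) p -> 0 <= f p)%E ->
  (\int[m1 \x m2]_(p in A `*` B) f p = \int[m1]_(x in A) \int[m2]_(y in B) f (x, y))%E.
Proof.
move=> mf f0; rewrite integral_mkcond fubini_tonelli1.
- rewrite [RHS]integral_mkcond; apply: eq_integral => x _.
  rewrite /fubini_F [RHS]patchE; case: ifPn => xA.
    by rewrite [RHS]integral_mkcond; apply: eq_integral => y _; rewrite patch_setX xA.
  by apply: integral0_eq => y _; rewrite patch_setX (negbTE xA).
- by apply/(measurable_restrictT _ _).1 => //; exact: measurableX.
- by move=> p; apply: erestrict_ge0.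
Qed.

Lemma Rintegral_setX (f : T1 * T2 -> R) (M : R) :
  (m1 A < +oo)%E -> (m2 B < +oo)%E -> measurable_fun (A `*` B) f ->
  (forall p, (A `*` B) p -> `|f p| <= M) ->
  \int[(m1 \x m2)%E]_(p in A `*` B) f p = \int[m1]_(x in A) \int[m2]_(y in B) f (x, y).
Proof.
move=> fA fB mf fM; have mAB : measurable (A `*` B) by exact: measurableX.
have intf : ((m1 \x m2)%E).-integrable (A `*` B) (EFin \o f).
  apply: measurable_bounded_integrable => //.
    have fin : (m1 A * m2 B < +oo)%E by rewrite lte_mul_pinfty ?ge0_fin_numE.
    by have := fin; rewrite -(product_measure1E m1 m2 mA mB).
  by exists M; split; [exact: num_real|move=> K MK p /fM/le_trans; apply; exact: ltW].
rewrite {1}/Rintegral integral_mkcond -integral12_prod_meas1; last first.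
  by apply/(integrable_mkcond _ _).1.
rewrite [RHS]/Rintegral [in RHS]integral_mkcond; congr fine.
apply: eq_integral => x _.
rewrite /fubini_F [RHS]patchE; case: ifPn => xA; last first.
  by apply: integral0_eq => y _; rewrite patch_setX (negbTE xA).
rewrite /= /Rintegral [in RHS]integral_mkcond.
have -> : (\int[m2]_y ((EFin \o f) \_ (A `*` B)) (x, y) =
  \int[m2]_y ((fun y => (f (x, y))%:E) \_ B) y)%E.
  by apply: eq_integral => y _; rewrite patch_setX xA.
rewrite fineK// -integral_mkcond.
apply: integrable_fin_num => //.
rewrite -/(EFin \o (fun y => f (x, y))).
apply: measurable_bounded_integrable => //.
  apply: (measurable_comp mAB _ mf) => [_ [y By <-]|].
    by split => //; move: xA; rewrite inE.
  by apply: measurable_funTS; exact: measurable_pair1.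
exists M; split; [exact: num_real|move=> K MK y By]; apply: le_trans (ltW MK).
by apply: fM; split => //=; move: xA; rewrite inE.
Qed.

End product_integrals.

Section torus.
Variable R : realType.
Local Notation mR := (measurableTypeR R).

Lemma measurable_torus d : measurable (@torus R d : set (d.-tuple mR)).
Proof.
rewrite (_ : @torus R d = \bigcap_(j in setT) ((fun x => tnth x j) @^-1` (@circle R))).
  apply: fin_bigcap_measurable => // j _; rewrite -[X in measurable X]setTI.
  by apply: measurable_tnth => //; exact: measurable_circle.
apply/seteqP; split=> [x xt j _|x xt j].
  by rewrite /circle/= in_itv; exact: xt.
by have := xt j I; rewrite /circle/= in_itv.
Qed.

Lemma torus_cons d : @tuple_pair R d @^-1` (@torus R d.+1) = @circle R `*` @torus R d.
Proof.
apply/seteqP; split=> [[a z] az|[a z] [/= a0 zt] j]; last first.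
  have [i ->|->] := unliftP ord0 j; first by rewrite tnthS; exact: zt.
  by rewrite tnth0; move: a0; rewrite /circle/= in_itv.
split=> [|j]; first by have := az ord0; rewrite tnth0 /circle/= in_itv.
by have := az (lift ord0 j); rewrite tnthS.
Qed.

Lemma lebesgue_torus d : lebesgue_tuple R d (@torus R d) = ((2 * pi) ^+ d)%:E.
Proof.
elim: d => [|d IH].
  rewrite /= diracE mem_set//; by case.
rewrite -[LHS]/((lebesgue_measure \x lebesgue_tuple R d)%E (@tuple_pair R d @^-1` (@torus R d.+1))).
rewrite torus_cons product_measure1E; [|exact: measurable_circle|exact: measurable_torus].
by rewrite -[X in (X * _)%E]/(lebesgue_measure (@circle R)) lebesgue_circle IH -EFinM exprS.
Qed.

Lemma bounded_torus_integrable d (f : d.-tuple mR -> R) (M : R) : measurable_fun setT f ->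
  (forall z, `|f z| <= M) -> (lebesgue_tuple R d).-integrable (@torus R d) (EFin \o f).
Proof.
move=> mf fM; apply: measurable_bounded_integrable.
- exact: measurable_torus.
- have fin : (lebesgue_tuple R d (@torus R d) < +oo)%E by rewrite lebesgue_torus ltry.
  exact: fin.
- exact: measurable_funTS.
- by exists M; split; [exact: num_real|move=> K MK z _; exact: le_trans (fM z) (ltW MK)].
Qed.

(** The measure on tuples is a pushforward along [tuple_pair], under which the torus pulls back to a
    rectangle. *)
Lemma Rintegral_torusS d (f : d.+1.-tuple mR -> R) (M : R) : measurable_fun setT f ->
  (forall z, `|f z| <= M) ->
  \int[lebesgue_tuple R d.+1]_(z in @torus R d.+1) f z =
  \int[lebesgue_measure]_(a in @circle R) \int[lebesgue_tuple R d]_(z in @torus R d)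
     f [tuple of a :: z].
Proof.
move=> mf fM; have mtp : measurable_fun setT (@tuple_pair R d) by exact: measurable_tuple_pair.
rewrite -(@Rintegral_setX _ _ _ _ R lebesgue_measure (lebesgue_tuple R d) (@circle R) (@torus R d)
  (@measurable_circle R) (@measurable_torus d) (f \o @tuple_pair R d) M).
- rewrite /Rintegral -torus_cons; congr fine.
  transitivity (\int[pushforward (lebesgue_measure \x lebesgue_tuple R d) (@tuple_pair R d)]_
     (z in @torus R d.+1) (f z)%:E)%E.
    by apply: eq_measure_integral => //; exact: measurable_torus.
  rewrite integral_pushforward//.
  + exact/measurable_EFinP.
  + rewrite torus_cons; apply: measurable_bounded_integrable.
    * by apply: measurableX; [exact: measurable_circle|exact: measurable_torus].
    * have e := @product_measure1E _ _ _ _ R lebesgue_measure (lebesgue_tuple R d) (@circle R) (@torus R d)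
         (@measurable_circle R) (@measurable_torus d).
      have fin : ((lebesgue_measure (@circle R) * lebesgue_tuple R d (@torus R d))%E < +oo)%E.
        by rewrite lebesgue_torus lebesgue_circle -EFinM ltry.
      by have := fin; rewrite -e.
    * by apply: measurable_funTS; exact: measurableT_comp.
    * by exists M; split; [exact: num_real|move=> K MK z _; exact: le_trans (fM _) (ltW MK)].
  + exact: measurable_torus.
- have fin : (lebesgue_measure (@circle R) < +oo)%E by rewrite lebesgue_circle ltry.
  exact: fin.
- have fin : (lebesgue_tuple R d (@torus R d) < +oo)%E by rewrite lebesgue_torus ltry.
  exact: fin.
- by apply: measurable_funTS; exact: measurableT_comp.
- by move=> p _; exact: fM.
Qed.

Lemma measurable_prod_tnth d (f : 'I_d -> R -> R) :
  (forall j, measurable_fun setT (f j : mR -> R)) ->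
  measurable_fun setT (fun z : d.-tuple mR => \prod_j f j (tnth z j)).
Proof.
move=> mf; apply: measurable_prod => j _.
by apply: (measurableT_comp (mf j)); exact: measurable_tnth.
Qed.

Lemma norm_prod_le d (f g : 'I_d -> R) : (forall j, `|f j| <= g j) ->
  `|\prod_j f j| <= \prod_j g j.
Proof. by move=> fg; rewrite normr_prod; apply: ler_prod => j _; rewrite normr_ge0 fg. Qed.

Lemma Rintegral_torus_prod d (f : 'I_d -> R -> R) (M : 'I_d -> R) :
  (forall j, measurable_fun setT (f j : mR -> R)) ->
  (forall j x, `|f j x| <= M j) ->
  \int[lebesgue_tuple R d]_(z in @torus R d) (\prod_j f j (tnth z j)) =
  \prod_j \int[lebesgue_measure]_(a in @circle R) f j a.
Proof.
elim: d f M => [|d IH] f M mf fM.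
  rewrite big_ord0; under eq_Rintegral do rewrite big_ord0.
  rewrite /Rintegral integral_cst; last exact: measurable_torus.
  by have := @lebesgue_torus 0; rewrite expr0 => /(congr1 (fun e => fine (1 * e)%E)) ->; rewrite mul1e.
rewrite (@Rintegral_torusS d (fun z => \prod_j f j (tnth z j)) (\prod_j M j)); last 2 first.
- exact: measurable_prod_tnth.
- by move=> z; exact: norm_prod_le.
rewrite big_ord_recl -(IH (fun j => f (lift ord0 j)) (fun j => M (lift ord0 j)))//.
set I := Rintegral _ _ _; rewrite -[RHS]mulrC -RintegralZl//; last 2 first.
- exact: measurable_circle.
- exact: circle_integrable (mf ord0) (fM ord0).
apply: eq_Rintegral => a _; rewrite mulrC -RintegralZl//; last 2 first.
- exact: measurable_torus.
- apply: (bounded_torus_integrable (M := \prod_j M (lift ord0 j))).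
    exact: (measurable_prod_tnth (f := fun j => f (lift ord0 j))).
  by move=> z; exact: (norm_prod_le (f := fun j => f (lift ord0 j) _)).
apply: eq_Rintegral => z _; rewrite big_ord_recl tnth0; congr (_ * _).
by apply: eq_bigr => j _; rewrite tnthS.
Qed.

End torus.

Section green_product.
Variables (R : realType) (d : nat).
Local Notation mR := (measurableTypeR R).
Implicit Types (x y z : d.-tuple R) (u : 'I_d -> R).

Definition kernel (r : R) u : R := \prod_j kernel1 r (u j).

Lemma green_termE t x y (k : 'I_d -> nat) :
  green_term t x y k = \prod_j kernel1_term t (tnth x j - tnth y j) (k j).
Proof.
rewrite /kernel1_term big_split/=; congr (_ * _); rewrite big_split/=; congr (_ * _).
  by rewrite -expR_sum; congr expR; rewrite /eigenvalue4 mulr_suml sumrN.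
rewrite /kernel1_coef prodfV; congr (_^-1); rewrite big_split/= big_const_ord iter_mulr_1; congr (_ * _).
rewrite -big_mkcond/= /num_null -prodr_const; apply: eq_bigl => j; by rewrite inE.
Qed.

(** Summation along cubes is what makes this exact already for partial sums: a sum over all
    functions of a product is a product of sums. *)
Lemma greenE t x y : 0 < t -> green t x y = kernel t (fun j => tnth x j - tnth y j).
Proof.
move=> t0; apply/cvg_lim => //.
have -> : (fun N => \sum_(k : {ffun 'I_d -> 'I_N}) green_term t x y (fun j => k j)) =
    (fun N => \prod_j \sum_(k < N) kernel1_term t (tnth x j - tnth y j) k).
  apply/funext => N; rewrite bigA_distr_bigA/=; apply: eq_bigr => k _; exact: green_termE.
apply: cvg_big => [|j _]; first exact: mul_continuous.
exact: kernel1_cvg_sum.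
Qed.

Lemma kernel_convolution a b x y : 0 < a -> 0 < b ->
  \int[lebesgue_tuple R d]_(z in @torus R d)
    (kernel a (fun j => tnth x j - tnth z j) * kernel b (fun j => tnth y j - tnth z j)) =
  kernel (a + b) (fun j => tnth x j - tnth y j).
Proof.
move=> a0 b0.
under eq_Rintegral do rewrite -big_split/=.
rewrite (@Rintegral_torus_prod R d
  (fun j (z : R) => kernel1 a (tnth x j - z) * kernel1 b (tnth y j - z))
  (fun=> kernel1 a 0 * kernel1 b 0)).
- by apply: eq_bigr => j _; exact: kernel1_convolution.
- move=> j; apply: measurable_funM; apply: (measurableT_comp (measurable_kernel1 _)) => //;
    exact: measurable_funB.
- by move=> j z; rewrite normrM ler_pM// kernel1_le0.
Qed.

End green_product.

(** * L2 norms of differences of kernels *)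

Section singular_integral.
Variable R : realType.
Implicit Types a s beta : R.

Let dpow s beta (x : R) : beta < 1 -> x < s ->
  is_derive x 1 (fun r => - ((s - r) `^ (1 - beta) / (1 - beta))) ((s - x) `^ (- beta)).
Proof.
move=> b1 xs; have sx : 0 < s - x by rewrite subr_gt0.
have d1 : is_derive x 1 (fun r : R => s - r) (-1).
  by apply: is_derive_eq; ring.
have d2 := @is_derive_fun_comp R (fun y => y `^ (1 - beta)) (fun r => s - r) x _ _
  (is_derive1_powR (1 - beta) sx) d1.
have := is_derive_funM d2 (is_derive_fun_cst (- (1 - beta)^-1) x).
rewrite (_ : (fun y => _) = (fun r => - ((s - r) `^ (1 - beta) / (1 - beta)))).
  move/is_derive_eq; apply; rewrite mulr0 addr0.
  rewrite (_ : 1 - beta - 1 = - beta); last by ring.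
  by field; rewrite subr_eq0 gt_eqF.
by apply/funext => y; rewrite mulrN.
Qed.

Let cpow s beta (x : R) : x < s -> {for x, continuous (fun r => (s - r) `^ (- beta))}.
Proof.
move=> xs; have sx : 0 < s - x by rewrite subr_gt0.
have d1 : is_derive x 1 (fun r : R => s - r) (-1).
  by apply: is_derive_eq; ring.
have d2 := @is_derive_fun_comp R (fun y => y `^ (- beta)) (fun r => s - r) x _ _
  (is_derive1_powR (- beta) sx) d1.
apply: differentiable_continuous; apply/derivable1_diffP.
exact: (@ex_derive _ _ _ _ _ _ _ d2).
Qed.

Lemma integral_powR_le a b s beta : a < b -> b < s -> beta < 1 ->
  (\int[lebesgue_measure]_(r in `[a, b]) ((s - r) `^ (- beta))%:E <=
   ((s - a) `^ (1 - beta) / (1 - beta))%:E)%E.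
Proof.
move=> ab bs b1; pose F r := - ((s - r) `^ (1 - beta) / (1 - beta)).
have cF (x : R) : x < s -> {for x, continuous F}.
  move=> xs; apply: differentiable_continuous; apply/derivable1_diffP.
  exact: (@ex_derive _ _ _ _ _ _ _ (dpow b1 xs)).
rewrite (@continuous_FTC2 _ _ F a b ab).
- rewrite -EFinB lee_fin /F opprK addrC lerBlDr lerDl divr_ge0 ?powR_ge0//.
  by rewrite subr_ge0 ltW.
- apply: continuous_in_subspaceT => x; rewrite inE/= in_itv/= => /andP[_ xb].
  by apply: cpow; exact: le_lt_trans bs.
- split => [x||].
  + rewrite in_itv/= => /andP[_ xb].
    by have xs := lt_trans xb bs; exact: (@ex_derive _ _ _ _ _ _ _ (dpow b1 xs)).
  + by apply: cvg_at_right_filter; apply: cF; exact: lt_trans bs.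
  + by apply: cvg_at_left_filter; exact: cF.
- move=> x; rewrite in_itv/= => /andP[_ xb].
  have xs := lt_trans xb bs; have dx := dpow b1 xs.
  by rewrite derive1E; exact: (@derive_val _ _ _ _ _ _ _ dx).
Qed.

(** The primitive is differentiable only before the singularity, hence a monotone limit along
    [[a, b n]] with [b n] increasing to [s]. *)
Lemma integral_singular_le a s beta : a <= s -> beta < 1 ->
  (\int[lebesgue_measure]_(r in `[a, s[) ((s - r) `^ (- beta))%:E <=
   ((s - a) `^ (1 - beta) / (1 - beta))%:E)%E.
Proof.
rewrite le_eqVlt => /predU1P[<- b1|as_ b1].
  rewrite set_itvco0// integral_set0 lee_fin divr_ge0 ?powR_ge0//.
  by rewrite subr_ge0 ltW.
(* With [n.+2], the interval [[a, b 0]] is already nondegenerate. *)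
pose b n : R := s - (s - a) / n.+2%:R.
have bs n : b n < s by rewrite /b gtrBl divr_gt0 ?subr_gt0.
have ab n : a < b n.
  rewrite /b ltrBrDl -ltrBrDr ltr_pdivrMr// ltr_pMr ?subr_gt0//.
  by rewrite ltr1n.
have U : `[a, s[%classic = \bigcup_n `[a, b n]%classic.
  apply/seteqP; split=> [x|x [n _]]; rewrite /= !in_itv/= => /andP[ax xs]; last first.
    by rewrite ax (le_lt_trans xs).
  have xs0 : 0 < s - x by rewrite subr_gt0.
  exists (Num.truncn ((s - a) / (s - x))) => //=; rewrite in_itv/= ax /b /=.
  rewrite lerBrDl -lerBrDr ler_pdivrMr// mulrC -ler_pdivrMr//.
  have h : (s - a) / (s - x) < (Num.truncn ((s - a) / (s - x))).+1%:R by exact: truncnS_gt.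
  by apply: (le_trans (ltW h)); rewrite ler_nat.
rewrite U.
have := @ge0_nondecreasing_set_cvg_integral _ (measurableTypeR R) R (fun n => `[a, b n]%classic)
  (fun r => ((s - r) `^ (- beta))%:E) lebesgue_measure.
have nd : nondecreasing_seq (fun n => `[a, b n]%classic).
  move=> n m nm; apply/subsetPset => x; rewrite /= !in_itv/= => /andP[-> xb]/=.
  apply: (le_trans xb); rewrite /b lerD2l lerN2; apply: ler_wpM2l; first by rewrite subr_ge0 ltW.
  by rewrite lef_pV2 ?posrE// ler_nat.
have mb n : measurable (`[a, b n]%classic : set (measurableTypeR R)) by exact: measurable_itv.
have mf n : measurable_fun (`[a, b n]%classic : set (measurableTypeR R)) (fun r : R => ((s - r) `^ (- beta))%:E).
  apply/measurable_EFinP; apply: measurable_funTS.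
  by apply: (measurableT_comp (measurable_powR _)); exact: measurable_funB.
move=> /(_ nd mb mf) h.
have {h} h := h (fun _ _ _ => powR_ge0 _ _).
rewrite -(cvg_lim _ h)//; apply: lime_le; first by apply/cvg_ex; eexists; exact: h.
by apply: nearW => n; exact: integral_powR_le.
Qed.

End singular_integral.

(** * Variances as integrals over time of explicit slices *)

Section wiener_kernel.
Variables (R : realType) (d : nat) (T : R).
Local Notation mR := (measurableTypeR R).
Local Notation st := (mR * d.-tuple mR)%type.
Implicit Types (t s r c : R) (x y z : d.-tuple R).

Definition diag_kernel r : R := kernel1 r 0 ^+ d.

Lemma kernel_cst0 r : @kernel R d r (fun=> 0) = diag_kernel r.
Proof. by rewrite /kernel prodr_const card_ord. Qed.

Definition wiener_kernel t x : st -> R :=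
  fun p => if (p.1 : R) < t then green (t - p.1) x p.2 else 0.

(** By the isometry, the variance of [v t x - c * v s y]. *)
Definition kernel_norm2 t x s y c : \bar R :=
  (\int[@st_measure R d]_(p in @spacetime R T d)
     ((wiener_kernel t x p - c * wiener_kernel s y p) ^+ 2)%:E)%E.

(** The contribution of the noise at time [r], in closed form: kernels at times [t - r] and [s - r]
    integrate against each other to the kernel at the sum of these times. The tests [r < t] and
    [r < s] are there because noise acts only on later times. *)
Definition kernel_slice t x s y c r : R :=
  (if r < t then diag_kernel (2 * (t - r)) else 0)
  - 2 * c * (if (r < t) && (r < s) then
      kernel (t + s - 2 * r) (fun j => tnth x j - tnth y j) else 0)
  + c ^+ 2 * (if r < s then diag_kernel (2 * (s - r)) else 0).

Lemma wiener_kernelE t x r z : r < t ->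
  wiener_kernel t x (r, z) = kernel (t - r) (fun j => tnth x j - tnth z j).
Proof. by move=> rt; rewrite /wiener_kernel/= rt greenE// subr_gt0. Qed.

Lemma wiener_kernel0 t x r z : t <= r -> wiener_kernel t x (r, z) = 0.
Proof. by move=> tr; rewrite /wiener_kernel/= ltNge tr. Qed.

Lemma measurable_kernel r x : 0 < r ->
  measurable_fun setT (fun z : d.-tuple mR => kernel r (fun j => tnth x j - tnth z j)).
Proof.
move=> r0; apply: (@measurable_prod_tnth R d (fun j (z : R) => kernel1 r (tnth x j - z))) => j.
by apply: (measurableT_comp (measurable_kernel1 r0)); exact: measurable_funB.
Qed.

Lemma kernel_le0 r (u : 'I_d -> R) : 0 < r -> `|kernel r u| <= diag_kernel r.
Proof.
by move=> r0; rewrite -kernel_cst0; apply: norm_prod_le => j; exact: kernel1_le0.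
Qed.

Let slice_bound t r : R := if r < t then diag_kernel (t - r) else 0.

Let wiener_kernel_le t x r z : `|wiener_kernel t x (r, z)| <= slice_bound t r.
Proof.
rewrite /slice_bound; case: ifPn => [rt|]; last first.
  by rewrite -leNgt => tr; rewrite wiener_kernel0// normr0.
by rewrite wiener_kernelE// kernel_le0// subr_gt0.
Qed.

Let measurable_wiener_slice t x r :
  measurable_fun setT (fun z : d.-tuple mR => wiener_kernel t x (r, z)).
Proof.
have [rt|tr] := ltP r t.
  by under eq_fun do rewrite wiener_kernelE//; apply: measurable_kernel; rewrite subr_gt0.
by under eq_fun do rewrite wiener_kernel0//; exact: measurable_cst.
Qed.

Let integrable_wiener_slice t x s y r : (lebesgue_tuple R d).-integrable (@torus R d)
  (EFin \o (fun z => wiener_kernel t x (r, z) * wiener_kernel s y (r, z))).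
Proof.
apply: (bounded_torus_integrable (M := slice_bound t r * slice_bound s r)).
  exact: measurable_funM.
by move=> z; rewrite normrM ler_pM// wiener_kernel_le.
Qed.

Let wiener_slice_prod t x s y r : \int[lebesgue_tuple R d]_(z in @torus R d)
    (wiener_kernel t x (r, z) * wiener_kernel s y (r, z)) =
  if (r < t) && (r < s) then kernel (t + s - 2 * r) (fun j => tnth x j - tnth y j) else 0.
Proof.
case: ifPn => [/andP[rt rs]|].
  rewrite (_ : t + s - 2 * r = t - r + (s - r)); last by ring.
  rewrite -kernel_convolution ?subr_gt0//.
  by apply: eq_Rintegral => z _; rewrite !wiener_kernelE.
rewrite negb_and -!leNgt => rts; rewrite /Rintegral integral0_eq// => z _.
by case/orP: rts => h; rewrite (wiener_kernel0 _ _ h) ?mulr0 ?mul0r.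
Qed.

Lemma kernel_sliceE t x s y c r :
  (\int[lebesgue_tuple R d]_(z in @torus R d)
     ((wiener_kernel t x (r, z) - c * wiener_kernel s y (r, z)) ^+ 2)%:E =
   (kernel_slice t x s y c r)%:E)%E.
Proof.
set f := fun z => wiener_kernel t x (r, z) * wiener_kernel t x (r, z)
  + ((- (2 * c)) * (wiener_kernel t x (r, z) * wiener_kernel s y (r, z))
  + c ^+ 2 * (wiener_kernel s y (r, z) * wiener_kernel s y (r, z))).
transitivity (\int[lebesgue_tuple R d]_(z in @torus R d) (f z)%:E)%E.
  by apply: eq_integral => z _; rewrite /f; congr (_%:E); ring.
have mtor := @measurable_torus R d.
have int1 := integrable_wiener_slice t x t x r.
have int2 := integrable_wiener_slice t x s y r.
have int3 := integrable_wiener_slice s y s y r.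
have int2' := integrableZl mtor (- (2 * c)) int2.
have int3' := integrableZl mtor (c ^+ 2) int3.
have intf : (lebesgue_tuple R d).-integrable (@torus R d) (EFin \o f).
  by apply: eq_integrable (integrableD mtor int1 (integrableD mtor int2' int3')) => // z _.
rewrite -[LHS]fineK; last exact: integrable_fin_num.
congr (_%:E); rewrite -[LHS]/(\int[lebesgue_tuple R d]_(z in @torus R d) f z) /f.
have int23 : (lebesgue_tuple R d).-integrable (@torus R d) (EFin \o (fun z =>
    (- (2 * c)) * (wiener_kernel t x (r, z) * wiener_kernel s y (r, z))
    + c ^+ 2 * (wiener_kernel s y (r, z) * wiener_kernel s y (r, z)))).
  by apply: eq_integrable (integrableD mtor int2' int3') => // z _.
rewrite (RintegralD mtor int1 int23) (RintegralD mtor int2' int3') !RintegralZl// !wiener_slice_prod /kernel_slice !andbb.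
rewrite mulNr addrA; congr (_ - _ + _ * _).
- case: ifP => // _; rewrite (_ : t + t - 2 * r = 2 * (t - r)); last by ring.
  by rewrite -kernel_cst0; congr kernel; apply/funext => j; rewrite subrr.
- case: ifP => // _; rewrite (_ : s + s - 2 * r = 2 * (s - r)); last by ring.
  by rewrite -kernel_cst0; congr kernel; apply/funext => j; rewrite subrr.
Qed.

Lemma kernel_slice_ge0 t x s y c r : 0 <= kernel_slice t x s y c r.
Proof.
rewrite -lee_fin -kernel_sliceE; apply: integral_ge0 => z _.
by rewrite lee_fin sqr_ge0.
Qed.

Let mspacetime : measurable (@spacetime R T d : set st).
Proof. by apply: measurableX; [exact: measurable_itv|exact: measurable_torus]. Qed.

(** Joint measurability of the kernels in time and space is part of the existence of the Wiener
    integrals and is supplied from there. *)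
Lemma kernel_norm2E t x s y c :
  measurable_fun (@spacetime R T d) (wiener_kernel t x) ->
  measurable_fun (@spacetime R T d) (wiener_kernel s y) ->
  kernel_norm2 t x s y c =
  (\int[lebesgue_measure]_(r in [set` `[0%R, T]]) (kernel_slice t x s y c r)%:E)%E.
Proof.
move=> mt ms; rewrite /kernel_norm2 /st_measure /spacetime ge0_integral_setX.
- by apply: eq_integral => r _; exact: kernel_sliceE.
- exact: measurable_itv.
- exact: measurable_torus.
- apply/measurable_EFinP; apply: measurable_funX; apply: measurable_funB => //.
  exact: measurable_funM.
- by move=> p _; rewrite lee_fin sqr_ge0.
Qed.

Lemma measurable_kernel_slice t x s y c :
  measurable_fun (@spacetime R T d) (wiener_kernel t x) ->
  measurable_fun (@spacetime R T d) (wiener_kernel s y) ->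
  measurable_fun (`[0, T]%classic : set mR) (kernel_slice t x s y c).
Proof.
move=> mt ms; apply/measurable_EFinP.
pose f p := ((wiener_kernel t x p - c * wiener_kernel s y p) ^+ 2)%:E.
have mf : measurable_fun (@spacetime R T d) f.
  apply/measurable_EFinP; apply: measurable_funX; apply: measurable_funB => //.
  exact: measurable_funM.
have mf0 := (measurable_restrictT f mspacetime).1 mf.
have f0 p : (0 <= (f \_ (@spacetime R T d)) p)%E.
  by apply: erestrict_ge0 => q _; rewrite lee_fin sqr_ge0.
have h := measurable_fun_fubini_tonelli_F (m2 := lebesgue_tuple R d) _ mf0 f0.
apply: eq_measurable_fun (measurable_funTS h) => r; rewrite inE => rT.
rewrite /fubini_F/= -kernel_sliceE [RHS]integral_mkcond; apply: eq_integral => z _.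
by rewrite !patchE in_setX mem_set.
Qed.

End wiener_kernel.

Section integral_split.
Variable R : realType.

Lemma ge0_integral_itv_split (a b : R) (z : itv_bound R) (f : R -> \bar R) :
  a <= b -> (BLeft b <= z)%O ->
  measurable_fun ([set` Interval (BLeft a) z] : set (measurableTypeR R)) f ->
  (forall x, 0 <= f x)%E ->
  (\int[lebesgue_measure]_(x in [set` Interval (BLeft a) z]) f x =
   \int[lebesgue_measure]_(x in [set` `[a, b[]) f x +
   \int[lebesgue_measure]_(x in [set` Interval (BLeft b) z]) f x)%E.
Proof.
move=> ab bz mf f0.
have U : [set` Interval (BLeft a) z] = [set` `[a, b[] `|` [set` Interval (BLeft b) z].
  by rewrite -itv_bndbnd_setU// bnd_simp.
rewrite U ge0_integral_setU//.
- by rewrite -U.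
- apply/disj_setPS => y [/=]; rewrite in_itv/= itv_boundlr => /andP[_ yb] /andP[].
  by rewrite bnd_simp leNgt yb.
Qed.

End integral_split.

(** * Upper bounds on the variances of increments *)

Section kernel_upper_bounds.
Variable R : realType.
Implicit Types a r u tau L : R.

Definition scale r : R := r `^ (- 4^-1).

Lemma scale_gt0 r : 0 < r -> 0 < scale r.
Proof. exact: powR_gt0. Qed.

Lemma scaleX r k : 0 < r -> scale r ^+ k = r `^ (- (k%:R / 4)).
Proof.
move=> r0; rewrite -powR_mulrn ?powR_ge0// -powRrM; congr (_ `^ _).
by rewrite mulNr mulrC.
Qed.

Lemma scaleK r : 0 < r -> (scale r ^+ 4)^-1 = r.
Proof.
move=> r0; rewrite scaleX// divff// powR_inv1 ?invrK// ltW//.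
Qed.

Lemma scale_le r r' : 0 < r -> r <= r' -> scale r' <= scale r.
Proof.
move=> r0 rr'; rewrite /scale !powRN lef_pV2 ?posrE ?powR_gt0 ?(lt_le_trans r0)//.
by rewrite ge0_ler_powR ?nnegrE ?(ltW r0)// (le_trans (ltW r0)).
Qed.

(** Because [min 1 x <= x ^ al], a bound on the size and a bound on the derivative combine into one
    of any intermediate order. The order is later chosen so that the singularity at the final time
    stays integrable. *)
Lemma le_powR_interpolation (A x y al : R) : 0 <= A -> 0 <= x -> 0 < al -> al <= 1 ->
  y <= A -> y <= A * x -> y <= A * x `^ al.
Proof.
move=> A0 x0 al0 al1 yA yAx; have [x1|x1] := leP x 1.
  apply: (le_trans yAx); apply: ler_wpM2l => //.
  have [->|xn0] := eqVneq x 0; first by rewrite powR0 ?gt_eqF.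
  by apply: ger1_powR => //; rewrite lt_neqAle eq_sym xn0 x0.
apply: (le_trans yA); rewrite ler_peMr//.
have := @ler_powR R x (ltW x1) 0 al (ltW al0); by rewrite powRr0.
Qed.

Lemma prod_lipschitz d (M : R) (a b : 'I_d -> R) :
  (forall j, `|a j| <= M) -> (forall j, `|b j| <= M) ->
  `|\prod_j a j - \prod_j b j| <= M ^+ d.-1 * \sum_j `|a j - b j|.
Proof.
elim: d a b => [|d IH] a b aM bM; first by rewrite !big_ord0 expr0 mulr0 subrr normr0.
have M0 : 0 <= M by exact: le_trans (normr_ge0 _) (bM ord0).
rewrite !big_ord_recl /=; set A := \prod_(i < d) a _; set B := \prod_(i < d) b _.
have AM : `|A| <= M ^+ d.
  rewrite /A -[in leRHS](card_ord d) -prodr_const normr_prod; apply: ler_prod => j _.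
  by rewrite normr_ge0 aM.
have := IH (fun j => a (lift ord0 j)) (fun j => b (lift ord0 j)) (fun j => aM _) (fun j => bM _).
rewrite -/A -/B; set S := \sum_(j < d) _ => h.
rewrite (_ : _ - _ = A * (a ord0 - b ord0) + b ord0 * (A - B)); last by ring.
rewrite [leRHS]mulrDr; apply: le_trans (ler_normD _ _) _; rewrite !normrM; apply: lerD.
  exact: ler_wpM2r.
apply: (@le_trans _ _ (M * (M ^+ d.-1 * S))); first by apply: ler_pM.
rewrite mulrA le_eqVlt; apply/orP; left; apply/eqP.
have [d0|d1] := posnP d; last by rewrite -exprS prednK.
by rewrite /S big1 ?mulr0// => j; have := ltn_ord j; rewrite [X in (_ < X)%N]d0.
Qed.

Lemma prod_diff_le d (G : R) (b : 'I_d -> R) : (forall j, `|b j| <= G) ->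
  G ^+ d - \prod_j b j <= G ^+ d.-1 * \sum_j (G - b j).
Proof.
move=> bG; have G0 (j : 'I_d) : `|G| <= G by rewrite ger0_norm// (le_trans _ (bG j)).
have := prod_lipschitz G0 bG; rewrite prodr_const card_ord.
move/(le_trans (ler_norm _)) => /le_trans; apply; rewrite le_eqVlt; apply/orP; left; apply/eqP.
congr (_ * _); apply: eq_bigr => j _.
by rewrite ger0_norm// subr_ge0 (le_trans (ler_norm _)).
Qed.

Variables (T al th : R).
Hypotheses (T0 : 0 < T) (al0 : 0 < al) (al1 : al <= 1) (th0 : 0 < th) (th1 : th <= 1).

(** Comes from [1 + 2 L] with [1 <= (2 T) ^ (1 / 4) * L] for times up to [2 T], the range of the
    sums of two times in [[0, T]]. *)
Definition kernel1_const : R := 2 + (2 * T) `^ 4^-1.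

Let K := kernel1_const.

Let K2 : 2 <= K. Proof. by rewrite /K /kernel1_const lerDl powR_ge0. Qed.
Let K0 : 0 <= K. Proof. by apply: le_trans K2. Qed.

Lemma kernel1_upper r : 0 < r -> r <= 2 * T -> kernel1 r 0 <= K * scale r.
Proof.
move=> r0 rT; have h := kernel1_0_le (scale_gt0 r0).
rewrite scaleK// in h; apply: (le_trans h); rewrite /K /kernel1_const [leRHS]mulrDl addrC lerD2l.
rewrite /scale powRN ler_pdivlMr ?powR_gt0// mul1r.
by rewrite ge0_ler_powR ?nnegrE ?mulr_ge0// ltW.
Qed.

(** The kernel is moved in time at [u = 0] and then in space at the later time [a + tau]; each move
    is interpolated between the size of the kernel and a derivative bound. *)
Lemma kernel1_increment a tau u : 0 < a -> a <= 2 * T -> 0 <= tau ->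
  kernel1 a 0 - kernel1 (a + tau) u <=
  2 * K * scale a * ((tau * scale a ^+ 4) `^ al + (u ^+ 2 * scale a ^+ 2) `^ th).
Proof.
move=> a0 aT tau0; set L := scale a.
have L0 : 0 < L by exact: scale_gt0.
have at0 : 0 < a + tau by rewrite ltr_pwDl.
have KL0 : 0 <= K * L by rewrite mulr_ge0// ltW.
have /andP[t1 t2] := kernel1_time_le (scale_gt0 a0) tau0.
rewrite scaleK// -/L in t1 t2.
have up := kernel1_upper a0 aT; rewrite -/L in up.
have pos : 0 <= kernel1 (a + tau) 0 by apply: le_trans (kernel1_0_ge at0); rewrite invr_ge0 mulr_ge0// pi_ge0.
have h1 : kernel1 a 0 - kernel1 (a + tau) 0 <= K * L * (tau * L ^+ 4) `^ al.
  apply: le_powR_interpolation => //.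
  - by rewrite mulr_ge0// exprn_ge0// ltW.
  - by apply: le_trans up; rewrite gerBl.
  - apply: (le_trans t2); rewrite (_ : 2 * tau * L ^+ 5 = 2 * (L * (tau * L ^+ 4))); last by ring.
    rewrite -[leRHS]mulrA; apply: ler_wpM2r => //.
    by apply: mulr_ge0; [exact: ltW|rewrite mulr_ge0// exprn_ge0// ltW].
have h2 : kernel1 (a + tau) 0 - kernel1 (a + tau) u <= 2 * K * L * (u ^+ 2 * L ^+ 2) `^ th.
  have ss := kernel1_space_le u (scale_gt0 at0); rewrite scaleK// in ss.
  have LL : scale (a + tau) <= L by apply: scale_le => //; rewrite lerDl.
  apply: le_powR_interpolation => //.
  - by rewrite -mulrA mulr_ge0.
  - by rewrite mulr_ge0 ?sqr_ge0.
  - have := kernel1_le0 u at0; rewrite ler_norml => /andP[u1 _]; rewrite -mulrA; lra.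
  - apply: (le_trans ss).
    apply: (@le_trans _ _ (u ^+ 2 * L ^+ 3)).
      by rewrite ler_wpM2l ?sqr_ge0// lerXn2r ?nnegrE// ltW// scale_gt0.
    rewrite (_ : _ * L ^+ 3 = 1 * (L * (u ^+ 2 * L ^+ 2))); last by ring.
    rewrite -[leRHS]mulrA; apply: ler_wpM2r; last by move: K2; lra.
    by apply: mulr_ge0; [exact: ltW|apply: mulr_ge0; exact: sqr_ge0].
have p0 : 0 <= (tau * L ^+ 4) `^ al by exact: powR_ge0.
have := mulr_ge0 KL0 p0; rewrite mulrDr.
move: h1 h2; rewrite -![2 * K * L * _]mulrA -!(mulrA K); lra.
Qed.

Section kernel_norm_upper.
Variable d : nat.
Hypotheses (d1 : (0 < d)%N) (dal : d%:R / 4 + al < 1) (dth : d%:R / 4 + th / 2 < 1).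
Implicit Types (t s : R) (x y : d.-tuple R).

Lemma diag_kernel_upper r : 0 < r -> r <= 2 * T ->
  diag_kernel d r <= K ^+ d * r `^ (- (d%:R / 4)).
Proof.
move=> r0 rT; rewrite /diag_kernel -scaleX// -exprMn lerXn2r ?nnegrE ?kernel1_upper//.
  by apply: le_trans (kernel1_0_ge r0); rewrite invr_ge0 mulr_ge0// pi_ge0.
by rewrite mulr_ge0// ltW// scale_gt0.
Qed.

Lemma diag_kernel_le r r' : 0 < r -> r <= r' -> diag_kernel d r' <= diag_kernel d r.
Proof.
move=> r0 rr'; have r'0 : 0 < r' by exact: lt_le_trans rr'.
have pos (a : R) : 0 < a -> 0 <= kernel1 a 0.
  by move=> /kernel1_0_ge; apply: le_trans; rewrite invr_ge0 mulr_ge0// pi_ge0.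
rewrite /diag_kernel lerXn2r ?nnegrE ?pos//.
have h := kernel1_time_le (scale_gt0 r0) (_ : 0 <= r' - r).
rewrite scaleK// subrKC in h; have /andP[+ _] := h ltac:(by rewrite subr_ge0).
by rewrite subr_ge0.
Qed.

(** The diagonal kernel decreases in time, so the slice is at most twice
    [diag_kernel a - kernel (a + tau) u] with [a = 2 (s - r)], and one-dimensional increments apply
    factor by factor. Each power of [L] spent on regularity sharpens the singularity at [r = s],
    whence the conditions [dal] and [dth] for integrability. *)
Lemma kernel_slice_upper t x s y r : 0 <= r -> r < s -> s <= t -> t <= T ->
  kernel_slice t x s y 1 r <= 4 * K ^+ d *
    (d%:R * (t - s) `^ al * (s - r) `^ (- (d%:R / 4 + al)) +
     (\sum_j ((tnth x j - tnth y j) ^+ 2) `^ th) * (s - r) `^ (- (d%:R / 4 + th / 2))).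
Proof.
move=> r0 rs st tT; have rt : r < t by exact: lt_le_trans st.
rewrite /kernel_slice rt rs /= expr1n mul1r mulr1.
set a := 2 * (s - r); set tau := t - s.
have tau0 : 0 <= tau by rewrite subr_ge0.
have sr0 : 0 < s - r by rewrite subr_gt0.
have a0 : 0 < a by rewrite mulr_gt0.
have aT : a <= 2 * T by rewrite ler_wpM2l//; lra.
rewrite (_ : t + s - 2 * r = a + tau); last by rewrite /a /tau; ring.
have Da : diag_kernel d (2 * (t - r)) <= diag_kernel d a.
  by apply: diag_kernel_le => //; rewrite ler_wpM2l// lerD2r.
set u := fun j => tnth x j - tnth y j; set G := kernel1 a 0; set L := scale a.
have L0 : 0 < L by exact: scale_gt0.
have at0 : 0 < a + tau by rewrite ltr_pwDl.
have G0 : 0 <= G by apply: le_trans (kernel1_0_ge a0); rewrite invr_ge0 mulr_ge0// pi_ge0.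
have GKL : G <= K * L by exact: kernel1_upper.
have bG j : `|kernel1 (a + tau) (u j)| <= G.
  apply: (le_trans (kernel1_le0 _ at0)); rewrite -subr_ge0.
  by have := kernel1_time_le (scale_gt0 a0) tau0; rewrite scaleK// => /andP[].
have h1 := prod_diff_le bG.
have h2 : G ^+ d.-1 * (\sum_j (G - kernel1 (a + tau) (u j))) <=
    (K * L) ^+ d.-1 * (\sum_j (2 * K * L * ((tau * L ^+ 4) `^ al + (u j ^+ 2 * L ^+ 2) `^ th))).
  apply: ler_pM; first exact: exprn_ge0.
  - by apply: sumr_ge0 => j _; rewrite subr_ge0 (le_trans (ler_norm _)).
  - by rewrite lerXn2r ?nnegrE// mulr_ge0// ltW.
  - by apply: ler_sum => j _; exact: kernel1_increment.
apply: (@le_trans _ _ (2 * (diag_kernel d a - kernel (a + tau) u))); first by rewrite -/(diag_kernel d a); lra.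
have E : (K * L) ^+ d.-1 * (\sum_j (2 * K * L * ((tau * L ^+ 4) `^ al + (u j ^+ 2 * L ^+ 2) `^ th))) =
   2 * K ^+ d * (d%:R * tau `^ al * a `^ (- (d%:R / 4 + al)) +
      (\sum_j (u j ^+ 2) `^ th) * a `^ (- (d%:R / 4 + th / 2))).
  rewrite -mulr_sumr big_split/= sumr_const card_ord.
  have -> : \sum_j (u j ^+ 2 * L ^+ 2) `^ th = (\sum_j (u j ^+ 2) `^ th) * (L ^+ 2) `^ th.
    by rewrite mulr_suml; apply: eq_bigr => j _; rewrite powRM ?sqr_ge0.
  rewrite powRM ?exprn_ge0 ?(ltW L0)//.
  have La m (e : R) : L ^+ d * (L ^+ m) `^ e = a `^ (- (d%:R / 4 + e * m%:R / 4)).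
    rewrite opprD powRD; last by rewrite (gt_eqF a0) implybT.
    rewrite -scaleX//; congr (_ * _); rewrite /L scaleX// -powRrM.
    by congr (_ `^ _); field.
  have := La 4 al; have := La 2 th.
  rewrite (_ : al * 4 / 4 = al); last by field.
  rewrite (_ : th * 2 / 4 = th / 2); last by field.
  move=> <- <-; set A := tau `^ al; set Bu := \sum_j _; set P1 := (L ^+ 4) `^ al; set P2 := (L ^+ 2) `^ th.
  have -> (w : R) : 2 * K ^+ d * w = 2 * K * (K ^+ d.-1 * w) by rewrite -[in LHS](prednK d1) exprS; ring.
  have -> : L ^+ d = L * L ^+ d.-1 by rewrite -exprS prednK.
  by rewrite exprMn -mulr_natl; ring.
apply: (@le_trans _ _ (2 * ((K * L) ^+ d.-1 * (\sum_j (2 * K * L * ((tau * L ^+ 4) `^ al + (u j ^+ 2 * L ^+ 2) `^ th)))))).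
  by rewrite ler_wpM2l// (le_trans _ h2).
rewrite E mulrA (_ : 2 * (2 * K ^+ d) = 4 * K ^+ d); last by ring.
have srE (e : R) : 0 <= e -> a `^ (- e) <= (s - r) `^ (- e).
  move=> e0; rewrite !powRN lef_pV2 ?posrE ?powR_gt0//.
  apply: ge0_ler_powR; rewrite ?nnegrE ?(ltW sr0) ?(ltW a0)//.
  by rewrite /a ler_peMl ?(ltW sr0)// ler1n.
rewrite ler_wpM2l//; first by rewrite mulr_ge0// exprn_ge0.
apply: lerD; apply: ler_wpM2l.
- by rewrite mulr_ge0// powR_ge0.
- by apply: srE; rewrite addr_ge0 ?divr_ge0// ltW.
- by apply: sumr_ge0 => j _; exact: powR_ge0.
- by apply: srE; rewrite addr_ge0 ?divr_ge0// ltW.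
Qed.

Lemma kernel_slice_upper_late t x s y r : s <= r -> 0 <= r -> t <= T ->
  kernel_slice t x s y 1 r <= if r < t then K ^+ d * (t - r) `^ (- (d%:R / 4)) else 0.
Proof.
move=> sr r0 tT; rewrite /kernel_slice [r < s]ltNge sr /= andbF mulr0 subr0 mulr0 addr0.
case: ifP => // rt; have tr0 : 0 < t - r by rewrite subr_gt0.
apply: (le_trans (diag_kernel_upper _ _)); first by rewrite mulr_gt0.
  by rewrite ler_wpM2l//; lra.
rewrite ler_wpM2l ?exprn_ge0// !powRN lef_pV2 ?posrE ?powR_gt0 ?mulr_gt0//.
by rewrite ge0_ler_powR ?nnegrE ?divr_ge0// ?mulr_ge0 ?ltW// ltr_pMl// ltr1n.
Qed.

Let mX := fun t x => measurable_fun (@spacetime R T d) (@wiener_kernel R d t x).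

Lemma kernel_norm2_upper : exists2 C : R, 0 < C & forall t x s y,
  mX t x -> mX s y -> 0 <= s -> s <= t -> t <= T ->
  (kernel_norm2 T t x s y 1 <=
   (C * ((t - s) `^ al + \sum_j ((tnth x j - tnth y j) ^+ 2) `^ th))%:E)%E.
Proof.
set b1 := d%:R / 4 + al; set b2 := d%:R / 4 + th / 2; set b0 := d%:R / 4 : R.
have b01 : b0 < 1 by apply: lt_trans dal; rewrite ltrDl.
have pw (e e' : R) : e < 1 -> 0 <= e' -> e' <= T -> e' `^ (1 - e) / (1 - e) <= T `^ (1 - e) / (1 - e).
  move=> e1 e'0 e'T; rewrite ler_wpM2r ?invr_ge0 ?subr_ge0 ?(ltW e1)//.
  by rewrite ge0_ler_powR ?nnegrE ?subr_ge0 ?(ltW e1) ?(ltW T0).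
pose c1 := T `^ (1 - b1) / (1 - b1); pose c2 := T `^ (1 - b2) / (1 - b2).
(* The noise of [[s, t[] contributes order [tau ^ (1 - b0)] where only [tau ^ al] is wanted; as
   [al < 1 - b0], the surplus power is bounded by the same power of [T]. *)
pose c0 := T `^ (1 - b0 - al) / (1 - b0).
have c10 : 0 <= c1 by rewrite divr_ge0 ?powR_ge0// subr_ge0 ltW.
have c20 : 0 <= c2 by rewrite divr_ge0 ?powR_ge0// subr_ge0 ltW.
have c00 : 0 <= c0 by rewrite divr_ge0 ?powR_ge0// subr_ge0 ltW.
have Kd0 : 0 <= K ^+ d by rewrite exprn_ge0.
exists (4 * K ^+ d * (d%:R * c1 + c2) + K ^+ d * c0 + 1).
  have p1 : 0 <= 4 * K ^+ d * (d%:R * c1 + c2).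
    by apply: mulr_ge0; rewrite ?mulr_ge0// addr_ge0// mulr_ge0.
  by have := mulr_ge0 Kd0 c00; move: p1; lra.
move=> t x s y mt ms s0 st tT; have sT : s <= T by exact: le_trans tT.
have t0 : 0 <= t by exact: le_trans st.
rewrite kernel_norm2E//; set S := kernel_slice t x s y 1.
have S0 r : (0 <= (S r)%:E)%E by rewrite lee_fin kernel_slice_ge0.
have mS : measurable_fun (`[0, T]%classic : set (measurableTypeR R)) (EFin \o S).
  by apply/measurable_EFinP; exact: measurable_kernel_slice.
have mI (i : interval R) : measurable ([set` i] : set (measurableTypeR R)) by exact: measurable_itv.
set tau := t - s; set Us := \sum_j ((tnth x j - tnth y j) ^+ 2) `^ th.
have tau0 : 0 <= tau by rewrite subr_ge0.
have tauT : tau <= T by rewrite /tau; lra.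
have Us0 : 0 <= Us by apply: sumr_ge0 => j _; exact: powR_ge0.
have mpow (D : set (measurableTypeR R)) (c b e : R) :
    measurable_fun D (fun r => (c * (b - r) `^ e)%:E).
  apply/measurable_EFinP/measurable_funTS; apply: measurable_funM => //.
  by apply: (measurableT_comp (measurable_powR _)); exact: measurable_funB.
have int_pow (c b e f : R) : 0 <= c -> b <= f -> e < 1 ->
    (\int[lebesgue_measure]_(r in [set` `[b, f[]) (c * (f - r) `^ (- e))%:E <=
     (c * ((f - b) `^ (1 - e) / (1 - e)))%:E)%E.
  move=> cpos bf e1; under eq_integral do rewrite EFinM.
  rewrite ge0_integralZl_EFin//; last 2 first.
  - by move=> r _; rewrite lee_fin powR_ge0.
  - by apply: eq_measurable_fun (mpow [set` `[b, f[] 1 f (- e)) => r _; rewrite mul1r.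
  by rewrite EFinM; apply: lee_wpmul2l; [rewrite lee_fin|exact: integral_singular_le].
have I1 : (\int[lebesgue_measure]_(r in [set` `[0%R, s[]) (S r)%:E <=
    (4 * K ^+ d * (d%:R * tau `^ al) * c1 + 4 * K ^+ d * Us * c2)%:E)%E.
  apply: (@le_trans _ _ (\int[lebesgue_measure]_(r in [set` `[0%R, s[])
     ((4 * K ^+ d * (d%:R * tau `^ al) * (s - r) `^ (- b1))%:E + (4 * K ^+ d * Us * (s - r) `^ (- b2))%:E))%E).
    apply: ge0_le_integral => //.
    - by apply: measurable_funS mS => //; apply: subset_itvl; rewrite bnd_simp.
    - by apply: emeasurable_funD; exact: mpow.
    - move=> r; rewrite /= in_itv/= => /andP[r0 rs].
      rewrite -EFinD lee_fin; apply: (le_trans (kernel_slice_upper _ _ r0 rs st tT)).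
      by rewrite le_eqVlt; apply/orP; left; apply/eqP; rewrite -/tau -/Us -/b1 -/b2; ring.
  rewrite ge0_integralD//=; last 2 first.
  - by move=> r _; rewrite lee_fin mulr_ge0 ?powR_ge0// mulr_ge0 ?mulr_ge0 ?powR_ge0.
  - by move=> r _; rewrite lee_fin mulr_ge0 ?powR_ge0// mulr_ge0 ?mulr_ge0.
  rewrite EFinD; apply: leeD.
    apply: (le_trans (int_pow _ _ _ _ _ s0 dal)); first by rewrite mulr_ge0 ?mulr_ge0 ?powR_ge0.
    by rewrite subr0 lee_fin ler_wpM2l ?pw// mulr_ge0 ?mulr_ge0 ?powR_ge0.
  apply: (le_trans (int_pow _ _ _ _ _ s0 dth)); first by rewrite mulr_ge0 ?mulr_ge0.
  by rewrite subr0 lee_fin ler_wpM2l ?pw// mulr_ge0 ?mulr_ge0.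
have I2 : (\int[lebesgue_measure]_(r in [set` `[s, t[]) (S r)%:E <=
    (K ^+ d * (tau `^ al * c0))%:E)%E.
  apply: (@le_trans _ _ (\int[lebesgue_measure]_(r in [set` `[s, t[])
     (K ^+ d * (t - r) `^ (- b0))%:E)%E).
    apply: ge0_le_integral => //.
    - apply: measurable_funS mS => // r; rewrite /= !in_itv/= => /andP[sr rt].
      by rewrite (le_trans s0 sr) ltW// (lt_le_trans rt).
    - move=> r; rewrite /= in_itv/= => /andP[sr rt].
      rewrite lee_fin; apply: (le_trans (kernel_slice_upper_late _ _ sr (le_trans s0 sr) tT)).
      by rewrite rt.
  apply: (le_trans (int_pow _ _ _ _ Kd0 st b01)); rewrite lee_fin ler_wpM2l//.
  rewrite /c0 mulrA ler_wpM2r ?invr_ge0 ?subr_ge0 ?(ltW b01)// -/tau.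
  have [->|tn0] := eqVneq tau 0.
    rewrite powR0; last by rewrite subr_eq0 gt_eqF.
    by rewrite mulr_ge0 ?powR_ge0.
  rewrite (_ : 1 - b0 = al + (1 - b0 - al)); last by ring.
  rewrite powRD; last by rewrite tn0 implybT.
  have e0 : 0 <= 1 - b0 - al by move: dal; rewrite /b0; lra.
  by rewrite (_ : al + (1 - b0 - al) - al = 1 - b0 - al) ?ler_wpM2l ?powR_ge0// ?ge0_ler_powR ?nnegrE ?(ltW T0)//; ring.
have I3 : (\int[lebesgue_measure]_(r in [set` `[t, T]]) (S r)%:E <= 0)%E.
  rewrite -(integral0 lebesgue_measure [set` `[t, T]]); apply: ge0_le_integral => //.
    by apply: measurable_funS mS => //; apply: subset_itvr; rewrite bnd_simp.
  move=> r; rewrite /= in_itv/= => /andP[tr rT]; rewrite lee_fin.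
  have := kernel_slice_upper_late x y (le_trans st tr) (le_trans t0 tr) tT.
  by rewrite ltNge tr.
rewrite (ge0_integral_itv_split (b := s))//.
rewrite (ge0_integral_itv_split (a := s) (b := t))//; last first.
  by apply: measurable_funS mS => //; apply: subset_itvr; rewrite bnd_simp.
apply: (le_trans (leeD I1 (leeD I2 I3))); rewrite -!EFinD lee_fin addr0.
have p0 : 0 <= tau `^ al by exact: powR_ge0.
have E1 := mulr_ge0 Kd0 p0; have E2 := mulr_ge0 Kd0 Us0.
clearbody c0 c1 c2.
have E3 : 0 <= 4 * K ^+ d * c2 * tau `^ al by rewrite !mulr_ge0.
have E4 : 0 <= 4 * K ^+ d * (d%:R * c1) * Us by rewrite !mulr_ge0.
have E5 : 0 <= K ^+ d * c0 * Us by rewrite !mulr_ge0.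
rewrite -subr_ge0; set X := (_ - _).
rewrite (_ : X = 4 * K ^+ d * c2 * tau `^ al + 4 * K ^+ d * (d%:R * c1) * Us +
   K ^+ d * c0 * Us + tau `^ al + Us); last by rewrite /X; ring.
by rewrite !addr_ge0.
Qed.

End kernel_norm_upper.
End kernel_upper_bounds.

(** * Size and decorrelation of the one-dimensional kernel from below *)

Section kernel1_lower_bounds.
Variable R : realType.

(** [kernel1_gap] at distance [2 u] with [L = 1 / (2 u)] and the sign [+]. The kernel at distance
    [2 u] is at most the one at [0], so half of the gap bounds the latter: [6144 = 2 * 2 * 1536]. *)
Lemma kernel1_0_lower : exists2 k : R, 0 < k & forall u : R, 0 < u -> u <= 2^-1 ->
  (k * u)^-1 <= kernel1 ((2 * u) ^+ 4) 0.
Proof.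
exists (6144 : R); first by rewrite ltr0n.
move=> u u0 u1; pose L := (2 * u)^-1.
have u20 : 0 < 2 * u by rewrite mulr_gt0.
have L1 : 1 <= L by rewrite -[leLHS]invr1 lef_pV2 ?posrE//; lra.
have L0 : 0 < L by rewrite invr_gt0.
have vL : `|2 * u| * L <= 1 by rewrite gtr0_norm// divff// gt_eqF.
have := kernel1_gap false L1 vL; rewrite expr0 mul1r.
have -> : (L ^+ 4)^-1 = (2 * u) ^+ 4 by rewrite /L exprVn invrK.
have g := kernel1_le0 (2 * u) (exprn_gt0 4 u20); move: g; rewrite ler_norml => /andP[_ g].
have -> : (2 * u) ^+ 2 * L ^+ 3 / 1536 = 2 * (6144 * u)^-1.
  by rewrite /L; field; rewrite gt_eqF.
by move: g; lra.
Qed.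

(** The two signs of [kernel1_gap] bound [kernel1 a 0 - |kernel1 a u|] below by [L / 6144], using
    [u L >= 1 / 2], while [kernel1 a 0 <= 1 + 2 L <= 3 L]; hence [18432 = 3 * 6144]. *)
Lemma kernel1_decorrelation : exists2 k : R, 0 < k < 1 & forall a u : R,
  0 < u -> u <= 2^-1 -> u ^+ 4 <= a -> a <= (2 * u) ^+ 4 -> a <= 1 ->
  `|kernel1 a u| <= (1 - k) * kernel1 a 0.
Proof.
exists (18432^-1 : R); first by rewrite invr_gt0 ltr0n invf_lt1 ?ltr0n// ltr1n.
move=> a u u0 u1 ua au a1; have a0 : 0 < a by apply: lt_le_trans ua; rewrite exprn_gt0.
have sX (v : R) : 0 < v -> scale (v ^+ 4) = v^-1.
  move=> v0; rewrite /scale -powR_mulrn ?(ltW v0)// -powRrM (_ : 4 * - 4^-1 = -1); last by field.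
  by rewrite powR_inv1 ?(ltW v0).
set L := scale a; have L0 : 0 < L by exact: scale_gt0.
have L1 : 1 <= L by rewrite /L; apply: le_trans (scale_le a0 a1); rewrite /scale powR1.
have Lu : L <= u^-1 by rewrite -sX// scale_le// exprn_gt0.
have Lu2 : (2 * u)^-1 <= L by rewrite -sX ?mulr_gt0// scale_le.
have uL : `|u| * L <= 1 by rewrite gtr0_norm// mulrC -ler_pdivlMr// div1r.
have E : (L ^+ 4)^-1 = a by exact: scaleK.
have gp := kernel1_gap false L1 uL; have gm := kernel1_gap true L1 uL.
have g0 := kernel1_0_le L0; rewrite E in gp gm g0.
have uL2 : 2^-1 <= u * L by move: Lu2; rewrite invfM ler_pdivrMr// mulrC.
have h : L / 6144 <= u ^+ 2 * L ^+ 3 / 1536.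
  rewrite (_ : _ * L ^+ 3 / 1536 = L * (u * L) ^+ 2 / 1536); last by ring.
  have : 4^-1 <= (u * L) ^+ 2.
    rewrite (_ : 4^-1 = 2^-1 ^+ 2); last by field.
    by rewrite lerXn2r ?nnegrE// mulr_ge0// ltW.
  by move: L0; nra.
rewrite expr0 mul1r in gp; rewrite expr1 mulN1r in gm.
by rewrite ler_norml; move: h gp gm g0 L1; lra.
Qed.

End kernel1_lower_bounds.

(** * Lower bounds on variances, uniform in the coefficient of the second value *)

Section kernel_lower_bounds.
Variables (R : realType) (d : nat) (T : R).
Hypotheses (d0 : (0 < d)%N) (d4 : (d < 4)%N) (T0 : 0 < T).
Variables k1 k2 : R.
Hypotheses (k10 : 0 < k1) (k20 : 0 < k2) (k21 : k2 < 1).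
Hypothesis kernel1_0_low : forall u : R, 0 < u -> u <= 2^-1 ->
  (k1 * u)^-1 <= kernel1 ((2 * u) ^+ 4) 0.
Hypothesis kernel1_decorr : forall a u : R, 0 < u -> u <= 2^-1 -> u ^+ 4 <= a ->
  a <= (2 * u) ^+ 4 -> a <= 1 -> `|kernel1 a u| <= (1 - k2) * kernel1 a 0.
Implicit Types (t s r c u : R) (x y : d.-tuple R).

Let mX := fun t x => measurable_fun (@spacetime R T d) (@wiener_kernel R d t x).

Let diag_gt0 r : 0 < r -> 0 < diag_kernel d r.
Proof.
move=> r0; rewrite /diag_kernel exprn_gt0// (lt_le_trans _ (kernel1_0_ge r0))//.
by rewrite invr_gt0 mulr_gt0// pi_gt0.
Qed.

Lemma diag_kernel_ge r : 0 < r -> (2 * pi) ^- d <= diag_kernel d r.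
Proof.
move=> r0; rewrite /diag_kernel -exprVn lerXn2r ?nnegrE ?kernel1_0_ge//.
  by rewrite invr_ge0 mulr_ge0// pi_ge0.
by apply: le_trans (kernel1_0_ge r0); rewrite invr_ge0 mulr_ge0// pi_ge0.
Qed.

Lemma diag_kernel_lower u r : 0 < u -> u <= 2^-1 -> 0 < r -> r <= (2 * u) ^+ 4 ->
  (k1 * u) ^- d <= diag_kernel d r.
Proof.
move=> u0 u1 r0 ru; apply: le_trans (diag_kernel_le d r0 ru).
have v0 : 0 < k1 * u by rewrite mulr_gt0.
rewrite -exprVn lerXn2r ?nnegrE ?kernel1_0_low//; first by rewrite invr_ge0 ltW.
by apply: le_trans (kernel1_0_low u0 u1); rewrite invr_ge0 ltW.
Qed.

Lemma kernel_slice_lower_bound t x s y c (a b w : R) : mX t x -> mX s y ->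
  0 <= a -> a <= b -> b <= T -> 0 <= w ->
  (forall r, a <= r -> r < b -> w <= kernel_slice t x s y c r) ->
  (((b - a) * w)%:E <= kernel_norm2 T t x s y c)%E.
Proof.
move=> mt ms a0 ab bT w0 h; rewrite kernel_norm2E//.
have S0 r : (0 <= (kernel_slice t x s y c r)%:E)%E by rewrite lee_fin kernel_slice_ge0.
have mS : measurable_fun (`[0, T]%classic : set (measurableTypeR R))
    (fun r => (kernel_slice t x s y c r)%:E).
  by apply/measurable_EFinP; exact: measurable_kernel_slice.
have sub : ([set` `[a, b[] : set R) `<=` [set` `[0%R, T]].
  move=> r; rewrite /= !in_itv/= => /andP[ar rb].
  by rewrite (le_trans a0 ar) ltW// (lt_le_trans rb).
apply: (@le_trans _ _ (\int[lebesgue_measure]_(r in [set` `[a, b[]) (kernel_slice t x s y c r)%:E)%E); last first.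
  by apply: ge0_subset_integral.
apply: (@le_trans _ _ (\int[lebesgue_measure]_(r in [set` `[a, b[]) (cst w%:E r))%E).
  have L : lebesgue_measure ([set` `[a, b[] : set R) = (b - a)%:E.
    rewrite lebesgue_measure_itv/= lte_fin; case: ltP => [ab'|ba] //.
    by rewrite (_ : b = a) ?subrr//; apply: le_anti; rewrite ab ba.
  have m : measurable ([set` `[a, b[] : set (measurableTypeR R)) by exact: measurable_itv.
  rewrite (etrans (integral_cst _ m w%:E) (congr1 (fun l => w%:E * l)%E L)).
  by rewrite -EFinM lee_fin mulrC.
apply: ge0_le_integral => //.
- by apply: measurable_funS mS.
- by move=> r; rewrite /= in_itv/= => /andP[ar rb]; rewrite lee_fin h.
Qed.

(** The coefficient [c = 0] removes the second kernel, so this concerns the variance of one value;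
    the constant Fourier mode already provides the bound. *)
Lemma kernel_norm2_ge t x : mX t x -> 0 <= t -> t <= T ->
  ((t * (2 * pi) ^- d)%:E <= kernel_norm2 T t x t x 0)%E.
Proof.
move=> mt t0 tT; rewrite -[t in (t * _)]subr0; apply: kernel_slice_lower_bound => //.
  by rewrite invr_ge0 exprn_ge0// mulr_ge0// pi_ge0.
move=> r r0 rt; rewrite /kernel_slice rt /= mulr0 mul0r subr0 expr0n/= mul0r addr0.
by apply: diag_kernel_ge; rewrite mulr_gt0// subr_gt0.
Qed.

(** The noise of [[s, t[] does not act on the value at time [s], so [c] is irrelevant there. An
    interval of length [u ^ 4] with a kernel of order [u ^ (- d)] gives [u ^ (4 - d)]. *)
Lemma kernel_norm2_time t x s y c u : mX t x -> mX s y -> 0 <= s -> t <= T ->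
  0 <= u -> u <= 2^-1 -> t - s = u ^+ 4 ->
  ((k1 ^- d * u ^+ (4 - d))%:E <= kernel_norm2 T t x s y c)%E.
Proof.
move=> mt ms s0 tT; rewrite le_eqVlt => /predU1P[<- _ _|u0 u1 tsu].
  rewrite expr0n subn_eq0 leqNgt d4 /= mulr0; apply: integral_ge0 => p _.
  by rewrite lee_fin sqr_ge0.
have -> : k1 ^- d * u ^+ (4 - d) = (t - s) * (k1 * u) ^- d :> R.
  rewrite tsu exprMn invfM mulrCA; congr (_ * _).
  by rewrite -exprB ?unitfE ?gt_eqF// ltnW.
apply: kernel_slice_lower_bound => //.
- by rewrite -subr_ge0 tsu exprn_ge0// ltW.
- by rewrite invr_ge0 exprn_ge0// mulr_ge0// ltW.
move=> r sr rt; rewrite /kernel_slice rt [r < s]ltNge sr /= !mulr0 subr0 addr0.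
apply: diag_kernel_lower => //; first by rewrite mulr_gt0// subr_gt0.
rewrite exprMn -tsu; have : 0 < t - r by rewrite subr_gt0.
by rewrite (_ : 2 ^+ 4 = 16); [move: sr; lra|ring].
Qed.

(** One coordinate supplies the factor [1 - k2]; the others are bounded by their values at [0]. *)
Lemma kernel_decorrelation (a : R) (v : 'I_d -> R) j : 0 < `|v j| -> `|v j| <= 2^-1 ->
  `|v j| ^+ 4 <= a -> a <= (2 * `|v j|) ^+ 4 -> a <= 1 ->
  `|kernel a v| <= (1 - k2) * diag_kernel d a.
Proof.
move=> v0 v1 va av a1; have a0 : 0 < a by apply: lt_le_trans va; rewrite exprn_gt0.
have h := kernel1_decorr v0 v1 va av a1.
have e : `|kernel1 a (v j)| = `|kernel1 a `|v j| |.
  have [vj|vj] := leP 0 (v j); first by rewrite [`|v j|]ger0_norm.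
  rewrite [`|v j|]ltr0_norm//.
  congr `| _ |; rewrite /kernel1; congr (limn (series _)); apply/funext => k.
  by rewrite /kernel1_term mulrN cosN.
have g0 : 0 <= kernel1 a 0 by apply: le_trans (kernel1_0_ge a0); rewrite invr_ge0 mulr_ge0// pi_ge0.
rewrite /kernel normr_prod (bigD1 j)//= e /diag_kernel -[in leRHS](prednK d0) exprS mulrA.
apply: ler_pM => //; first by apply: prodr_ge0.
rewrite (_ : d.-1 = #|[pred i | i != j]|); last first.
  by rewrite -[in LHS](card_ord d) (cardD1 j) inE add1n /=; apply: eq_card => i; rewrite !inE andbT.
rewrite -prodr_const; apply: ler_prod => i _.
by rewrite normr_ge0 kernel1_le0.
Qed.

(** This is the nonnegativity of [kernel_slice] at its minimum over [c]. *)
Lemma diag_kernel_cauchy_schwarz t s r : r < s -> r < t ->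
  diag_kernel d (t + s - 2 * r) ^+ 2 <= diag_kernel d (2 * (t - r)) * diag_kernel d (2 * (s - r)).
Proof.
move=> rs rt; pose x : d.-tuple R := [tuple 0 | i < d].
set A := diag_kernel d (2 * (t - r)); set B := diag_kernel d (2 * (s - r)).
set M := diag_kernel d (t + s - 2 * r).
have B0 : 0 < B by apply: diag_gt0; rewrite mulr_gt0// subr_gt0.
have := kernel_slice_ge0 t x s x (M / B) r.
rewrite /kernel_slice rs rt /= -/A -/B.
have -> : kernel (t + s - 2 * r) (fun j => tnth x j - tnth x j) = M.
  by rewrite /M -kernel_cst0; congr kernel; apply/funext => j; rewrite subrr.
have -> : A - 2 * (M / B) * M + (M / B) ^+ 2 * B = (A * B - M ^+ 2) / B.
  by field; rewrite gt_eqF.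
by rewrite pmulr_lge0 ?invr_gt0// subr_ge0.
Qed.

(** Only the slices at [r] with [u ^ 4 <= s - r <= 2 u ^ 4] are used: there the two kernels
    have size [1 / u] and are decorrelated at distance [u]. *)
Lemma kernel_norm2_space t x s y c j : mX t x -> mX s y ->
  s <= t -> t <= T -> t - s <= `|tnth x j - tnth y j| ^+ 4 ->
  2 * `|tnth x j - tnth y j| ^+ 4 <= s -> `|tnth x j - tnth y j| <= 2^-1 ->
  ((k1 ^- d * k2 * `|tnth x j - tnth y j| ^+ (4 - d))%:E <= kernel_norm2 T t x s y c)%E.
Proof.
move=> mt ms st tT; set u := `|_|.
have : 0 <= u by exact: normr_ge0.
rewrite le_eqVlt => /predU1P[<- _ _ _|u0 tau us u1].
  rewrite expr0n subn_eq0 leqNgt d4 /= mulr0; apply: integral_ge0 => p _.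
  by rewrite lee_fin sqr_ge0.
have u40 : 0 < u ^+ 4 by rewrite exprn_gt0.
have u416 : u ^+ 4 <= 16^-1.
  rewrite (_ : 16^-1 = 2^-1 ^+ 4); last by field.
  by rewrite lerXn2r ?nnegrE// ltW.
have E2 : (2 * u) ^+ 4 = 16 * u ^+ 4 by rewrite exprMn; congr (_ * _); ring.
have -> : k1 ^- d * k2 * u ^+ (4 - d) =
    (s - u ^+ 4 - (s - 2 * u ^+ 4)) * (k2 * (k1 * u) ^- d) :> R.
  rewrite (_ : s - u ^+ 4 - _ = u ^+ 4); last by ring.
  rewrite exprMn invfM exprB ?unitfE ?gt_eqF//; last exact: ltnW.
  by ring.
have W0 : 0 <= k2 * (k1 * u) ^- d :> R.
  apply: mulr_ge0; first exact: ltW.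
  by rewrite invr_ge0; apply: exprn_ge0; apply: mulr_ge0; exact: ltW.
apply: kernel_slice_lower_bound => //; [lra|lra|lra|].
move=> r r1 r2; have rs : r < s by lra.
have rt : r < t by lra.
rewrite /kernel_slice rs rt /=.
have CS := diag_kernel_cauchy_schwarz rs rt.
set A := diag_kernel d (2 * (t - r)) in CS *; set B := diag_kernel d (2 * (s - r)) in CS *.
set a := t + s - 2 * r in CS *.
(* As [a = (t - s) + 2 (s - r)], it lies between [2 u ^ 4] and [5 u ^ 4], inside the range of
   [kernel1_decorr], and [u <= 1 / 2] keeps it below [1]. *)
have dec : `|kernel a (fun j => tnth x j - tnth y j)| <= (1 - k2) * diag_kernel d a.
  by apply: (@kernel_decorrelation _ _ j) => //; rewrite -/u ?E2 /a; lra.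
set M := kernel a _ in dec *; set D := diag_kernel d a in CS dec *.
have B0 : 0 < B by apply: diag_gt0; rewrite mulr_gt0// subr_gt0.
have A1 : (k1 * u) ^- d <= A.
  by apply: diag_kernel_lower => //; rewrite ?E2; lra.
have D0 : 0 < D by apply: diag_gt0; rewrite /a; lra.
have M2 : M ^+ 2 <= (1 - k2) * (A * B).
  apply: (@le_trans _ _ ((1 - k2) * D ^+ 2)); last by apply: ler_wpM2l => //; rewrite subr_ge0 ltW.
  rewrite -[M ^+ 2]real_normK ?num_real//.
  apply: (@le_trans _ _ (((1 - k2) * D) ^+ 2)).
    rewrite lerXn2r ?nnegrE//; apply: mulr_ge0; last exact: ltW.
    by rewrite subr_ge0 ltW.
  rewrite exprMn; apply: ler_wpM2r; first exact: sqr_ge0.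
  by move: k20 k21; nra.
apply: (@le_trans _ _ (k2 * A)); first by apply: ler_wpM2l => //; exact: ltW.
rewrite -(ler_pM2r B0).
(* The square vanishes at the minimizing [c]; what remains is the determinant of the two slices. *)
have -> : (A - 2 * c * M + c ^+ 2 * B) * B = A * B - M ^+ 2 + (M - c * B) ^+ 2 by ring.
have := sqr_ge0 (M - c * B); lra.
Qed.

End kernel_lower_bounds.

Section kernel_norm_lower.
Variables (R : realType) (d : nat) (T : R).
Hypotheses (d0 : (0 < d)%N) (d4 : (d < 4)%N) (T0 : 0 < T).

(** Uniformity in [c] makes this a bound on conditional variances. *)
Lemma kernel_norm2_lower : exists2 k : R, 0 < k & forall (t s c : R) (x y : d.-tuple R),
  measurable_fun (@spacetime R T d) (@wiener_kernel R d t x) ->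
  measurable_fun (@spacetime R T d) (@wiener_kernel R d s y) ->
  0 <= s -> s <= t -> t <= T ->
  (forall u, 0 <= u -> u <= 2^-1 -> t - s = u ^+ 4 ->
    ((k * u ^+ (4 - d))%:E <= kernel_norm2 T t x s y c)%E) /\
  (forall j, let u := `|tnth x j - tnth y j| in
    t - s <= u ^+ 4 -> 2 * u ^+ 4 <= s -> u <= 2^-1 ->
    ((k * u ^+ (4 - d))%:E <= kernel_norm2 T t x s y c)%E).
Proof.
have [k1 k10 h1] := kernel1_0_lower R.
have [k2 /andP[k20 k21] h2] := kernel1_decorrelation R.
exists (k1 ^- d * k2); first by rewrite mulr_gt0// invr_gt0 exprn_gt0.
move=> t s c x y mt ms s0 st tT; split=> [u u0 u1 tsu|j u tu us u1]; last first.
  exact: (kernel_norm2_space d0 d4 k10 k20 k21 h1 h2 c mt ms st tT tu us u1).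
apply: le_trans (kernel_norm2_time d4 k10 h1 c mt ms s0 tT u0 u1 tsu).
rewrite lee_fin ler_wpM2r ?exprn_ge0// ler_piMr ?(ltW k21)//.
by rewrite invr_ge0 exprn_ge0// ltW.
Qed.

End kernel_norm_lower.

(** * The initial condition *)

Section initial_condition.
Variables (R : realType) (d : nat) (T : R) (v0 : d.-tuple R -> R).
Hypothesis T0 : 0 < T.
Local Notation mR := (measurableTypeR R).
Local Notation mu := (lebesgue_tuple R d).
Implicit Types (x y z : d.-tuple R) (t s : R).

Lemma kernel1_lower_near0 : exists2 de : R, 0 < de &
  forall u : R, `|u| <= de -> (4 * pi)^-1 <= kernel1 T u.
Proof.
set L := scale T; have L0 : 0 < L by exact: scale_gt0.
have pi0 := @pi_gt0 R.
have c0 : 0 < (4 * pi)^-1 / L ^+ 3 :> R by rewrite divr_gt0 ?exprn_gt0// invr_gt0 mulr_gt0.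
exists (Num.sqrt ((4 * pi)^-1 / L ^+ 3)); first by rewrite sqrtr_gt0.
move=> u ud; have u2 : u ^+ 2 * L ^+ 3 <= (4 * pi)^-1.
  rewrite -ler_pdivlMr ?exprn_gt0// -real_normK ?num_real//.
  rewrite -[leRHS]sqr_sqrtr ?(ltW c0)// lerXn2r ?nnegrE ?sqrtr_ge0//.
have := kernel1_space_le u L0; rewrite scaleK// => h.
have := kernel1_0_ge T0; have : (2 * pi)^-1 = 2 * (4 * pi)^-1 :> R.
  by rewrite !invfM mulrA; congr (_ * _); field.
by move=> ->; move: h u2; lra.
Qed.

(** Each coordinate of [z] is rounded down to a multiple of [2 pi / N]. Rounding down stays inside
    [[0, 2 pi)], so periodicity is not involved. *)
Lemma green_lower_net : exists N : nat, exists xs : 'I_N -> R,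
  (forall i, 0 <= xs i < 2 * pi) /\
  forall z, torus z -> exists f : {ffun 'I_d -> 'I_N},
    (4 * pi) ^- d <= green T [tuple xs (f j) | j < d] z.
Proof.
have [de de0 hde] := kernel1_lower_near0.
have pi20 : 0 < 2 * pi :> R by rewrite mulr_gt0// pi_gt0.
pose N := (Num.truncn (2 * pi / de)).+1.
have N0 : 0 < N%:R :> R by rewrite ltr0n.
have Nde : 2 * pi / N%:R <= de.
  rewrite ler_pdivrMr// [de * _]mulrC -ler_pdivrMr//; apply: ltW; exact: truncnS_gt.
exists N, (fun i => 2 * pi / N%:R * i%:R); split=> [i|z zt].
  rewrite mulr_ge0//=; last by rewrite divr_ge0 ?ltW.
  by rewrite -mulrA gtr_pMr// mulrC ltr_pdivrMr// mul1r ltr_nat.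
have zN j : (Num.truncn (tnth z j * N%:R / (2 * pi)) < N)%N.
  have /andP[z0 z1] := zt j.
  rewrite -(ltr_nat R); apply: le_lt_trans (_ : tnth z j * N%:R / (2 * pi) < N%:R).
    have w0 : 0 <= tnth z j * N%:R / (2 * pi) by rewrite divr_ge0 ?(ltW pi20)// mulr_ge0.
    by have /andP[] := truncn_itv w0.
  by rewrite ltr_pdivrMr// mulrC ltr_pM2l.
exists [ffun j => Ordinal (zN j)]; rewrite greenE// /kernel.
rewrite -exprVn -[in leLHS](card_ord d) -prodr_const; apply: ler_prod => j _.
rewrite invr_ge0 mulr_ge0 ?pi_ge0//=; apply: hde.
rewrite tnth_mktuple ffunE /=; have /andP[z0 z1] := zt j.
apply: le_trans Nde; set w := tnth z j * N%:R / (2 * pi).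
have w0 : 0 <= w by rewrite divr_ge0 ?(ltW pi20)// mulr_ge0.
have /andP[tw wt] := truncn_itv w0.
have -> : tnth z j = 2 * pi / N%:R * w.
  have e (p n v : R) : p != 0 -> n != 0 -> v = p / n * (v * n / p).
    by move=> p0 n0; field; rewrite p0 n0.
  by apply: e; rewrite gt_eqF.
rewrite -mulrBr normrM ger0_norm ?divr_ge0 ?(ltW pi20)// ler_piMr ?divr_ge0 ?(ltW pi20)//.
by rewrite ler_norml; move: tw wt; rewrite -natr1; lra.
Qed.

Lemma measurable_green t x : 0 < t ->
  measurable_fun setT (fun z : d.-tuple mR => green t x z).
Proof. by move=> t0; under eq_fun do rewrite greenE//; exact: measurable_kernel. Qed.

Lemma green_le t x z : 0 < t -> `|green t x z| <= diag_kernel d t.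
Proof. by move=> t0; rewrite greenE// kernel_le0. Qed.

Hypothesis hv0 : forall x, torus x -> mu.-integrable (@torus R d)
  (fun z => (green T x z * v0 z)%:E).

(** Finitely many kernels [green T x] are jointly bounded below on the torus, so
    the integrability of the products carries over to [v0]. *)
Lemma integrable_initial : mu.-integrable (@torus R d) (EFin \o v0).
Proof.
have [N [xs [xst net]]] := green_lower_net.
pose X (f : {ffun 'I_d -> 'I_N}) := [tuple xs (f j) | j < d].
have XT f : torus (X f) by move=> j; rewrite tnth_mktuple.
pose S z := \sum_(f : {ffun 'I_d -> 'I_N}) green T (X f) z ^+ 2.
have c0 : 0 < (4 * pi) ^- d :> R by rewrite invr_gt0 exprn_gt0// mulr_gt0// pi_gt0.
have S_ge z : torus z -> ((4 * pi) ^- d) ^+ 2 <= S z.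
  move=> /net[f hf]; rewrite /S (bigD1 f)//=; apply: ler_wpDr.
    by apply: sumr_ge0 => g _; exact: sqr_ge0.
  by rewrite lerXn2r ?nnegrE ?(le_trans (ltW c0) hf)// ltW.
have S0 z : torus z -> 0 < S z by move=> /S_ge; apply: lt_le_trans; rewrite exprn_gt0.
have mS : measurable_fun setT (S : d.-tuple mR -> R).
  by apply: measurable_sum => f; apply: measurable_funX; exact: measurable_green.
(* The products [w f * green T (X f)] sum to one, and the [w f] are bounded because [S] is bounded
   below: [v0] becomes a bounded combination of integrable products. *)
pose w f z := green T (X f) z / S z.
have iw f : mu.-integrable (@torus R d) (EFin \o (fun z => w f z * (green T (X f) z * v0 z))).
  have mtor := @measurable_torus R d.
  have := @integrableMr _ _ R mu (@torus R d) mtor (w f) (fun z => (green T (X f) z * v0 z)%:E).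
  move=> h; apply: eq_integrable (h _ _ _) => //.
  - apply: measurable_funTS; apply: measurable_funM; first exact: measurable_green.
    have -> : (fun z => (S z)^-1) = (fun z => S z `^ (-1)).
      by apply/funext => z; rewrite powR_inv1//; apply: sumr_ge0 => g _; exact: sqr_ge0.
    exact: (measurableT_comp (measurable_powR _)).
  - exists (diag_kernel d T / ((4 * pi) ^- d) ^+ 2); split; first exact: num_real.
    move=> K MK z zt; apply: le_trans (ltW MK); rewrite normrM normfV (gtr0_norm (S0 _ zt)).
    by apply: ler_pM; rewrite ?invr_ge0 ?(ltW (S0 _ zt))// ?green_le// lef_pV2 ?posrE ?S0 ?exprn_gt0// S_ge.
  - exact: hv0.
have := integrable_sum_real (@measurable_torus R d) (index_enum {ffun 'I_d -> 'I_N}) iw.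
move=> h; apply: eq_integrable h => //; first exact: measurable_torus.
move=> z; rewrite inE => zt /=; congr (_%:E).
transitivity ((\sum_f green T (X f) z ^+ 2) / S z * v0 z).
  by rewrite !mulr_suml; apply: eq_bigr => f _; rewrite /w; ring.
by rewrite -/(S z) divff ?mul1r// gt_eqF// S0.
Qed.

Definition mean t x : R := \int[mu]_(z in @torus R d) (green t x z * v0 z).

(** From time [t0] on, the kernels are bounded and Lipschitz with constants depending only on
    [scale t0] and [d]; integration against [v0] preserves both properties. *)
Lemma mean_bounds (t0 : R) : 0 < t0 -> exists2 C : R, 0 < C &
  (forall t x, t0 <= t -> `|mean t x| <= C) /\
  (forall t s x y, t0 <= t -> t0 <= s ->
    `|mean t x - mean s y| <= C * (`|t - s| + \sum_j `|tnth x j - tnth y j|)).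
Proof.
move=> t00; have iv := integrable_initial.
have mtor := @measurable_torus R d.
set V := \int[mu]_(z in @torus R d) `|v0 z|.
have V0 : 0 <= V by apply: Rintegral_ge0.
set L := scale t0; have L0 : 0 < L by exact: scale_gt0.
have E : (L ^+ 4)^-1 = t0 by exact: scaleK.
have tpos t : t0 <= t -> 0 < t by exact: lt_le_trans.
have ig t x : t0 <= t -> mu.-integrable (@torus R d) (EFin \o (fun z => green t x z * v0 z)).
  move=> tt; have := @integrableMr _ _ R mu (@torus R d) mtor (green t x) (EFin \o v0).
  move=> h; apply: eq_integrable (h _ _ iv) => //.
  - by apply: measurable_funTS; apply: measurable_green; exact: tpos.
  - exists (diag_kernel d t); split; first exact: num_real.
    by move=> K MK z _; apply: le_trans (ltW MK); apply: green_le; exact: tpos.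
have bound (f : d.-tuple R -> R) (B : R) : mu.-integrable (@torus R d) (EFin \o (fun z => f z * v0 z)) ->
    (forall z, `|f z| <= B) -> `|\int[mu]_(z in @torus R d) (f z * v0 z)| <= B * V.
  move=> fi fB; apply: le_trans (le_normr_Rintegral mtor fi) _.
  have iV : mu.-integrable (@torus R d) (EFin \o (fun z => `|v0 z|)).
    exact: (integrable_norm iv).
  rewrite /V -RintegralZl//; apply: le_Rintegral => //.
  - exact: (integrable_norm fi).
  - exact: (integrableZl mtor B iV).
  - by move=> z _; rewrite normrM ler_wpM2r.
set G := kernel1 t0 0.
have G0 : 0 <= G by apply: le_trans (kernel1_0_ge t00); rewrite invr_ge0 mulr_ge0// pi_ge0.
have gG t u : t0 <= t -> `|kernel1 t u| <= G.
  move=> tt; apply: le_trans (kernel1_le0 _ (tpos _ tt)) _.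
  have h := kernel1_time_le L0 (_ : 0 <= t - t0).
  rewrite E subrKC in h; have /andP[+ _] := h ltac:(by rewrite subr_ge0).
  by rewrite subr_ge0.
pose C1 := G ^+ d * V.
pose C2 := G ^+ d.-1 * (d%:R * (2 * L ^+ 5) + 2 * L ^+ 3) * V.
have L50 : 0 <= L ^+ 5 by rewrite exprn_ge0// ltW.
have L30 : 0 <= L ^+ 3 by rewrite exprn_ge0// ltW.
have C10 : 0 <= C1 by rewrite mulr_ge0// exprn_ge0.
have C20 : 0 <= C2 by apply: mulr_ge0 => //; apply: mulr_ge0; [exact: exprn_ge0|apply: addr_ge0; apply: mulr_ge0 => //; exact: mulr_ge0].
exists (C1 + C2 + 1); first by rewrite ltr_wpDl// addr_ge0.
split=> [t x tt|t s x y tt ss].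
  apply: (@le_trans _ _ C1); last by rewrite -addrA lerDl addr_ge0.
  apply: bound; first exact: ig.
  move=> z; rewrite greenE ?tpos// /kernel normr_prod.
  by rewrite -[in leRHS](card_ord d) -prodr_const; apply: ler_prod => j _; rewrite normr_ge0 gG.
set Q := `|t - s| + _; have Q0 : 0 <= Q by rewrite addr_ge0// sumr_ge0.
apply: (@le_trans _ _ (C2 * Q)); last by rewrite ler_wpM2r//; move: C10; lra.
rewrite /mean -RintegralB//; [|exact: ig|exact: ig].
under eq_Rintegral do rewrite -mulrBl.
rewrite /C2 mulrAC; apply: (bound (fun z => green t x z - green s y z)).
  apply: eq_integrable (integrableB mtor (ig t x tt) (ig s y ss)) => // z _.
  by rewrite /= mulrBl EFinB.
move=> z; rewrite !greenE ?tpos//.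
apply: le_trans (prod_lipschitz (fun j => gG t _ tt) (fun j => gG s _ ss)) _.
rewrite -mulrA; apply: ler_wpM2l; first exact: exprn_ge0.
apply: (@le_trans _ _ (\sum_(j < d) (2 * L ^+ 5 * `|t - s| + 2 * L ^+ 3 * `|tnth x j - tnth y j|))).
  apply: ler_sum => j _.
  have := kernel1_lipschitz (tnth x j - tnth z j) (tnth y j - tnth z j) L0 (_ : _ <= t) (_ : _ <= s).
  rewrite E => /(_ tt ss); rewrite (_ : _ - tnth z j - _ = tnth x j - tnth y j)//; ring.
rewrite big_split/= sumr_const card_ord -mulr_sumr /Q; set D := \sum_j _; set A := `|t - s|.
have D0 : 0 <= D by apply: sumr_ge0.
have A0 : 0 <= A by exact: normr_ge0.
rewrite -mulr_natl; have d0 : 0 <= d%:R :> R by [].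
have := mulr_ge0 (mulr_ge0 d0 L50) D0; have := mulr_ge0 L30 A0; lra.
Qed.

End initial_condition.

(** * Wiener integrals *)

Import HBSimple.

(** * Bilinear calculus of square integrable functions *)

Section square_integrable.
Context dsp (X : measurableType dsp) (R : realType).
Variables (mu : {measure set X -> \bar R}) (D : set X).
Hypothesis mD : measurable D.
Implicit Types (f g : X -> R) (a b : R).

Definition square_integrable f :=
  measurable_fun D f /\ mu.-integrable D (EFin \o (fun x => f x ^+ 2)).

Lemma square_integrableP f : measurable_fun D f ->
  (\int[mu]_(x in D) (f x ^+ 2)%:E < +oo)%E -> square_integrable f.
Proof.
move=> mf foo; split=> //; apply/integrableP; split.
  by apply/measurable_EFinP; exact: measurable_funX.
by under eq_integral do rewrite /= ger0_norm ?sqr_ge0//.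
Qed.

Lemma square_integrable_prod f g : square_integrable f -> square_integrable g ->
  mu.-integrable D (EFin \o (fun x => f x * g x)).
Proof.
move=> [mf fi] [mg gi].
apply: le_integrable (integrableD mD fi gi) => //.
  by apply/measurable_EFinP; exact: measurable_funM.
move=> x _ /=; rewrite lee_fin [leRHS]ger0_norm ?addr_ge0 ?sqr_ge0//.
by rewrite ler_norml; apply/andP; split; have := sqr_ge0 (f x + g x); have := sqr_ge0 (f x - g x); have := sqr_ge0 (f x); have := sqr_ge0 (g x); nra.
Qed.

Lemma square_integrable_lin a b f g : square_integrable f -> square_integrable g ->
  square_integrable (fun x => a * f x + b * g x).
Proof.
move=> sf sg; have [mf fi] := sf; have [mg gi] := sg; split.
  by apply: measurable_funD; exact: measurable_funM.
have fg := square_integrable_prod sf sg.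
have h := integrableD mD (integrableZl mD (a ^+ 2) fi)
  (integrableD mD (integrableZl mD (2 * a * b) fg) (integrableZl mD (b ^+ 2) gi)).
apply: eq_integrable h => // x _ /=; congr (_%:E); ring.
Qed.

Lemma Rintegral_sqr_lin a b f g : square_integrable f -> square_integrable g ->
  \int[mu]_(x in D) (a * f x + b * g x) ^+ 2 =
  a ^+ 2 * (\int[mu]_(x in D) f x ^+ 2) + 2 * a * b * (\int[mu]_(x in D) (f x * g x))
  + b ^+ 2 * (\int[mu]_(x in D) g x ^+ 2).
Proof.
move=> sf sg; have [mf fi] := sf; have [mg gi] := sg.
have fg := square_integrable_prod sf sg.
have h1 := integrableZl mD (a ^+ 2) fi; have h2 := integrableZl mD (2 * a * b) fg.
have h3 := integrableZl mD (b ^+ 2) gi.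
have h12 : mu.-integrable D (EFin \o (fun x => a ^+ 2 * f x ^+ 2 + 2 * a * b * (f x * g x))).
  exact: (integrableD mD h1 h2).
rewrite -!RintegralZl// -(RintegralD mD h1 h2) -(RintegralD mD h12 h3).
by apply: eq_Rintegral => x _; ring.
Qed.

Lemma Rintegral_sqr_ge0 f : 0 <= \int[mu]_(x in D) f x ^+ 2.
Proof. by apply: Rintegral_ge0 => x _; exact: sqr_ge0. Qed.

Lemma square_integrable_fin f : square_integrable f ->
  (\int[mu]_(x in D) (f x ^+ 2)%:E)%E = (\int[mu]_(x in D) f x ^+ 2)%:E.
Proof. by move=> [_ fi]; rewrite /Rintegral fineK//; exact: integrable_fin_num fi. Qed.

Lemma L2_dist_lin a b f g f' g' : square_integrable f -> square_integrable g ->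
  square_integrable f' -> square_integrable g' ->
  \int[mu]_(x in D) (a * f x + b * g x - (a * f' x + b * g' x)) ^+ 2 <=
  2 * a ^+ 2 * (\int[mu]_(x in D) (f x - f' x) ^+ 2) +
  2 * b ^+ 2 * (\int[mu]_(x in D) (g x - g' x) ^+ 2).
Proof.
move=> sf sg sf' sg'.
have sub k k' : square_integrable k -> square_integrable k' -> square_integrable (fun x => k x - k' x).
  move=> sk sk'; have := square_integrable_lin 1 (-1) sk sk'.
  by rewrite (_ : (fun x => 1 * k x + -1 * k' x) = (fun x => k x - k' x))//; apply/funext => x; ring.
have s1 := sub _ _ sf sf'; have s2 := sub _ _ sg sg'.
have s3 := sub _ _ (square_integrable_lin a b sf sg) (square_integrable_lin a b sf' sg').
have h1 := integrableZl mD (2 * a ^+ 2) (proj2 s1); have h2 := integrableZl mD (2 * b ^+ 2) (proj2 s2).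
rewrite -!RintegralZl//; [|exact: (proj2 s2)|exact: (proj2 s1)].
rewrite -(RintegralD mD h1 h2); apply: le_Rintegral => //.
- exact: (proj2 s3).
- exact: (integrableD mD h1 h2).
- move=> x _; have := sqr_ge0 (a * (f x - f' x) - b * (g x - g' x)); lra.
Qed.

(** Nonnegativity of the integrals of [(e f + (f - h n)) ^ 2] and [(e f - (f - h n)) ^ 2] bounds the
    cross term with a free parameter [e], which is then chosen so that [e q] uses half of the
    tolerance. *)
Lemma L2_norm_cvg f (h : nat -> X -> R) : square_integrable f ->
  (forall n, square_integrable (h n)) ->
  \int[mu]_(x in D) (f x - h n x) ^+ 2 @[n --> \oo] --> 0 ->
  \int[mu]_(x in D) (h n x) ^+ 2 @[n --> \oo] --> \int[mu]_(x in D) (f x) ^+ 2.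
Proof.
move=> sf sh fh; set q := \int[mu]_(x in D) (f x) ^+ 2.
have q0 : 0 <= q by exact: Rintegral_sqr_ge0.
pose dn n := \int[mu]_(x in D) (f x - h n x) ^+ 2.
have dn0 n : 0 <= dn n by exact: Rintegral_sqr_ge0.
have E n e : 0 < e -> `|\int[mu]_(x in D) (h n x) ^+ 2 - q| <= e * q + (1 + e^-1) * dn n.
  move=> e0.
  have sn : square_integrable (fun x => f x - h n x).
    have := square_integrable_lin 1 (-1) sf (sh n).
    by rewrite (_ : (fun x => 1 * f x + -1 * h n x) = (fun x => f x - h n x))//; apply/funext => x; ring.
  have -> : \int[mu]_(x in D) (h n x) ^+ 2 - q =
      -2 * (\int[mu]_(x in D) (f x * (f x - h n x))) + dn n.
    have := Rintegral_sqr_lin 1 (-1) sf sn; rewrite -/q -/(dn n).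
    have -> : \int[mu]_(x in D) (1 * f x + -1 * (f x - h n x)) ^+ 2 = \int[mu]_(x in D) (h n x) ^+ 2.
      by apply: eq_Rintegral => x _; ring.
    by move=> ->; ring.
  have h1 := Rintegral_sqr_lin e 1 sf sn; have h2 := Rintegral_sqr_lin e (-1) sf sn.
  have p1 := Rintegral_sqr_ge0 (fun x => e * f x + 1 * (f x - h n x)).
  have p2 := Rintegral_sqr_ge0 (fun x => e * f x + -1 * (f x - h n x)).
  rewrite h1 -/q -/(dn n) in p1; rewrite h2 -/q -/(dn n) in p2.
  set I := \int[mu]_(x in D) _ in p1 p2 *.
  have b1 : 2 * I <= e * q + e^-1 * dn n.
    by rewrite -(ler_pM2l e0) mulrDr mulrA [e * (e^-1 * _)]mulrA divff ?gt_eqF//; move: p2; lra.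
  have b2 : - (2 * I) <= e * q + e^-1 * dn n.
    by rewrite -(ler_pM2l e0) mulrDr mulrN mulrA [e * (e^-1 * _)]mulrA divff ?gt_eqF//; move: p1; lra.
  by rewrite ler_norml; have := dn0 n; move: b1 b2; lra.
apply/cvgrPdist_le => e e0.
pose e1 := e / (2 * (q + 1)).
have q1 : 0 < q + 1 by rewrite ltr_wpDl.
have e10 : 0 < e1 by rewrite divr_gt0// mulr_gt0.
have c0 : 0 < 1 + e1^-1 by rewrite addr_gt0// invr_gt0.
have e2 : 0 < e / (2 * (1 + e1^-1)) by rewrite divr_gt0// mulr_gt0.
move/cvgrPdist_le : fh => /(_ _ e2); apply: filterS => n.
rewrite sub0r normrN ger0_norm ?dn0// => hn; rewrite distrC.
apply: le_trans (E n e1 e10) _.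
have -> : e = e / 2 + e / 2 by field.
apply: lerD.
  rewrite /e1 invfM mulrA -[leRHS]mulr1 -!mulrA ler_wpM2l ?(ltW e0)// ler_wpM2l//.
  by rewrite mulrC ler_pdivrMr// mul1r lerDl.
by rewrite mulrC -ler_pdivlMr// -mulrA -invfM.
Qed.

End square_integrable.

(** * Simple integrals, the isometry and pairs of Wiener integrals *)

Section simple_noise.
Context {dsp} {Om : measurableType dsp} {R : realType}.
Variables (P : probability Om R) (T : R) (d : nat).
Local Notation mR := (measurableTypeR R).
Local Notation st := (mR * d.-tuple mR)%type.
Variable W : set st -> Om -> R.
Hypotheses (T0 : 0 < T) (hW : white_noise P T W).
Implicit Types (l : seq (R * set st)) (h : {sfun st >-> R}).

Local Notation mu := (@st_measure R d).
Local Notation D := (@spacetime R T d).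

Lemma measurable_spacetime : measurable (D : set st).
Proof. by apply: measurableX; [exact: measurable_itv|exact: measurable_torus]. Qed.

Lemma st_measure_spacetime_lty : (mu D < +oo)%E.
Proof.
have h := @product_measure1E _ _ _ _ R (@lebesgue_measure R) (lebesgue_tuple R d) [set` `[0, T]] (@torus R d)
  (measurable_itv _) (@measurable_torus R d).
have fin : (lebesgue_measure ([set` `[0%R, T]] : set R) * lebesgue_tuple R d (@torus R d) < +oo)%E.
  by rewrite lebesgue_torus lebesgue_measure_itv/= lte_fin T0 oppr0 adde0 -EFinM ltry.
by have := fin; rewrite -h.
Qed.

(** Lists of coefficients and sets may contain overlapping sets, so that a combination of two simple
    integrals is again of this form, by concatenation and without a common refinement. *)
Definition noise l (w : Om) : R := \sum_(p <- l) p.1 * W p.2 w.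
Definition noise_fun l (z : st) : R := \sum_(p <- l) p.1 * \1_(p.2) z.

Definition noise_sets l := forall p, p \in l -> measurable p.2 /\ p.2 `<=` D.

Let cov A B : measurable A -> A `<=` D -> measurable B -> B `<=` D ->
  (\int[P]_w (W A w * W B w)%:E = mu (A `&` B))%E.
Proof. by move=> mA AD mB BD; rewrite -(white_noise_cov hW)// unlock. Qed.

Let measurable_W A : measurable A -> A `<=` D -> measurable_fun setT (W A).
Proof.
move=> mA AD; have [+ _] := @white_noise_gaussian _ _ _ _ _ _ _ hW 1 (fun=> A) (fun=> 1) (fun=> conj mA AD).
by under eq_fun do rewrite big_ord1 mul1r.
Qed.

Let muD_lty A : measurable A -> A `<=` D -> (mu A < +oo)%E.
Proof.
move=> mA AD; apply: le_lt_trans st_measure_spacetime_lty.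
by apply: le_measure => //; rewrite inE//; exact: measurable_spacetime.
Qed.

Let square_integrable_W A : measurable A -> A `<=` D -> square_integrable P setT (W A).
Proof.
move=> mA AD; apply: square_integrableP => //; first exact: measurable_W.
by under eq_integral do rewrite expr2; rewrite cov// setIid muD_lty.
Qed.

Lemma gaussian_noise l : noise_sets l -> gaussian_rv P (noise l).
Proof.
move=> lD; pose A (i : 'I_(size l)) := (tnth (in_tuple l) i).2.
have hA i : measurable (A i) /\ A i `<=` D by apply: lD; exact: mem_tnth.
have := @white_noise_gaussian _ _ _ _ _ _ _ hW _ A (fun i => (tnth (in_tuple l) i).1) hA.
by under eq_fun do rewrite -(big_tnth _ _ l xpredT (fun p => p.1 * W p.2 _)).
Qed.

Lemma square_integrable_noise l : noise_sets l -> square_integrable P setT (noise l).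
Proof.
rewrite /noise; elim: l => [|p l IH] lD.
  under eq_fun do rewrite big_nil.
  apply: square_integrableP; first exact: measurable_cst.
  by under eq_integral do rewrite expr0n/=; rewrite integral0 ltry.
have [mA AD] := lD p (mem_head _ _).
have lD' : noise_sets l by move=> q ql; apply: lD; rewrite inE ql orbT.
have := square_integrable_lin measurableT p.1 1 (square_integrable_W mA AD) (IH lD').
by congr square_integrable; apply/funext => w; rewrite big_cons mul1r.
Qed.

Let square_integrable_indic A : measurable A -> A `<=` D ->
  square_integrable mu D (\1_A : st -> R).
Proof.
move=> mA AD; apply: square_integrableP => //.
have -> : (\int[mu]_(x in D) (\1_A x ^+ 2)%:E = \int[mu]_(x in D) (\1_A x)%:E)%E.
  by apply: eq_integral => x _; rewrite indicE; case: (x \in A); rewrite ?expr1n ?expr0n.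
rewrite integral_indic//; last exact: measurable_spacetime.
by rewrite setIidl// muD_lty.
Qed.

Lemma square_integrable_noise_fun l : noise_sets l -> square_integrable mu D (noise_fun l).
Proof.
rewrite /noise_fun; elim: l => [|p l IH] lD.
  under eq_fun do rewrite big_nil.
  apply: square_integrableP; first exact: measurable_cst.
  by under eq_integral do rewrite expr0n/=; rewrite integral0 ltry.
have [mA AD] := lD p (mem_head _ _).
have lD' : noise_sets l by move=> q ql; apply: lD; rewrite inE ql orbT.
have := square_integrable_lin measurable_spacetime p.1 1 (square_integrable_indic mA AD) (IH lD').
by congr square_integrable; apply/funext => w; rewrite big_cons mul1r.
Qed.

(** Linearity in one argument. Applied to each argument in turn, it reduces the isometry to two
    indicators, where it is the covariance of the noise. *)
Let noise_isometry_l l Y y : noise_sets l -> square_integrable P setT Y ->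
  square_integrable mu D y ->
  (forall A, measurable A -> A `<=` D ->
     \int[P]_w (W A w * Y w) = \int[mu]_(z in D) (\1_A z * y z)) ->
  \int[P]_w (noise l w * Y w) = \int[mu]_(z in D) (noise_fun l z * y z).
Proof.
move=> + sY sy h; elim: l => [|p l IH] lD.
  under eq_Rintegral do rewrite /noise big_nil mul0r.
  under [RHS]eq_Rintegral do rewrite /noise_fun big_nil mul0r.
  by rewrite /Rintegral !integral0.
have [mA AD] := lD p (mem_head _ _).
have lD' : noise_sets l by move=> q ql; apply: lD; rewrite inE ql orbT.
have i1 := square_integrable_prod measurableT (square_integrable_W mA AD) sY.
have i2 := square_integrable_prod measurableT (square_integrable_noise lD') sY.
have j1 := square_integrable_prod measurable_spacetime (square_integrable_indic mA AD) sy.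
have j2 := square_integrable_prod measurable_spacetime (square_integrable_noise_fun lD') sy.
transitivity (\int[P]_w (p.1 * (W p.2 w * Y w) + noise l w * Y w)).
  by apply: eq_Rintegral => w _; rewrite /noise big_cons; ring.
rewrite (RintegralD measurableT (integrableZl measurableT p.1 i1) i2) RintegralZl//.
rewrite IH// h//.
transitivity (\int[mu]_(z in D) (p.1 * (\1_(p.2) z * y z) + noise_fun l z * y z)); last first.
  by apply: eq_Rintegral => w _; rewrite /noise_fun big_cons; ring.
by rewrite (RintegralD measurable_spacetime (integrableZl measurable_spacetime p.1 j1) j2) RintegralZl//; exact: measurable_spacetime.
Qed.

Lemma noise_isometry l : noise_sets l ->
  \int[P]_w (noise l w) ^+ 2 = \int[mu]_(z in D) (noise_fun l z) ^+ 2.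
Proof.
move=> lD; under eq_Rintegral do rewrite expr2.
under [RHS]eq_Rintegral do rewrite expr2.
have sn := square_integrable_noise lD; have sf := square_integrable_noise_fun lD.
apply: noise_isometry_l => // A mA AD.
under eq_Rintegral do rewrite mulrC.
under [RHS]eq_Rintegral do rewrite mulrC.
apply: noise_isometry_l => //.
- exact: square_integrable_W.
- exact: square_integrable_indic.
move=> B mB BD; rewrite /Rintegral cov//.
have -> : (\int[mu]_(x in D) (\1_B x * \1_A x)%:E = \int[mu]_(x in D) (\1_(B `&` A) x)%:E)%E.
  by apply: eq_integral => x _; rewrite indicI.
rewrite integral_indic; [|exact: measurable_spacetime|exact: measurableI].
by rewrite (_ : B `&` A `&` D = B `&` A)//; apply: setIidl => z [_ /AD].
Qed.

Lemma noise_mean0 l : noise_sets l -> ('E_P[noise l] = 0)%E.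
Proof.
move=> lD; rewrite unlock; elim: l lD => [|p l IH] lD.
  by under eq_integral do rewrite /noise big_nil; exact: integral0.
have [mA AD] := lD p (mem_head _ _).
have lD' : noise_sets l by move=> q ql; apply: lD; rewrite inE ql orbT.
have si X : square_integrable P setT X -> P.-integrable setT (EFin \o X).
  by move=> [mX iX]; exact: sqr_integrable1.
have i1 := si _ (square_integrable_W mA AD); have i2 := si _ (square_integrable_noise lD').
under eq_integral do rewrite /noise big_cons EFinD EFinM.
rewrite (integralD measurableT (integrableZl measurableT p.1 i1) i2) integralZl// IH// adde0.
by have := white_noise_mean hW mA AD; rewrite unlock => ->; rewrite mule0.
Qed.

(** The level sets in [simple_wiener] are cut by [spacetime], so the two functions are compared
    there only. *)
Lemma simple_wienerE h : exists2 l, noise_sets l &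
  simple_wiener T W h = noise l /\ {in D, forall z, noise_fun l z = h z}.
Proof.
exists [seq (c, D `&` h @^-1` [set c]) | c <- finmap.enum_fset (fset_set (range h))].
  move=> p /mapP[c _ ->] /=; split; last by move=> z [].
  by apply: measurableI; [exact: measurable_spacetime|exact: measurable_funPTI].
split.
  by apply/funext => w; rewrite /simple_wiener /noise big_map fsbig_finite.
move=> z; rewrite inE => zD; rewrite [RHS]fimfunE /noise_fun big_map fsbig_finite//=.
apply: eq_bigr => c _; congr (_ * _); rewrite !indicE; congr (_%:R); congr nat_of_bool.
by rewrite in_setI mem_set.
Qed.

Lemma square_integrable_sfun h : square_integrable mu D h.
Proof.
have [l lD [_ e]] := simple_wienerE h; have [mf fi] := square_integrable_noise_fun lD.
split; first by apply: eq_measurable_fun mf => z zD; exact: e.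
apply: eq_integrable fi; first exact: measurable_spacetime.
by move=> z zD /=; rewrite e.
Qed.

Lemma square_integrable_simple_wiener h : square_integrable P setT (simple_wiener T W h).
Proof.
by have [l lD [-> _]] := simple_wienerE h; exact: square_integrable_noise.
Qed.

(** The two integrals are combined before any limit is taken: joint Gaussianity of a pair is used in
    the form of Gaussianity of its combinations. *)
Lemma simple_wiener_lin (a b : R) h h' :
  let S := fun w => a * simple_wiener T W h w + b * simple_wiener T W h' w in
  [/\ gaussian_rv P S, ('E_P[S] = 0)%E &
    (\int[P]_w (S w ^+ 2)%:E)%E = (\int[mu]_(z in D) (a * h z + b * h' z) ^+ 2)%:E].
Proof.
move=> S; have [l lD [hl el]] := simple_wienerE h; have [l' lD' [hl' el']] := simple_wienerE h'.
pose k := [seq (a * p.1, p.2) | p <- l] ++ [seq (b * p.1, p.2) | p <- l'].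
have kD : noise_sets k.
  by move=> p; rewrite mem_cat => /orP[] /mapP[q ql ->] /=; [exact: lD|exact: lD'].
have SE : S = noise k.
  apply/funext => w; rewrite /S hl hl' /noise big_cat !big_map /= !mulr_sumr.
  by congr (_ + _); apply: eq_bigr => p _; rewrite mulrA.
have kE z : z \in D -> noise_fun k z = a * h z + b * h' z.
  move=> zD; rewrite -el// -el'// /noise_fun big_cat !big_map /= !mulr_sumr.
  by congr (_ + _); apply: eq_bigr => p _; rewrite mulrA.
rewrite SE; split; [exact: gaussian_noise|exact: noise_mean0|].
rewrite (square_integrable_fin measurableT (square_integrable_noise kD)) noise_isometry//.
by congr (_%:E); apply: eq_Rintegral => z zD; rewrite kE.
Qed.

Section wiener_pair.
Variables (f g : st -> R) (X Y : Om -> R).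
Hypotheses (hX : is_wiener_integral P T W f X) (hY : is_wiener_integral P T W g Y).
Variables a b : R.

Lemma square_integrable_wiener_kernel (k : st -> R) Z : is_wiener_integral P T W k Z ->
  square_integrable mu D k.
Proof. by move=> [mk koo _ _]; apply: square_integrableP => //; exact: measurable_spacetime. Qed.

Let sub_sqi dsp' (Z : measurableType dsp') (nu : {measure set Z -> \bar R}) E (k k' : Z -> R) :
  measurable E -> square_integrable nu E k -> square_integrable nu E k' ->
  square_integrable nu E (fun x => k x - k' x).
Proof.
move=> mE sk sk'; have := square_integrable_lin mE 1 (-1) sk sk'.
by rewrite (_ : (fun x => 1 * k x + -1 * k' x) = (fun x => k x - k' x))//; apply/funext => x; ring.
Qed.

(** Convergence to zero makes some distance to a simple integral finite, and the simple integral is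
    square integrable. *)
Let wiener_sqi (k : st -> R) Z : is_wiener_integral P T W k Z -> square_integrable P setT Z.
Proof.
move=> [mk koo mZ [h [_ /fine_cvgP[[n _ /(_ n (leqnn n)) hn] _]]]].
have sn := square_integrable_simple_wiener (h n).
have sd : square_integrable P setT (fun w => Z w - simple_wiener T W (h n) w).
  apply: square_integrableP => //; first by apply: measurable_funB => //; exact: (proj1 sn).
  by move: hn; rewrite unlock ge0_fin_numE//; apply: integral_ge0 => w _; rewrite lee_fin sqr_ge0.
have := square_integrable_lin measurableT 1 1 sd sn.
by congr square_integrable; apply/funext => w; ring.
Qed.

Let q := \int[mu]_(z in D) (a * f z + b * g z) ^+ 2.

(** The approximations of [X] and [Y] are combined at equal index. The two given convergences in
    [L^2] of kernels control the variance, those of variables the distance to [a X + b Y]. *)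
Lemma wiener_pair_approx : exists S : nat -> Om -> R, exists q_ : nat -> R,
  [/\ forall n, gaussian_rv P (S n), forall n, ('E_P[S n] = 0)%E,
    forall n, (\int[P]_w (S n w ^+ 2)%:E)%E = (q_ n)%:E,
    q_ n @[n --> \oo] --> q &
    (\int[P]_w ((a * X w + b * Y w - S n w) ^+ 2)%:E)%E @[n --> \oo] --> 0%E].
Proof.
have sf := square_integrable_wiener_kernel hX; have sg := square_integrable_wiener_kernel hY.
have sX := wiener_sqi hX; have sY := wiener_sqi hY.
have [_ _ _ [h [/fine_cvgP[_ h0] /fine_cvgP[_ h1]]]] := hX.
have [_ _ _ [h' [/fine_cvgP[_ h'0] /fine_cvgP[_ h'1]]]] := hY.
pose S n w := a * simple_wiener T W (h n) w + b * simple_wiener T W (h' n) w.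
exists S, (fun n => \int[mu]_(z in D) (a * h n z + b * h' n z) ^+ 2).
have lim0 (u v : nat -> R) : (u n @[n --> \oo] --> 0) -> (v n @[n --> \oo] --> 0) ->
    2 * a ^+ 2 * u n + 2 * b ^+ 2 * v n @[n --> \oo] --> 0.
  move=> u0 v0; rewrite -[X in _ --> X](_ : 2 * a ^+ 2 * 0 + 2 * b ^+ 2 * 0 = 0); last by rewrite !mulr0 addr0.
  by apply: cvgD; exact: cvgMl_tmp.
split=> [n|n|n||].
- by have [] := simple_wiener_lin a b (h n) (h' n).
- by have [] := simple_wiener_lin a b (h n) (h' n).
- by have [] := simple_wiener_lin a b (h n) (h' n).
- apply: (L2_norm_cvg measurable_spacetime).
  + exact: (square_integrable_lin measurable_spacetime).
  + by move=> n; apply: (square_integrable_lin measurable_spacetime); exact: square_integrable_sfun.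
  + apply: (squeeze_cvgr _ (cvg_cst 0) (lim0 _ _ h0 h'0)).
    apply: nearW => n; rewrite Rintegral_sqr_ge0/=.
    by apply: (L2_dist_lin measurable_spacetime) => //; exact: square_integrable_sfun.
- have sS n : square_integrable P setT (S n).
    by apply: (square_integrable_lin measurableT); exact: square_integrable_simple_wiener.
  have sXY := square_integrable_lin measurableT a b sX sY.
  have fin n := square_integrable_fin measurableT (sub_sqi measurableT sXY (sS n)).
  under eq_fun do rewrite fin.
  apply: cvg_EFin; first by apply: nearW.
  apply: (squeeze_cvgr _ (cvg_cst 0) (lim0 _ _ h1 h'1)).
  apply: nearW => n; rewrite /= Rintegral_sqr_ge0/= unlock.
  by apply: (L2_dist_lin measurableT) => //; exact: square_integrable_simple_wiener.
Qed.

Let mXY : measurable_fun setT (fun w => a * X w + b * Y w).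
Proof. by have [_ _ mX _] := hX; have [_ _ mY _] := hY; apply: measurable_funD; exact: measurable_funM. Qed.

Lemma wiener_pair_cos c : \int[P]_w cos (a * X w + b * Y w + c) = cos c * expR (- (q / 2)).
Proof.
have [S [q_ [gS S0 Sq q_q S_XY]]] := wiener_pair_approx.
apply: (L2_limit_cos mXY _ q_q S_XY) => n; first by have [] := gS n.
exact: gaussian_cos.
Qed.

Lemma wiener_pair_tail (q' u : R) : q < q' -> 0 < q' -> 0 < u ->
  (P [set w | (u < `|a * X w + b * Y w|)%R] <= (2 * expR (- (u ^+ 2 / (16 * q'))))%:E)%E.
Proof.
move=> qq' q'0 u0; have [S [q_ [gS S0 Sq q_q S_XY]]] := wiener_pair_approx.
apply: (L2_limit_tail mXY _ q_q S_XY qq' q'0 u0) => n; first by have [] := gS n.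
by move=> qn; apply: (gaussian_tail (gS n) (S0 n) (Sq n) qn) => //; rewrite divr_ge0// ltW.
Qed.

End wiener_pair.

End simple_noise.

(** * One- and two-point estimates *)

Section field.
Context {dsp} {Om : measurableType dsp} {R : realType}.
Variables (P : probability Om R) (T : R) (d : nat).
Local Notation mR := (measurableTypeR R).
Local Notation st := (mR * d.-tuple mR)%type.
Variables (W : set st -> Om -> R) (v0 : d.-tuple R -> R) (v : R -> d.-tuple R -> Om -> R).
Hypotheses (T0 : 0 < T) (d0 : (0 < d)%N) (d4 : (d < 4)%N).
Hypotheses (hW : white_noise P T W) (hv : biharmonic_field P T W v0 v).
Hypothesis hv0 : forall x, torus x -> (lebesgue_tuple R d).-integrable (@torus R d)
  (fun z => (green T x z * v0 z)%:E).
Implicit Types (t s : R) (x y : d.-tuple R).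

Local Notation mu := (@st_measure R d).
Local Notation D := (@spacetime R T d).
Local Notation K := (@wiener_kernel R d).
Local Notation m := (mean v0).

Definition kernel_cov t x s y : R := \int[mu]_(z in D) (K t x z * K s y z).

Let field_wiener t x : 0 < t <= T -> torus x ->
  exists2 X, is_wiener_integral P T W (K t x) X &
    {ae P, forall w, v t x w = m t x + X w}.
Proof. by move=> tT xt; have [_ [X iX vX]] := hv tT xt; exists X. Qed.

(** Read off the existence of the Wiener integral that defines the field; this is also where
    measurability of the kernels comes from. *)
Lemma square_integrable_kernel t x : 0 < t <= T -> torus x -> square_integrable mu D (K t x).
Proof.
by move=> tT xt; have [X iX _] := field_wiener tT xt; exact: square_integrable_wiener_kernel iX.
Qed.

Let mK t x : 0 < t <= T -> torus x -> measurable_fun D (K t x).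
Proof. by move=> tT xt; have [] := square_integrable_kernel tT xt. Qed.

Lemma Rintegral_kernel_lin t x s y (a b : R) : 0 < t <= T -> torus x -> 0 < s <= T -> torus y ->
  \int[mu]_(z in D) (a * K t x z + b * K s y z) ^+ 2 =
  a ^+ 2 * kernel_cov t x t x + 2 * a * b * kernel_cov t x s y + b ^+ 2 * kernel_cov s y s y.
Proof.
move=> tT xt sT yt.
rewrite (Rintegral_sqr_lin (@measurable_spacetime R T d) _ _ (square_integrable_kernel tT xt) (square_integrable_kernel sT yt)).
by congr (_ * _ + _ + _ * _); apply: eq_Rintegral => z _; rewrite expr2.
Qed.

Lemma kernel_norm2_cov t x s y c : 0 < t <= T -> torus x -> 0 < s <= T -> torus y ->
  kernel_norm2 T t x s y c =
  (kernel_cov t x t x - 2 * c * kernel_cov t x s y + c ^+ 2 * kernel_cov s y s y)%:E.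
Proof.
move=> tT xt sT yt; have st := square_integrable_kernel tT xt.
have ss := square_integrable_kernel sT yt.
have := Rintegral_kernel_lin 1 (- c) tT xt sT yt.
have sl := square_integrable_lin (@measurable_spacetime R T d) 1 (- c) st ss.
rewrite /kernel_norm2 => e.
transitivity (\int[mu]_(z in D) ((1 * K t x z + (- c) * K s y z) ^+ 2)%:E)%E.
  by apply: eq_integral => z _; congr (_%:E); ring.
rewrite (square_integrable_fin (@measurable_spacetime R T d) sl) e; congr (_%:E).
by move: (kernel_cov t x t x) (kernel_cov t x s y) (kernel_cov s y s y) => A B C; ring.
Qed.

(** The form in which the joint Gaussian law of two values enters the small ball estimates; [b = 0]
    gives the law of a single value. *)
Lemma field_cos t x s y (a b c : R) : 0 < t <= T -> torus x -> 0 < s <= T -> torus y ->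
  \int[P]_w cos (a * v t x w + b * v s y w + c) =
  cos (a * m t x + b * m s y + c) *
  expR (- ((a ^+ 2 * kernel_cov t x t x + 2 * a * b * kernel_cov t x s y +
            b ^+ 2 * kernel_cov s y s y) / 2)).
Proof.
move=> tT xt sT yt; have [X iX vX] := field_wiener tT xt; have [Y iY vY] := field_wiener sT yt.
rewrite -Rintegral_kernel_lin// -(wiener_pair_cos T0 hW iX iY).
have [mvt _] := hv tT xt; have [mvs _] := hv sT yt.
have [_ _ mX _] := iX; have [_ _ mY _] := iY.
have mcos : measurable_fun setT (cos : R -> R).
  by apply: continuous_measurable_fun; exact: continuous_cos.
congr fine; apply: ae_eq_integral => //.
- apply/measurable_EFinP; apply: (measurableT_comp mcos); apply: measurable_funD => //.
  by apply: measurable_funD; exact: measurable_funM.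
- apply/measurable_EFinP; apply: (measurableT_comp mcos); apply: measurable_funD => //.
  by apply: measurable_funD; exact: measurable_funM.
- move: vX vY; apply: filterS2 => w -> -> _; congr (_%:E); congr cos; ring.
Qed.

Lemma field_increment_tail t x s y (q u : R) : 0 < t <= T -> torus x -> 0 < s <= T -> torus y ->
  (kernel_norm2 T t x s y 1 <= q%:E)%E -> 0 < q -> 0 < u ->
  (P [set w | (u + `|m t x - m s y| < `|v t x w - v s y w|)%R] <=
   (2 * expR (- (u ^+ 2 / (32 * q))))%:E)%E.
Proof.
move=> tT xt sT yt nq q0 u0.
have [X iX vX] := field_wiener tT xt; have [Y iY vY] := field_wiener sT yt.
(* A strict bound on the variance is required by [wiener_pair_tail], hence [2 q] and
   [32 = 16 * 2]. *)
have qq : \int[mu]_(z in D) (1 * K t x z + (-1) * K s y z) ^+ 2 < 2 * q.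
  rewrite Rintegral_kernel_lin//; move: nq; rewrite kernel_norm2_cov// lee_fin.
  by move: q0; move: (kernel_cov t x t x) (kernel_cov t x s y) (kernel_cov s y s y) => A B C; lra.
have q20 : 0 < 2 * q by rewrite mulr_gt0.
have := wiener_pair_tail T0 hW iX iY qq q20 u0.
rewrite (_ : 16 * (2 * q) = 32 * q); last by ring.
apply: le_trans; have [mvt _] := hv tT xt; have [mvs _] := hv sT yt.
have [_ _ mX _] := iX; have [_ _ mY _] := iY.
have mA := measurable_norm_gt (u + `|m t x - m s y|) (measurable_funB mvt mvs).
have mL : measurable_fun setT (fun w => 1 * X w + (-1) * Y w).
  by apply: measurable_funD; exact: measurable_funM.
have mB := measurable_norm_gt u mL.
have [N [mN PN NS]] := filterI vX vY.
apply: (@le_trans _ _ (P ([set w | (u < `|1 * X w + (-1) * Y w|)%R] `|` N))).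
  apply: le_measure; rewrite ?inE//; first exact: measurableU.
  move=> w /= hw; have [Nw|Nw] := pselect (N w); [by right|left].
  have [[e1 e2]|h] := pselect (v t x w = m t x + X w /\ v s y w = m s y + Y w); last first.
    by exfalso; apply: Nw; exact: NS.
  move: hw; rewrite e1 e2 => hw.
  have : `|m t x + X w - (m s y + Y w)| <= `|m t x - m s y| + `|1 * X w + -1 * Y w|.
    apply: le_trans (ler_normD _ _); rewrite le_eqVlt; apply/orP; left; apply/eqP; congr `| _ |; ring.
  by move: hw; rewrite /=; lra.
apply: le_trans (measureU2 _ _ _) _ => //.
have PN0 : (P N <= 0)%E by rewrite le_eqVlt; apply/orP; left; apply/eqP; exact: PN.
by rewrite -[leRHS]adde0; apply: leeD.
Qed.

Section field_estimates.
Variable t0 : R.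
Hypotheses (t00 : 0 < t0) (t0T : t0 <= T).

Let tpos t : t0 <= t <= T -> 0 < t <= T.
Proof. by move=> /andP[a ->]; rewrite andbT (lt_le_trans t00). Qed.

Let mv t x : t0 <= t <= T -> torus x -> measurable_fun setT (v t x).
Proof. by move=> /tpos tT xt; have [] := hv tT xt. Qed.

Let cov_ge t x : t0 <= t <= T -> torus x -> t0 * (2 * pi) ^- d <= kernel_cov t x t x.
Proof.
move=> tT xt; have tT' := tpos tT; have /andP[tt tT1] := tT.
have := kernel_norm2_ge (mK tT' xt) (ltW (lt_le_trans t00 tt)) tT1.
rewrite kernel_norm2_cov// lee_fin mulr0 mul0r subr0 expr0n/= mul0r addr0.
by apply: le_trans; rewrite ler_wpM2r// invr_ge0 exprn_ge0// mulr_ge0// pi_ge0.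
Qed.

Let c0 := t0 * (2 * pi) ^- d.
Let c00 : 0 < c0.
Proof. by rewrite mulr_gt0// invr_gt0 exprn_gt0// mulr_gt0// pi_gt0. Qed.

Let cov_upper : exists2 C : R, 0 < C & forall t x, t0 <= t <= T -> torus x -> kernel_cov t x t x <= C.
Proof.
have d41 : d%:R / 4 < 1 :> R by rewrite ltr_pdivrMr// mul1r ltr_nat.
pose al : R := Num.min 1 ((1 - d%:R / 4) / 2).
have al0 : 0 < al by rewrite lt_min ltr01/= divr_gt0// subr_gt0.
have al1 : al <= 1 by rewrite ge_min lexx.
have al2 : al <= (1 - d%:R / 4) / 2 by rewrite ge_min lexx orbT.
have [C C0 hC] := @kernel_norm2_upper R T al al T0 al0 al1 al0 al1 d d0
  ltac:(move: al0 d41 al2; lra) ltac:(move: al0 d41 al2; lra).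
exists (C * T `^ al); first by rewrite mulr_gt0// powR_gt0.
move=> t x tT xt; have tT' := tpos tT; have /andP[tt tT1] := tT.
(* The kernel at time [0] vanishes on [spacetime], so the variance at [(t, x)] is that of the
   increment from [(0, x)] and the upper bound on increments applies. *)
have m0 : measurable_fun D (K 0 x).
  have e : {in D, (cst (0 : R) : st -> R) =1 K 0 x}.
    move=> [r z]; rewrite inE => -[/= + _]; rewrite in_itv/= => /andP[r0 _].
    by rewrite wiener_kernel0.
  by apply: (eq_measurable_fun _ e); exact: measurable_cst.
have := hC t x 0 x (mK tT' xt) m0 (lexx 0) (ltW (lt_le_trans t00 tt)) tT1.
have -> : kernel_norm2 T t x 0 x 1 = kernel_norm2 T t x t x 0.
  apply: eq_integral => -[r z]; rewrite inE => -[/= + _]; rewrite in_itv/= => /andP[r0 _].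
  by rewrite (wiener_kernel0 x z r0) mulr0 mul0r.
rewrite kernel_norm2_cov// lee_fin mulr0 mul0r subr0 expr0n/= mul0r addr0 => /le_trans; apply.
rewrite subr0 big1 ?addr0; last by move=> j _; rewrite subrr expr0n/= powR0// gt_eqF.
by apply: ler_wpM2l; [exact: ltW|rewrite ge0_ler_powR ?nnegrE ?(ltW al0) ?(ltW T0)// (le_trans (ltW t00))].
Qed.

Let cos1 t x : t0 <= t <= T -> torus x -> forall a c,
  \int[P]_w cos (a * v t x w + c) = cos (a * m t x + c) * expR (- (a ^+ 2 * kernel_cov t x t x / 2)).
Proof.
move=> tT xt a c; have tT' := tpos tT.
have := field_cos a 0 c tT' xt tT' xt; rewrite !mulr0 !mul0r expr0n/= mul0r !addr0 => <-.
by apply: eq_Rintegral => w _; rewrite mul0r addr0.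
Qed.

Lemma field_point_upper : exists2 C : R, 0 < C & forall t x (z e : R),
  t0 <= t <= T -> torus x -> 0 < e ->
  fine (P [set w | (`|v t x w - z| <= e)%R]) <= C * e.
Proof.
exists (2 / Num.sqrt c0); first by rewrite divr_gt0// sqrtr_gt0.
move=> t x z e tT xt e0; have A0 := lt_le_trans c00 (cov_ge tT xt).
apply: le_trans (small_ball_upper (mv tT xt) A0 (cos1 tT xt) z e0) _.
rewrite mulrAC ler_wpM2r ?(ltW e0)// ler_wpM2l// lef_pV2 ?posrE ?sqrtr_gt0//.
by rewrite ler_wsqrtr// cov_ge.
Qed.

Lemma field_point_lower (Z : R) : exists2 c : R, 0 < c & forall t x (z e : R),
  t0 <= t <= T -> torus x -> `|z| <= Z -> 0 < e -> e <= 1 ->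
  c * e <= fine (P [set w | (`|v t x w - z| <= e)%R]).
Proof.
have [C C0 hC] := cov_upper.
have [M M0 [hM _]] := @mean_bounds R d T v0 T0 hv0 t0 t00.
exists (small_ball_const c0 C (M + Z)); first exact: (small_ball_const_gt0 _ c00 (ltW C0)).
move=> t x z e tT xt zZ e0 e1; have A0 := lt_le_trans c00 (cov_ge tT xt).
apply: (small_ball_lower (mv tT xt) A0 (cos1 tT xt)) => //; [exact: cov_ge|exact: hC|].
apply: le_trans (ler_normB _ _) _; apply: lerD => //.
by apply: hM; have /andP[] := tT.
Qed.

Lemma field_increment (al th : R) : 0 < al -> al <= 1 -> 0 < th -> th <= 1 ->
  d%:R / 4 + al < 1 -> d%:R / 4 + th / 2 < 1 ->
  exists2 C : R, 0 < C & forall t s x y (q u : R), t0 <= s -> s <= t -> t <= T ->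
    torus x -> torus y -> 0 < q -> 0 < u ->
    (t - s) `^ al + \sum_j ((tnth x j - tnth y j) ^+ 2) `^ th <= q ->
    (P [set w | (u + C * (t - s + \sum_j `|tnth x j - tnth y j|) < `|v t x w - v s y w|)%R] <=
     (2 * expR (- (u ^+ 2 / (C * q))))%:E)%E.
Proof.
move=> al0 al1 th0 th1 dal dth.
have [C C0 hC] := @kernel_norm2_upper R T al th T0 al0 al1 th0 th1 d d0 dal dth.
have [M M0 [_ hM]] := @mean_bounds R d T v0 T0 hv0 t0 t00.
(* One constant for two purposes: [32 * C] for the Gaussian exponent and [M] for the Lipschitz bound
   on the mean. *)
exists (32 * C + M); first by rewrite addr_gt0// mulr_gt0.
move=> t s x y q u s0 st tT xt yt q0 u0 hq.
have tT' : t0 <= t <= T by rewrite tT (le_trans s0).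
have sT' : t0 <= s <= T by rewrite s0 (le_trans st).
have nq : (kernel_norm2 T t x s y 1 <= (C * q)%:E)%E.
  apply: le_trans (hC t x s y (mK (tpos tT') xt) (mK (tpos sT') yt) (le_trans (ltW t00) s0) st tT) _.
  by rewrite lee_fin ler_pM2l.
have Cq0 : 0 < C * q by rewrite mulr_gt0.
have := field_increment_tail (tpos tT') xt (tpos sT') yt nq Cq0 u0.
move=> h; apply: le_trans (le_trans h _).
  apply: le_measure; rewrite ?inE.
  - by apply: measurable_norm_gt; apply: measurable_funB; exact: mv.
  - by apply: measurable_norm_gt; apply: measurable_funB; exact: mv.
  move=> w; apply: le_lt_trans; rewrite lerD2l.
  have S0 : 0 <= t - s + \sum_j `|tnth x j - tnth y j| by rewrite addr_ge0 ?subr_ge0// sumr_ge0.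
  apply: le_trans (hM t s x y _ _) _ => //; first exact: le_trans st.
  rewrite [`|t - s|]ger0_norm ?subr_ge0// ler_wpM2r// lerDr mulr_ge0// ltW//.
rewrite lee_fin ler_wpM2l// ler_expR lerN2 ler_wpM2l ?sqr_ge0// lef_pV2 ?posrE.
- by rewrite mulrA ler_wpM2r ?(ltW q0)// lerDl ltW.
- by rewrite mulr_gt0// addr_gt0// mulr_gt0.
- by rewrite mulr_gt0.
Qed.

(** At [c = B / C] the lower bound uniform in [c] becomes [w <= A - B ^ 2 / C], so the determinant
    is at least [w C], and [C >= c0]. The alternative on [rho] says that this distance is attained
    either in time or in one coordinate. *)
Let two_point_aux : exists C : R, exists2 k : R, 0 < C /\ 0 < k & forall t s x y (z e rho : R),
  t0 <= s -> s <= t -> t <= T -> torus x -> torus y -> 0 < e -> 0 <= rho -> rho <= 2^-1 ->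
  2 * rho ^+ 4 <= t0 ->
  (t - s = rho ^+ 4 \/ exists2 j, `|tnth x j - tnth y j| = rho & t - s <= rho ^+ 4) ->
  fine (P ([set w | (`|v t x w - z| <= e)%R] `&` [set w | (`|v s y w - z| <= e)%R])) <=
  C * (e ^+ 2 / Num.sqrt (e ^+ 2 + k * rho ^+ (4 - d))).
Proof.
have [k k0 hk] := @kernel_norm2_lower R d T d0 d4.
exists (4 / Num.sqrt c0), k; first by split => //; rewrite divr_gt0// sqrtr_gt0.
move=> t s x y z e rho s0 st tT xt yt e0 rho0 rho1 rho4 hrho.
have tT' : t0 <= t <= T by rewrite tT (le_trans s0).
have sT' : t0 <= s <= T by rewrite s0 (le_trans st).
have [tT0 sT0] := (tpos tT', tpos sT').
set A := kernel_cov t x t x; set B := kernel_cov t x s y; set C := kernel_cov s y s y.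
set w := k * rho ^+ (4 - d).
have w0 : 0 <= w by rewrite mulr_ge0 ?(ltW k0)// exprn_ge0.
have A1 : c0 <= A by exact: cov_ge. have C1 : c0 <= C by exact: cov_ge.
have A0 : 0 < A by exact: lt_le_trans A1. have C0 : 0 < C by exact: lt_le_trans C1.
have low c : w <= A - 2 * c * B + c ^+ 2 * C.
  have [h1 h2] := hk t s c x y (mK tT0 xt) (mK sT0 yt) (le_trans (ltW t00) s0) st tT.
  rewrite -lee_fin -kernel_norm2_cov//.
  case: hrho => [ts|[j xyj ts]]; first exact: h1.
  by have := h2 j; rewrite /= xyj; apply => //; exact: le_trans s0.
have hc : forall a b c, \int[P]_w cos (a * v t x w + b * v s y w + c) =
   cos (a * m t x + b * m s y + c) * expR (- ((a ^+ 2 * A + 2 * a * b * B + b ^+ 2 * C) / 2)).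
  by move=> a b c; exact: field_cos.
clearbody A B C w.
have det : w * C <= A * C - B ^+ 2.
  have := low (B / C); rewrite -(ler_pM2r C0) => /le_trans; apply.
  by rewrite le_eqVlt; apply/orP; left; apply/eqP; field; rewrite gt_eqF.
have BAC : B ^+ 2 <= A * C by rewrite -subr_ge0; apply: le_trans det; rewrite mulr_ge0// ltW.
have := two_small_balls_upper z z (mv tT' xt) (mv sT' yt) A0 (ltW C0) BAC
  hc e0.
move/le_trans; apply.
rewrite [leRHS]mulrACA -invfM.
have p1 : 0 < c0 * (e ^+ 2 + w) by rewrite mulr_gt0// ltr_wpDr// exprn_gt0.
rewrite ler_wpM2l//; first by rewrite mulr_ge0 ?sqr_ge0.
rewrite -sqrtrM ?(ltW c00)// lef_pV2 ?posrE ?sqrtr_gt0//.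
  rewrite ler_wsqrtr// mulrDr; apply: lerD; first by rewrite mulrC ler_wpM2l ?sqr_ge0.
  by apply: le_trans det; rewrite mulrC ler_wpM2l.
by rewrite ltr_wpDr ?mulr_gt0 ?exprn_gt0// subr_ge0.
Qed.

Lemma field_two_points : exists C : R, exists2 k : R, 0 < C /\ 0 < k & forall t s x y (z e rho : R),
  t0 <= s <= T -> t0 <= t <= T -> torus x -> torus y -> 0 < e -> 0 <= rho -> rho <= 2^-1 ->
  2 * rho ^+ 4 <= t0 ->
  (`|t - s| = rho ^+ 4 \/ exists2 j, `|tnth x j - tnth y j| = rho & `|t - s| <= rho ^+ 4) ->
  fine (P ([set w | (`|v t x w - z| <= e)%R] `&` [set w | (`|v s y w - z| <= e)%R])) <=
  C * (e ^+ 2 / Num.sqrt (e ^+ 2 + k * rho ^+ (4 - d))).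
Proof.
have [C [k Ck h]] := two_point_aux; exists C, k => // t s x y z e rho sT tT xt yt e0 r0 r1 r4 hr.
have /andP[s1 s2] := sT; have /andP[t1 t2] := tT.
have [st|/ltW ts] := leP s t.
  by apply: h => //; move: hr; rewrite ger0_norm ?subr_ge0.
rewrite setIC; apply: h => //; move: hr; rewrite distrC ger0_norm ?subr_ge0//.
by case=> [->|[j xj tj]]; [left|right; exists j => //; rewrite distrC].
Qed.

End field_estimates.
End field.

(** * Independent copies *)

Section copies.
Context {dsp dsp'} {Om : measurableType dsp} {Om' : measurableType dsp'} {R : realType}.
Variables (P : probability Om R) (P' : probability Om' R) (T : R) (d D : nat).
Local Notation mR := (measurableTypeR R).
Variables (v : R -> d.-tuple R -> Om' -> R) (V : 'I_D -> R -> d.-tuple R -> Om -> R).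
Hypothesis hV : independent_copies P T P' v V.
Implicit Types (t s : R) (x y : d.-tuple R) (i : 'I_D).

Lemma measurable_copy i t x : 0 < t <= T -> torus x -> measurable_fun setT (V i t x).
Proof. by move=> tT xt; have [mV _ _] := hV; exact: mV. Qed.

Lemma copy_law1 i t x (B : set mR) : 0 < t <= T -> torus x -> measurable B ->
  P (V i t x @^-1` B) = P' (v t x @^-1` B).
Proof.
move=> tT xt mB; have [_ sl _] := hV.
have mB' : measurable [set y : 1.-tuple mR | B (tnth y ord0)].
  rewrite -[X in measurable X]setTI.
  exact: (@measurable_tnth _ mR 1 ord0 measurableT B mB).
have := sl i 1 (fun=> t) (fun=> x) _ (fun=> conj tT xt) mB'.
have e (U : Type) (f : U -> R) :
    [set w | [set y : 1.-tuple R | B (tnth y ord0)] [tuple f w | i < 1]] = f @^-1` B.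
  by apply/seteqP; split => w /=; rewrite tnth_mktuple.
by rewrite !e.
Qed.

Lemma copy_law2 i t s x y (B : set (mR * mR)) : 0 < t <= T -> torus x ->
  0 < s <= T -> torus y -> measurable B ->
  P [set w | B (V i t x w, V i s y w)] = P' [set w | B (v t x w, v s y w)].
Proof.
move=> tT xt sT yt mB; have [_ sl _] := hV.
pose h (z : 2.-tuple mR) : mR * mR := (tnth z ord0, tnth z ord_max).
have mh : measurable_fun setT h.
  by apply/measurable_fun_pairP; split; exact: measurable_tnth.
have mB' : measurable (h @^-1` B) by rewrite -[X in measurable X]setTI; exact: mh.
pose tt (j : 'I_2) := if j == ord0 then t else s.
pose xx (j : 'I_2) := if j == ord0 then x else y.
have dom j : 0 < tt j <= T /\ torus (xx j) by rewrite /tt /xx; case: ifP.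
have := sl i 2 tt xx _ dom mB'.
have e (U : Type) (f : 'I_2 -> U -> R) :
    [set w | (h @^-1` B) [tuple f j w | j < 2]] = [set w | B (f ord0 w, f ord_max w)].
  by apply/seteqP; split => w /=; rewrite /h !tnth_mktuple.
by rewrite !e.
Qed.

Let point i t x (z e : R) := [set w | (`|V i t x w - z| <= e)%R].

Let mball (z e : R) : measurable [set a : mR | (`|a - z| <= e)%R].
Proof. by apply: (@measurable_ball _ mR R (fun a => a) z e). Qed.

Lemma field_sigma_point i t x (z e : R) : 0 < t <= T -> torus x -> field_sigma T (V i) (point i t x z e).
Proof.
move=> tT xt; apply: sub_gen_smallest; exists t, x, [set a : mR | (`|a - z| <= e)%R]; split => //.
exact: mball.
Qed.

Lemma field_sigmaI i A B : field_sigma T (V i) A -> field_sigma T (V i) B ->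
  field_sigma T (V i) (A `&` B).
Proof. exact: (@measurableI _ (g_sigma_algebraType _)). Qed.

Lemma copy_point i t x (z e : R) : 0 < t <= T -> torus x ->
  P (point i t x z e) = P' [set w | (`|v t x w - z| <= e)%R].
Proof. by move=> tT xt; exact: (copy_law1 i tT xt (mball z e)). Qed.

Lemma copy_two_points i t s x y (z e : R) : 0 < t <= T -> torus x -> 0 < s <= T -> torus y ->
  P (point i t x z e `&` point i s y z e) =
  P' ([set w | (`|v t x w - z| <= e)%R] `&` [set w | (`|v s y w - z| <= e)%R]).
Proof.
move=> tT xt sT yt.
exact: (copy_law2 i tT xt sT yt (measurableX (mball z e) (mball z e))).
Qed.

Lemma copy_increment i t s x y (c : R) : 0 < t <= T -> torus x -> 0 < s <= T -> torus y ->
  P [set w | (c < `|V i t x w - V i s y w|)%R] = P' [set w | (c < `|v t x w - v s y w|)%R].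
Proof.
move=> tT xt sT yt.
apply: (copy_law2 i tT xt sT yt (B := [set p | (c < `|p.1 - p.2|)%R])).
by apply: (measurable_norm_gt (X := fun p : mR * mR => p.1 - p.2)); exact: measurable_funB.
Qed.

Lemma copies_point (z : D.-tuple R) t x (e : R) : 0 < t <= T -> torus x ->
  fine (P (\bigcap_i point i t x (tnth z i) e)) =
  \prod_i fine (P' [set w | (`|v t x w - tnth z i| <= e)%R]).
Proof.
move=> tT xt; have [_ _ indep] := hV; rewrite indep.
  by apply: eq_bigr => i _; rewrite copy_point.
by move=> i; exact: field_sigma_point.
Qed.

(** The two balls of one component form a single event of its sigma-algebra, so independence across
    components still factors the probability. *)
Lemma copies_two_points (z : D.-tuple R) t s x y (e : R) :
  0 < t <= T -> torus x -> 0 < s <= T -> torus y ->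
  fine (P (\bigcap_i (point i t x (tnth z i) e `&` point i s y (tnth z i) e))) =
  \prod_i fine (P' ([set w | (`|v t x w - tnth z i| <= e)%R] `&`
                    [set w | (`|v s y w - tnth z i| <= e)%R])).
Proof.
move=> tT xt sT yt; have [_ _ indep] := hV; rewrite indep.
  by apply: eq_bigr => i _; rewrite copy_two_points.
by move=> i; apply: field_sigmaI; exact: field_sigma_point.
Qed.

End copies.

(** * Polarity of points *)

Section dyadic_grid.
Variable R : realType.
Implicit Types (L y : R) (k n a : nat).

Definition half_pow n : R := 2^-1 ^+ n.

Definition grid_point L k n a : R := L * a%:R * half_pow (k * n).

Lemma half_pow_gt0 n : 0 < half_pow n.
Proof. by rewrite exprn_gt0// invr_gt0. Qed.

Lemma half_powK n : half_pow n * (2 ^ n)%N%:R = 1.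
Proof. by rewrite /half_pow natrX exprVn mulVf// gt_eqF// exprn_gt0. Qed.

Lemma half_pow_le n n' : (n <= n')%N -> half_pow n' <= half_pow n.
Proof. by move=> nn'; rewrite /half_pow ler_wiXn2l ?invr_ge0// invf_le1// ler1n. Qed.

Lemma half_powD n n' : half_pow (n + n') = half_pow n * half_pow n'.
Proof. exact: exprD. Qed.

Lemma grid_point_itv L k n a : 0 <= L -> (a <= 2 ^ (k * n))%N -> 0 <= grid_point L k n a <= L.
Proof.
move=> L0 ak; have h0 := half_pow_gt0 (k * n).
rewrite /grid_point mulr_ge0 ?mulr_ge0 ?(ltW h0)//= -mulrA ler_piMr//.
rewrite -[leRHS](half_powK (k * n)) [leRHS]mulrC; apply: ler_wpM2r; first exact: ltW.
by rewrite ler_nat.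
Qed.

Lemma grid_point_parent L k n a : 0 <= L ->
  0 <= grid_point L k n.+1 a - grid_point L k n (a %/ 2 ^ k) <= L * half_pow (k * n).
Proof.
move=> L0; have k2 : (0 < 2 ^ k)%N by rewrite expn_gt0.
have -> : grid_point L k n.+1 a - grid_point L k n (a %/ 2 ^ k) =
    L * half_pow (k * n) * (half_pow k * (a %% 2 ^ k)%:R).
  rewrite /grid_point mulnS half_powD {1}(divn_eq a (2 ^ k)) natrD natrM.
  have := half_powK k; set b := half_pow k; set c := (2 ^ k)%:R => bc.
  transitivity (L * half_pow (k * n) * (b * (a %% 2 ^ k)%:R) +
     L * half_pow (k * n) * (a %/ 2 ^ k)%:R * (b * c - 1)); first by ring.
  by rewrite bc subrr mulr0 addr0.
have h0 := half_pow_gt0 (k * n); have h1 := half_pow_gt0 k.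
have Lh : 0 <= L * half_pow (k * n) by rewrite mulr_ge0// ltW.
have c0 : 0 <= half_pow k * (a %% 2 ^ k)%:R by rewrite mulr_ge0// ltW.
rewrite mulr_ge0//= ler_piMr// -[leRHS](half_powK k); apply: ler_wpM2l; first exact: ltW.
by rewrite ler_nat ltnW// ltn_mod.
Qed.

Definition grid_index L k n y : nat := Num.truncn (y / L * (2 ^ (k * n))%N%:R).

Lemma grid_index_le L k n y : 0 < L -> 0 <= y -> y <= L -> (grid_index L k n y <= 2 ^ (k * n))%N.
Proof.
move=> L0 y0 yL; rewrite -(ler_nat R).
have w0 : 0 <= y / L * (2 ^ (k * n))%N%:R by rewrite mulr_ge0// divr_ge0// ltW.
have /andP[h _] := truncn_itv w0; apply: (le_trans h).
by rewrite ler_piMl// ler_pdivrMr// mul1r.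
Qed.

Lemma grid_index_dist L k n y : 0 < L -> 0 <= y ->
  `|y - grid_point L k n (grid_index L k n y)| <= L * half_pow (k * n).
Proof.
move=> L0 y0; have w0 : 0 <= y / L * (2 ^ (k * n))%N%:R by rewrite mulr_ge0// divr_ge0// ltW.
have /andP[h1 h2] := truncn_itv w0; rewrite -/(grid_index L k n y) in h1 h2.
have hp := half_pow_gt0 (k * n); have hK := half_powK (k * n).
have -> : y - grid_point L k n (grid_index L k n y) =
    L * half_pow (k * n) * (y / L * (2 ^ (k * n))%N%:R - (grid_index L k n y)%:R).
  rewrite /grid_point mulrBr; congr (_ - _); last by ring.
  transitivity (y * (half_pow (k * n) * (2 ^ (k * n))%N%:R)); first by rewrite hK mulr1.
  by field; rewrite gt_eqF.
have Lh : 0 <= L * half_pow (k * n) by apply: mulr_ge0; exact: ltW.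
rewrite normrM (ger0_norm Lh) ler_piMr//.
by rewrite ler_norml; move: h1 h2; rewrite -natr1; lra.
Qed.

(** The roundings of a point at successive levels thus form a chain of parents, the only pairs of
    vertices whose increments have to be controlled. *)
Lemma grid_index_parent L k n y : 0 < L -> 0 <= y ->
  (grid_index L k n.+1 y %/ 2 ^ k)%N = grid_index L k n y.
Proof.
move=> L0 y0; have k2 : (0 < 2 ^ k)%N by rewrite expn_gt0.
set w := y / L * (2 ^ (k * n))%N%:R.
have w0 : 0 <= w by rewrite mulr_ge0// divr_ge0// ltW.
have wE : y / L * (2 ^ (k * n.+1))%N%:R = w * (2 ^ k)%N%:R.
  by rewrite mulnS expnD natrM /w; ring.
apply/esym/truncn_def; rewrite -/w /grid_index wE.
have w20 : 0 <= w * (2 ^ k)%N%:R by rewrite mulr_ge0.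
have /andP[h1 h2] := truncn_itv w20; set A := Num.truncn _ in h1 h2 *.
have c0 : 0 < (2 ^ k)%N%:R :> R by rewrite ltr0n.
rewrite -(ler_pM2r c0) -(ltr_pM2r c0) -!natrM; apply/andP; split.
  by apply: le_trans h1; rewrite ler_nat leq_trunc_div.
by apply: (lt_le_trans h2); rewrite ler_nat ltn_ceil.
Qed.

End dyadic_grid.

Section half_pow_limits.
Variable R : realType.

Lemma half_pow_small (K e : R) : 0 < e -> exists n, forall k, (n <= k)%N -> K * half_pow R k <= e.
Proof.
move=> e0; have h : K * half_pow R n @[n --> \oo] --> 0.
  rewrite -[X in _ --> X](mulr0 K); apply: cvgMl_tmp; apply: cvg_expr.
  by rewrite ger0_norm ?invr_ge0// invf_lt1// ltr1n.
move/cvgrPdist_le : h => /(_ _ e0)[n _ hn]; exists n => k /hn /=.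
by rewrite sub0r normrN => /(le_trans (ler_norm _)).
Qed.

Lemma le_half_pow_eq0 (x K : R) : 0 <= x -> (forall n, x <= K * half_pow R n) -> x = 0.
Proof.
move=> x0 h; apply/eqP; rewrite eq_le x0 andbT leNgt; apply/negP => xp.
have [n hn] := half_pow_small K (divr_gt0 xp (ltr0n R 2)).
by have := h n; have := hn n (leqnn n); move: xp; lra.
Qed.

Lemma sum_half_pow n N : \sum_(k < N) half_pow R (n + k) <= 2 * half_pow R n.
Proof.
have -> : \sum_(k < N) half_pow R (n + k) = half_pow R n * (2 * (1 - half_pow R N)).
  elim: N => [|N IH]; first by rewrite big_ord0 /half_pow expr0 subrr !mulr0.
  by rewrite big_ord_recr/= IH half_powD /half_pow exprS; field.
have h1 := half_pow_gt0 R n; have h2 := half_pow_gt0 R N.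
by rewrite mulrC ler_wpM2r ?(ltW h1)//; lra.
Qed.

(** One term [y ^ k.+1 / k.+1!] of the exponential series, at [y = c 2 ^ n]; any power of the mesh
    is available. *)
Lemma expR_neg_le_pow (c : R) k n : 0 < c ->
  expR (- (c * (2 ^ n)%N%:R)) <= k.+1`!%:R / c ^+ k.+1 * half_pow R (k.+1 * n).
Proof.
move=> c0; set y := c * _; have y0 : 0 < y by rewrite mulr_gt0// ltr0n expn_gt0.
have h := expR_ge1Dxn k (ltW y0); rewrite expRN.
have f0 : 0 < k.+1`!%:R :> R by rewrite ltr0n fact_gt0.
have -> : k.+1`!%:R / c ^+ k.+1 * half_pow R (k.+1 * n) = (y ^+ k.+1 / k.+1`!%:R)^-1.
  rewrite /y exprMn /half_pow natrX -exprM exprVn mulnC invf_div invfM mulrA.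
  by rewrite mulrC.
rewrite lef_pV2 ?posrE ?expR_gt0 ?divr_gt0 ?exprn_gt0//.
by apply: le_trans h; rewrite lerDr.
Qed.

End half_pow_limits.

Section finite_union_bound.
Context {dsp} {Om : measurableType dsp} {R : realType} (P : probability Om R).

Lemma measure_bigsetU_le (I : Type) (s : seq I) (A : I -> set Om) (B : R) :
  (forall i, measurable (A i)) -> (forall i, (P (A i) <= B%:E)%E) ->
  (P (\big[setU/set0]_(i <- s) A i) <= ((size s)%:R * B)%:E)%E.
Proof.
move=> mA AB; elim: s => [|i s IH]; first by rewrite big_nil measure0 mul0r.
rewrite big_cons; apply: le_trans (measureU2 _ _ _) _ => //.
  exact: bigsetU_measurable.
by rewrite /= -natr1 mulrDl mul1r addrC EFinD; apply: leeD.
Qed.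

End finite_union_bound.

Section continuity_along_sequences.
Variables (R : realType) (d : nat).

Definition row_of_tuple (x : d.-tuple R) : 'rV[R]_d := \row_j tnth x j.

Lemma row_of_tupleK (x : d.-tuple R) : [tuple (row_of_tuple x) ord0 j | j < d] = x.
Proof. by apply: eq_from_tnth => j; rewrite tnth_mktuple mxE. Qed.

Lemma continuous_paths_cvg {dsp} {Om : measurableType dsp} (I : set R) (J : set (d.-tuple R))
    (v : R -> d.-tuple R -> Om -> R) w (t_ : nat -> R) (x_ : nat -> d.-tuple R) t x :
  continuous_paths I J v -> I t -> J x -> (forall n, I (t_ n)) -> (forall n, J (x_ n)) ->
  (forall e : R, 0 < e -> exists N, forall n, (N <= n)%N ->
     `|t - t_ n| < e /\ forall j, `|tnth x j - tnth (x_ n) j| < e) ->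
  v (t_ n) (x_ n) w @[n --> \oo] --> v t x w.
Proof.
move=> cv It Jx It_ Jx_ cvg_; have := cv w => /subspace_continuousP h.
have S0 : [set p : R * 'rV[R]_d | I p.1 /\ J [tuple p.2 ord0 j | j < d]] (t, row_of_tuple x).
  by split => //=; rewrite row_of_tupleK.
pose F (p : R * 'rV[R]_d) := v p.1 [tuple p.2 ord0 j | j < d] w.
have {h S0} hc := h _ S0.
have -> : (fun n => v (t_ n) (x_ n) w) = F \o (fun n => (t_ n, row_of_tuple (x_ n))).
  by apply/funext => n /=; rewrite /F/= row_of_tupleK.
have -> : v t x w = F (t, row_of_tuple x) by rewrite /F/= row_of_tupleK.
apply: cvg_comp hc => A /nbhs_ballP[e /= e0 eA].
have [N hN] := cvg_ e e0; exists N => // n /= Nn; have [h1 h2] := hN n Nn.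
apply: eA; last by split => //=; rewrite row_of_tupleK.
split => //=; split => // i j; rewrite ord1 !mxE; exact: h2.
Qed.

End continuity_along_sequences.

(** * Chaining along dyadic grids *)

Section polar_points.
Context {dsp} {Om : measurableType dsp} {R : realType} (P : probability Om R).
Variables (d D : nat) (V : 'I_D -> R -> d.-tuple R -> Om -> R) (t0 T M : R).
Variables (p q r : nat) (al th C : R) (z : D.-tuple R).
Hypotheses (t0T : t0 < T) (M0 : 0 < M) (C0 : 0 < C).
Hypotheses (r2 : (2 <= r)%N) (rp : (r.-1 <= p)%N) (rq : (r.-1 <= q)%N).
Hypotheses (al0 : 0 < al) (th0 : 0 < th) (alp : al * p%:R = 2 * r%:R) (thq : th * q%:R = r%:R).
Hypothesis pqr : (p + d * q + 1 <= r.-1 * D)%N.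

Local Notation J := (@box R d M).
Local Notation point i t x e := [set w | (`|V i t x w - tnth z i| <= e)%R].

Hypothesis mV : forall i t x, t0 <= t <= T -> J x -> measurable_fun setT (V i t x).
Hypothesis V_point : forall t x e, t0 <= t <= T -> J x -> 0 < e ->
  fine (P (\bigcap_i point i t x e)) <= (C * e) ^+ D.
Hypothesis V_increment : forall i t s x y Q u, t0 <= s -> s <= t -> t <= T ->
  J x -> J y -> 0 < Q -> 0 < u ->
  (t - s) `^ al + \sum_j ((tnth x j - tnth y j) ^+ 2) `^ th <= Q ->
  (P [set w | (u + C * (t - s + \sum_j `|tnth x j - tnth y j|) < `|V i t x w - V i s y w|)%R] <=
   (2 * expR (- (u ^+ 2 / (C * Q))))%:E)%E.
Hypothesis V_continuous : forall i, continuous_paths [set` `[t0, T]] J (V i).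

Local Notation half := (half_pow R).
(** By [alp] and [thq], the variance bound between a vertex and its parent is of order
    [2 ^ (- 2 r n)]. The threshold exceeds its square root by a factor of order [2 ^ n]. *)
Let thr n : R := half (r.-1 * n).
Let time n (a : nat) : R := t0 + grid_point (T - t0) p n a.
Let space n (f : 'I_d -> nat) : d.-tuple R := [tuple grid_point M q n (f j) | j < d].
Let grid n : finType := ('I_(2 ^ (p * n)).+1 * {ffun 'I_d -> 'I_(2 ^ (q * n)).+1})%type.

Let L0 : 0 <= T - t0. Proof. by rewrite subr_ge0 ltW. Qed.

Let time_itv n a : (a <= 2 ^ (p * n))%N -> t0 <= time n a <= T.
Proof.
move=> an; have /andP[h1 h2] := grid_point_itv L0 an.
by rewrite /time lerDl h1/= -lerBrDl.
Qed.

Let space_box n f : (forall j, f j <= 2 ^ (q * n))%N -> J (space n f).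
Proof. by move=> fn j; rewrite tnth_mktuple; apply: grid_point_itv => //; exact: ltW. Qed.

Let double_r n : (2 * r * n = 2 * n + r.-1 * n * 2)%N.
Proof. by rewrite -[in LHS](prednK (ltnW r2)) mulnS mulnDl; congr addn; rewrite mulnC [in LHS]mulnA mulnAC mulnC mulnA mulnC mulnCA mulnC. Qed.

(** One for the random part of an increment, the rest for the drift of the mean: a mesh is at most a
    multiple of [thr n] because [r - 1 <= p] and [r - 1 <= q]. *)
Let kap : R := 1 + C * ((T - t0) + d%:R * M).
Let Q0 : R := (T - t0) `^ al + d%:R * (M ^+ 2) `^ th.

Let kap1 : 1 <= kap.
Proof. rewrite lerDl; apply: mulr_ge0; first exact: ltW.
by apply: addr_ge0 => //; apply: mulr_ge0 => //; exact: ltW. Qed.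

Let Q00 : 0 < Q0.
Proof. by rewrite ltr_wpDr ?powR_gt0 ?subr_gt0// mulr_ge0// powR_ge0. Qed.

Let half_powR (e : R) (k m n : nat) : e * k%:R = m%:R -> half (k * n) `^ e = half (m * n).
Proof.
move=> ek; rewrite /half_pow -!powR_mulrn ?invr_ge0// -powRrM !natrM -ek.
by congr (_ `^ _); ring.
Qed.

Let jump n (g : grid n.+1) (i : 'I_D) : set Om :=
  [set w | (kap * thr n < `|V i (time n.+1 g.1) (space n.+1 (fun j => g.2 j)) w -
     V i (time n (g.1 %/ 2 ^ p)) (space n (fun j => g.2 j %/ 2 ^ q)%N) w|)%R].

Let parent_le k n (a : 'I_(2 ^ (k * n.+1)).+1) : (a %/ 2 ^ k <= 2 ^ (k * n))%N.
Proof.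
rewrite -(leq_pmul2r (_ : 0 < 2 ^ k)%N) ?expn_gt0// -expnD addnC -mulnS.
by apply: leq_trans (leq_trunc_div _ _) _; rewrite -ltnS.
Qed.

Let mjump n g i : measurable (@jump n g i).
Proof.
apply: measurable_norm_gt; apply: measurable_funB; apply: mV.
- by apply: time_itv; rewrite -ltnS.
- by apply: space_box => j; rewrite -ltnS.
- by apply: time_itv; exact: parent_le.
- by apply: space_box => j; exact: parent_le.
Qed.

Let jump_le n g i : (P (@jump n g i) <= (2 * expR (- ((C * Q0)^-1 * (2 ^ n)%N%:R)))%:E)%E.
Proof.
set t := time n.+1 g.1; set s := time n (g.1 %/ 2 ^ p).
set x := space n.+1 (fun j => g.2 j); set y := space n (fun j => g.2 j %/ 2 ^ q)%N.
have ts : 0 <= t - s <= (T - t0) * half (p * n).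
  rewrite /t /s /time opprD addrACA subrr add0r; exact: grid_point_parent.
have xy j : 0 <= tnth x j - tnth y j <= M * half (q * n).
  by rewrite !tnth_mktuple; apply: grid_point_parent; exact: ltW.
have /andP[s0 sT] : t0 <= s <= T by apply: time_itv; exact: parent_le.
have /andP[ts0 ts1] := ts; rewrite subr_ge0 in ts0.
have tT : t <= T by have /andP[] : t0 <= t <= T by apply: time_itv; rewrite -ltnS.
have hp k : 0 < half k by exact: half_pow_gt0.
have thr0 : 0 < thr n by exact: hp.
have Qn0 : 0 < Q0 * half (2 * r * n) by rewrite mulr_gt0.
have hQ : (t - s) `^ al + \sum_j ((tnth x j - tnth y j) ^+ 2) `^ th <= Q0 * half (2 * r * n).
  rewrite /Q0 mulrDl; apply: lerD.
    have -> : half (2 * r * n) = half (p * n) `^ al by rewrite (half_powR (m := 2 * r))// natrM.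
    rewrite -powRM ?(ltW (hp _))//; apply: ge0_ler_powR; rewrite ?nnegrE ?(ltW al0)//.
      by rewrite subr_ge0.
    by rewrite mulr_ge0// ltW.
  have E : (M ^+ 2) `^ th * half (2 * r * n) = ((M * half (q * n)) ^+ 2) `^ th.
    rewrite exprMn [in RHS]powRM ?sqr_ge0//; congr (_ * _).
    rewrite expr2 powRM ?(ltW (hp _))// (half_powR _ thq) -half_powD; congr half.
    by rewrite -mulnA mul2n addnn.
  rewrite -mulrA E -[d in X in _ <= X]card_ord mulr_natl -sumr_const.
  apply: ler_sum => j _; have /andP[x0 x1] := xy j.
  apply: ge0_ler_powR; rewrite ?nnegrE ?(ltW th0) ?sqr_ge0// lerXn2r ?nnegrE//.
  by rewrite mulr_ge0 ?ltW.
have := V_increment i s0 ts0 tT (space_box (fun j => _ : (g.2 j <= _)%N)) (space_box (fun j => parent_le (g.2 j))) Qn0 thr0 hQ.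
move=> /(_ (fun j => ltac:(by rewrite -ltnS))) h.
apply: le_trans (le_trans h _).
  apply: le_measure; rewrite ?inE; [exact: mjump| |].
    apply: measurable_norm_gt; apply: measurable_funB; apply: mV.
    + by rewrite tT (le_trans s0).
    + by apply: space_box => j; rewrite -ltnS.
    + by rewrite s0.
    + by apply: space_box => j; exact: parent_le.
  move=> w; apply: le_lt_trans.
  rewrite /kap mulrDl mul1r lerD2l -mulrA ler_wpM2l ?(ltW C0)// mulrDl; apply: lerD.
    by apply: (le_trans ts1); rewrite ler_wpM2l// half_pow_le// leq_mul2r rp orbT.
  rewrite -mulrA -[d in X in _ <= X]card_ord mulr_natl -sumr_const.
  apply: ler_sum => j _; have /andP[x0 x1] := xy j; rewrite ger0_norm//.
  by apply: (le_trans x1); rewrite ler_wpM2l ?(ltW M0)// half_pow_le// leq_mul2r rq orbT.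
rewrite lee_fin ler_wpM2l// ler_expR lerN2.
(* The squared threshold over the variance bound is of order [2 ^ (2 n)], of which [2 ^ n] is
   kept. *)
have e1 : half (2 * r * n) = half (2 * n) * thr n ^+ 2.
  rewrite /thr /half_pow -exprM -exprD; congr (_ ^+ _).
  exact: double_r.
have e2 : (2 ^ (2 * n))%N%:R = (half (2 * n))^-1.
  by apply: (mulfI (_ : half (2 * n) != 0)); rewrite ?half_powK ?divff// gt_eqF.
have -> : thr n ^+ 2 / (C * (Q0 * half (2 * r * n))) = (C * Q0)^-1 * (2 ^ (2 * n))%N%:R.
  by rewrite e2 e1; field; rewrite !gt_eqF.
apply: ler_wpM2l; first by rewrite invr_ge0; apply: mulr_ge0; exact: ltW.
by rewrite ler_nat leq_pexp2l// leq_pmull.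
Qed.

Let k := (p + d * q)%N.

Let card_grid n : #|grid n|%:R <= 2 ^+ d.+1 * (half (k * n))^-1 :> R.
Proof.
have -> : (half (k * n))^-1 = (2 ^ (k * n))%N%:R by rewrite /half_pow exprVn invrK natrX.
rewrite -natrX -natrM ler_nat card_prod card_ffun !card_ord.
have h a : ((2 ^ a).+1 <= 2 ^ a.+1)%N by rewrite expnS mul2n -addnn -[X in (X < _)%N]addn0 ltn_add2l expn_gt0.
apply: (@leq_trans (2 ^ (p * n).+1 * (2 ^ (q * n).+1) ^ d)).
  by apply: leq_mul; [exact: h|case: (d) => // d'; rewrite leq_exp2r].
rewrite -expnM -!expnD; apply: leq_pexp2l => //; rewrite /k; lia.
Qed.

Let jumps n : set Om := \big[setU/set0]_(gi <- enum {: (grid n.+1 * 'I_D)%type}) jump gi.1 gi.2.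

Let mjumps n : measurable (jumps n).
Proof. by apply: bigsetU_measurable => gi _; exact: mjump. Qed.

(** The grid has of order [2 ^ (k n)] vertices; the tail is used as a power [k.+1] of the mesh,
    which leaves a summable [2 ^ (- n)]. *)
Let jumps_le : exists2 K : R, 0 <= K & forall n, (P (jumps n) <= (K * half n)%:E)%E.
Proof.
set c := (C * Q0)^-1; have c0 : 0 < c by rewrite invr_gt0 mulr_gt0.
set K1 := k.+1`!%:R / c ^+ k.+1.
have K10 : 0 <= K1 by rewrite divr_ge0// exprn_ge0// ltW.
have hp m : 0 < half m by exact: half_pow_gt0.
exists (2 ^+ d.+1 * (half k)^-1 * D%:R * 2 * K1).
  apply: mulr_ge0 => //; apply: mulr_ge0 => //; apply: mulr_ge0 => //.
  by apply: mulr_ge0; [exact: exprn_ge0|rewrite invr_ge0 ltW].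
move=> n; apply: le_trans (measure_bigsetU_le _ (fun gi => mjump gi.1 gi.2) (fun gi => jump_le gi.1 gi.2)) _.
rewrite lee_fin -cardE card_prod card_ord natrM.
apply: (@le_trans _ _ (2 ^+ d.+1 * (half (k * n.+1))^-1 * D%:R * (2 * (K1 * half (k.+1 * n))))).
  apply: ler_pM => //; rewrite ?mulr_ge0 ?expR_ge0//.
    by rewrite ler_wpM2r.
  by rewrite ler_wpM2l// expR_neg_le_pow.
rewrite mulnS mulSn !half_powD le_eqVlt; apply/orP; left; apply/eqP.
by field; rewrite !gt_eqF.
Qed.

Let hits n : set Om := \big[setU/set0]_(g <- enum (grid n))
  \bigcap_i point i (time n g.1) (space n (fun j => g.2 j)) (2 * kap * thr n).

Let mhits1 n (g : grid n) :
  measurable (\bigcap_i point i (time n g.1) (space n (fun j => g.2 j)) (2 * kap * thr n)).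
Proof.
apply: fin_bigcap_measurable => // i _; apply: measurable_ball; apply: mV.
  by apply: time_itv; rewrite -ltnS.
by apply: space_box => j; rewrite -ltnS.
Qed.

Let mhits n : measurable (hits n).
Proof. by apply: bigsetU_measurable => g _; exact: mhits1. Qed.

(** The summand [1] in [pqr] is what leaves the factor [2 ^ (- n)] after the union over all
    vertices. *)
Let hits_le : exists2 K : R, 0 <= K & forall n, (P (hits n) <= (K * half n)%:E)%E.
Proof.
have hp m : 0 < half m by exact: half_pow_gt0.
have kap0 : 0 < kap by exact: lt_le_trans kap1.
have K0 : 0 <= C * (2 * kap) by rewrite mulr_ge0 ?mulr_ge0 ?ltW.
exists (2 ^+ d.+1 * (C * (2 * kap)) ^+ D); first by rewrite mulr_ge0// exprn_ge0.
move=> n; have h g : (P (\bigcap_i point i (time n (g : grid n).1) (space n (fun j => g.2 j)) (2 * kap * thr n)) <=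
    ((C * (2 * kap) * thr n) ^+ D)%:E)%E.
  rewrite -[X in (X <= _)%E]fineK; last by rewrite fin_num_measure//; exact: mhits1.
  rewrite lee_fin (_ : C * (2 * kap) * thr n = C * (2 * kap * thr n)); last by ring.
  apply: V_point.
  - by apply: time_itv; rewrite -ltnS.
  - by apply: space_box => j; rewrite -ltnS.
  - by apply: mulr_gt0; [exact: mulr_gt0|exact: hp].
apply: le_trans (measure_bigsetU_le _ (@mhits1 n) h) _.
rewrite lee_fin -cardE exprMn.
have thrD : thr n ^+ D <= half (k * n) * half n.
  rewrite -half_powD /thr /half_pow -exprM.
  rewrite [leLHS](_ : _ = half (r.-1 * n * D))// half_pow_le//.
  by rewrite -mulSnr -addn1 mulnAC leq_mul2r pqr orbT.
apply: (@le_trans _ _ (2 ^+ d.+1 * (half (k * n))^-1 * ((C * (2 * kap)) ^+ D * (half (k * n) * half n)))).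
  apply: ler_pM => //; first by rewrite mulr_ge0 ?exprn_ge0// ltW.
  by rewrite ler_wpM2l// exprn_ge0.
rewrite le_eqVlt; apply/orP; left; apply/eqP.
by field; rewrite !gt_eqF.
Qed.

Let cover n : set Om := hits n `|` \bigcup_m jumps (n + m).

Let mcover n : measurable (cover n).
Proof. by apply: measurableU => //; exact: bigcup_measurable. Qed.

Let cover_le : exists2 K : R, 0 <= K & forall n, (P (cover n) <= (K * half n)%:E)%E.
Proof.
have [K K0 hK] := hits_le; have [K' K'0 hK'] := jumps_le.
exists (K + K' * 2); first by rewrite addr_ge0// mulr_ge0.
move=> n; apply: le_trans (measureU2 _ _ _) _ => //; first exact: bigcup_measurable.
rewrite mulrDl EFinD; apply: leeD; first exact: hK.
have mF m : measurable (jumps (n + m)) by [].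
apply: le_trans (measure_sigma_subadditive P mF (bigcup_measurable (fun m _ => mF m)) (@subset_refl _ _)) _.
apply: lime_le; first by apply: is_cvg_nneseries.
apply: nearW => N; rewrite big_mkord.
apply: (@le_trans _ _ (\sum_(m < N) (K' * half (n + m))%:E)%E); first by apply: lee_sum => m _; exact: hK'.
by rewrite sumEFin lee_fin -mulr_sumr -mulrA ler_wpM2l// sum_half_pow.
Qed.

(** The thresholds decrease geometrically, as [r - 1 >= 1]; their sum explains the radius
    [2 * kap * thr n] in [hits]. *)
Let chain (f : nat -> R) n N : (forall m, (m < N)%N -> `|f m.+1 - f m| <= kap * thr (n + m)) ->
  `|f N - f 0%N| <= 2 * kap * thr n.
Proof.
move=> h; have kap0 : 0 < kap by exact: lt_le_trans kap1.
apply: (@le_trans _ _ (\sum_(m < N) (kap * thr (n + m)))).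
  elim: N h => [|N IH] h; first by rewrite big_ord0 subrr normr0.
  rewrite big_ord_recr/= (_ : f N.+1 - f 0%N = (f N - f 0%N) + (f N.+1 - f N)); last by ring.
  apply: le_trans (ler_normD _ _) _; apply: lerD; last exact: h.
  by apply: IH => m mN; apply: h; exact: ltnW.
rewrite -mulr_sumr [2 * kap]mulrC -mulrA ler_wpM2l ?(ltW kap0)//.
apply: le_trans (sum_half_pow R (r.-1 * n) N); apply: ler_sum => m _.
rewrite /thr half_pow_le// mulnDr leq_add2l leq_pmull//.
by rewrite -ltnS prednK// ltnW.
Qed.

(** A point where the target is attained is approached along its own roundings. Without a jump from
    level [n] on, the values along the chain stay near the one at level [n], and continuity
    identifies their limit as [z]. *)
Let target_cover n : [set w | exists p0 : R * d.-tuple R,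
    [/\ t0 <= p0.1 <= T, J p0.2 & forall i, V i p0.1 p0.2 w = tnth z i]] `<=` cover n.
Proof.
move=> w [[t x] [/= tT xJ Vz]]; have [jw|njw] := pselect ((\bigcup_m jumps (n + m)) w); [by right|left].
have /andP[t1 t2] := tT.
have L1 : 0 < T - t0 by rewrite subr_gt0.
have tp : 0 <= t - t0 by rewrite subr_ge0.
have tpT : t - t0 <= T - t0 by rewrite lerD2r.
have xp j : 0 <= tnth x j by have /andP[] := xJ j.
have xpM j : tnth x j <= M by have /andP[] := xJ j.
pose a m := grid_index (T - t0) p m (t - t0).
pose b m j := grid_index M q m (tnth x j).
have aP m : (a m <= 2 ^ (p * m))%N by exact: grid_index_le.
have bP m j : (b m j <= 2 ^ (q * m))%N by exact: grid_index_le.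
have step i m : `|V i (time (n + m).+1 (a (n + m).+1)) (space (n + m).+1 (b (n + m).+1)) w -
    V i (time (n + m) (a (n + m)%N)) (space (n + m) (b (n + m)%N)) w| <= kap * thr (n + m).
  rewrite leNgt; apply/negP => hj; apply: njw; exists m => //.
  pose g : grid (n + m).+1 := (inord (a (n + m).+1), [ffun j => inord (b (n + m).+1 j)]).
  rewrite /jumps -bigcup_seq; exists (g, i) => /=; first by rewrite mem_enum.
  have g1 : g.1 = a (n + m).+1 :> nat by rewrite inordK// ltnS.
  have g2 j : g.2 j = b (n + m).+1 j :> nat by rewrite ffunE inordK// ltnS.
  rewrite /jump /= g1 (_ : (fun j => (g.2 j : nat)) = b (n + m).+1); last by apply/funext => j; rewrite g2.
  rewrite (_ : (fun j => (g.2 j %/ 2 ^ q)%N) = b (n + m)%N); last first.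
    by apply/funext => j; rewrite g2 /b grid_index_parent.
  by rewrite {2}/a grid_index_parent.
have close i : `|V i (time n (a n)) (space n (b n)) w - tnth z i| <= 2 * kap * thr n.
  pose f m := V i (time (n + m) (a (n + m)%N)) (space (n + m) (b (n + m)%N)) w.
  have f0 : f 0%N = V i (time n (a n)) (space n (b n)) w by rewrite /f addn0.
  have fl N : `|f N - f 0%N| <= 2 * kap * thr n.
    by apply: chain => m _; rewrite /f addnS; exact: step.
  have fc : f m @[m --> \oo] --> tnth z i.
    rewrite -(Vz i); apply: (continuous_paths_cvg (@V_continuous i)) => //=.
    - by move=> m; rewrite in_itv/=; exact: time_itv.
    - by move=> m; apply: space_box => j; exact: bP.
    move=> e e0.
    have [N1 h1] := half_pow_small (T - t0) (divr_gt0 e0 (ltr0n R 2)).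
    have [N2 h2] := half_pow_small M (divr_gt0 e0 (ltr0n R 2)).
    have e2 : e / 2 < e by rewrite ltr_pdivrMr// ltr_pMr// ltr1n.
    have p0 : (0 < p)%N by apply: leq_trans rp; rewrite -ltnS prednK// ltnW.
    have q0 : (0 < q)%N by apply: leq_trans rq; rewrite -ltnS prednK// ltnW.
    exists (N1 + N2)%N => m Nm; split=> [|j].
      have := grid_index_dist p (n + m) L1 tp.
      rewrite -/(a _) /time opprD addrA => /le_lt_trans; apply; apply: le_lt_trans e2.
      by apply: h1; apply: leq_trans (leq_pmull _ p0); exact: leq_trans (leq_trans (leq_addr N2 N1) Nm) (leq_addl n m).
    rewrite tnth_mktuple; have := grid_index_dist q (n + m) M0 (xp j).
    move=> /le_lt_trans; apply; apply: le_lt_trans e2.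
    by apply: h2; apply: leq_trans (leq_pmull _ q0); exact: leq_trans (leq_trans (leq_addl N1 N2) Nm) (leq_addl n m).
  rewrite -f0 distrC.
  have fc' : `|f m - f 0%N| @[m --> \oo] --> `|tnth z i - f 0%N|.
    by apply: cvg_norm; apply: cvgB => //; exact: cvg_cst.
  rewrite -(cvg_lim _ fc')//; apply: limr_le; first by apply/cvg_ex; eexists; exact: fc'.
  by apply: nearW.
pose g : grid n := (inord (a n), [ffun j => inord (b n j)]).
rewrite /hits -bigcup_seq; exists g => /=; first by rewrite mem_enum.
have g1 : g.1 = a n :> nat by rewrite inordK// ltnS.
have g2 : (fun j => (g.2 j : nat)) = b n by apply/funext => j; rewrite ffunE inordK// ltnS.
by move=> i _ /=; rewrite g1 g2; exact: close.
Qed.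

Theorem polar_point : polar P [set` `[t0, T]] J (fun t x w => [tuple V i t x w | i < D]) [set z].
Proof.
have [K K0 hK] := cover_le.
exists (\bigcap_n cover n); split.
- exact: bigcap_measurable.
- have mI : measurable (\bigcap_n cover n) by exact: bigcap_measurable.
  have fin : P (\bigcap_n cover n) \is a fin_num by rewrite fin_num_measure.
  have e : fine (P (\bigcap_n cover n)) = 0.
    apply: (@le_half_pow_eq0 _ _ K) => [|n]; first exact: fine_ge0.
    rewrite -lee_fin fineK//; apply: le_trans (hK n).
    by apply: le_measure; rewrite ?inE//; exact: bigcap_inf.
  by rewrite -[LHS]fineK// e.
- move=> w [y [[[t x] [/= tT xJ] <-] zE]] n _; apply: target_cover.
  rewrite in_itv/= in tT; exists (t, x); split => //= i.
  by rewrite -zE tnth_mktuple.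
Qed.

End polar_points.

(** * Nonpolarity of points *)

Section second_moment.
Context {dsp} {Om : measurableType dsp} {R : realType} (P : probability Om R).

Lemma second_moment (I : finType) (E : I -> set Om) (S1 S2 : R) :
  (forall i, measurable (E i)) -> 0 < S1 -> 0 < S2 ->
  S1 <= \sum_i fine (P (E i)) ->
  \sum_i \sum_j fine (P (E i `&` E j)) <= S2 ->
  S1 ^+ 2 / S2 <= fine (P (\big[setU/set0]_(i <- enum I) E i)).
Proof.
move=> mE S10 S20 h1 h2; set U := \big[setU/set0]_(i <- _) _.
have mU : measurable U by exact: bigsetU_measurable.
have int1 (A : set Om) : measurable A -> P.-integrable setT (EFin \o (\1_A : Om -> R)).
  move=> mA; apply: (@bounded_integrable _ _ _ P _ 1); first exact: measurable_indic.
  by move=> w; rewrite indicE; case: (_ \in _); rewrite ?normr1 ?normr0.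
pose Z (w : Om) : R := \sum_(i <- enum I) \1_(E i) w.
have iZ : P.-integrable setT (EFin \o Z) by apply: integrable_sum_real => // i; exact: int1.
have ZE : \int[P]_w Z w = \sum_i fine (P (E i)).
  rewrite Rintegral_sum//; last by move=> i; exact: int1.
  by rewrite big_enum; apply: eq_bigr => i _; exact: Rintegral_indic_prob.
have ZZ w : Z w ^+ 2 = \sum_(i <- enum I) \sum_(j <- enum I) \1_(E i `&` E j) w.
  rewrite expr2 {1}/Z mulr_suml; apply: eq_bigr => i _; rewrite /Z mulr_sumr.
  by apply: eq_bigr => j _; rewrite indicI.
have iZZ : P.-integrable setT (EFin \o (fun w => Z w ^+ 2)).
  rewrite (_ : (fun w => Z w ^+ 2) = fun w => \sum_(i <- enum I) \sum_(j <- enum I) \1_(E i `&` E j) w); last exact/funext.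
  by apply: integrable_sum_real => // i; apply: integrable_sum_real => // j; apply: int1; exact: measurableI.
have ZZE : \int[P]_w Z w ^+ 2 = \sum_i \sum_j fine (P (E i `&` E j)).
  under eq_Rintegral do rewrite ZZ.
  rewrite Rintegral_sum//; last first.
    by move=> i; apply: integrable_sum_real => // j; apply: int1; exact: measurableI.
  rewrite big_enum; apply: eq_bigr => i _.
  rewrite Rintegral_sum//; last by move=> j; apply: int1; exact: measurableI.
  by rewrite big_enum; apply: eq_bigr => j _; apply: Rintegral_indic_prob; exact: measurableI.
(* [1_(Z > 0) >= 2 l Z - l ^ 2 Z ^ 2], optimized in [l] *)
set l := S1 / S2; have l0 : 0 < l by rewrite divr_gt0.
have h3 : \int[P]_w (2 * l * Z w - l ^+ 2 * Z w ^+ 2) <= \int[P]_w \1_U w.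
  apply: le_Rintegral => //.
  - exact: (integrableB measurableT (integrableZl measurableT (2 * l) iZ) (integrableZl measurableT (l ^+ 2) iZZ)).
  - exact: int1.
  move=> w _; rewrite indicE; have [Uw|Uw] := boolP (w \in U).
    by rewrite -[leRHS]/(1 : R); have := sqr_ge0 (l * Z w - 1); lra.
  have -> : Z w = 0; last by rewrite expr0n/= !mulr0 subrr.
  rewrite /Z big1_seq// => i /andP[_ iI]; rewrite indicE memNset// => Ew.
  by move/negP: Uw; apply; rewrite inE /U -bigcup_seq; exists i.
move: h3; rewrite Rintegral_indic_prob// RintegralB//; last 2 first.
- exact: (integrableZl measurableT (2 * l) iZ).
- exact: (integrableZl measurableT (l ^+ 2) iZZ).
rewrite !RintegralZl// ZE ZZE; apply: le_trans.
apply: (@le_trans _ _ (2 * l * S1 - l ^+ 2 * S2)).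
  by rewrite /l le_eqVlt; apply/orP; left; apply/eqP; field; rewrite gt_eqF.
apply: lerB; first by rewrite ler_wpM2l// mulr_ge0// ltW.
by rewrite ler_wpM2l// sqr_ge0.
Qed.

End second_moment.

(** * Discrete energies *)

Section energy.
Variable R : realType.
Implicit Types (th x : R).

(** Bernoulli's inequality for a concave power, from Young's inequality for the product of
    [(1 - x) ^ a] and [1] with exponents [1 / a] and [1 / (1 - a)]. *)
Lemma powR_one_sub_le (a x : R) : 0 < a -> a < 1 -> 0 <= x -> x <= 1 -> (1 - x) `^ a <= 1 - a * x.
Proof.
move=> a0 a1 x0 x1; have y0 : 0 <= 1 - x by rewrite subr_ge0.
have a10 : 0 < 1 - a by rewrite subr_gt0.
have := @conjugate_powR R ((1 - x) `^ a) 1 a^-1 (1 - a)^-1 (powR_ge0 _ _) ler01.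
rewrite invr_gt0 => /(_ a0); rewrite invr_gt0 => /(_ a10); rewrite !invrK.
rewrite addrC subrK => /(_ erefl); rewrite mulr1 -powRrM divff ?gt_eqF// powRr1// powR1 mul1r.
by move/le_trans; apply; lra.
Qed.

(** The comparison with the integral of [x ^ (- th)], by induction; the step is Bernoulli's
    inequality at [1 / (n + 1)]. *)
Lemma sum_powR_le th n : 0 < th -> th < 1 ->
  \sum_(k < n) (1 + k%:R) `^ (- th) <= n%:R `^ (1 - th) / (1 - th) :> R.
Proof.
move=> th0 th1; have t0 : 0 < 1 - th by rewrite subr_gt0.
elim: n => [|n IH]; first by rewrite big_ord0 divr_ge0 ?powR_ge0// ltW.
rewrite big_ord_recr/=; apply: le_trans (lerD IH (lexx _)) _.
have n0 : 0 < n.+1%:R :> R by rewrite ltr0n.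
have e1 : n%:R `^ (1 - th) = n.+1%:R `^ (1 - th) * (1 - n.+1%:R^-1) `^ (1 - th) :> R.
  have n1 : 0 <= 1 - n.+1%:R^-1 :> R by rewrite subr_ge0 invf_le1// ler1n.
  rewrite -powRM ?(ltW n0)//; congr (_ `^ _).
  by rewrite mulrBr mulr1 divff ?gt_eqF// -natr1 addrK.
have e2 : (1 + n%:R) `^ (- th) = n.+1%:R `^ (1 - th) * n.+1%:R^-1 :> R.
  rewrite addrC natr1 -[_^-1]powR_inv1 ?(ltW n0)// -powRD; last by rewrite (gt_eqF n0) implybT.
  by congr (_ `^ _); ring.
rewrite e1 e2 ler_pdivlMr// mulrDl divfK ?gt_eqF// -mulrA -mulrDr.
rewrite -[leRHS]mulr1 ler_wpM2l ?powR_ge0//.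
have := @powR_one_sub_le (1 - th) n.+1%:R^-1 t0.
rewrite ltrBlDr ltrDl th0 => /(_ isT); rewrite invr_ge0 ler0n => /(_ isT).
by rewrite invf_le1// ler1n => /(_ isT); rewrite [X in _ -> _ + X <= _]mulrC -lerBrDr.
Qed.

Definition ndist (a b : nat) : nat := (a - b + (b - a))%N.

Lemma ndistE a b : `|a%:R - b%:R| = (ndist a b)%:R :> R.
Proof.
rewrite /ndist; have [ab|/ltnW ab] := leqP a b.
  by rewrite ler0_norm ?subr_le0 ?ler_nat// opprB -natrB// (eqP ab) add0n.
by rewrite ger0_norm ?subr_ge0 ?ler_nat// -natrB// (eqP ab) addn0.
Qed.

Lemma ndist_leq a b n : (a < n)%N -> (b < n)%N -> (ndist a b <= n)%N.
Proof. by rewrite /ndist; lia. Qed.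

(** A distance to [a] occurs at most twice, once on either side. *)
Lemma sum_ndist_le (f : nat -> R) (a n : nat) : (forall k, 0 <= f k) -> (a < n)%N ->
  \sum_(b < n) f (ndist a b) <= 2 * \sum_(k < n) f k.
Proof.
move=> f0 an; rewrite -(big_mkord xpredT (fun b => f (ndist a b))) -(big_mkord xpredT f).
rewrite (big_cat_nat (n := a) (leq0n a) (ltnW an))/= mulr_natl mulr2n.
have mono m : (m <= n)%N -> \sum_(0 <= k < m) f k <= \sum_(0 <= k < n) f k.
  by move=> mn; rewrite [leRHS](big_cat_nat (leq0n m) mn)/= lerDl sumr_ge0.
apply: lerD.
  apply: le_trans (mono a.+1 an).
  rewrite big_nat_rev/= add0n [leRHS]big_nat_recl//= -[leLHS]add0r; apply: lerD => //.
  rewrite !big_nat; apply: ler_sum => k /andP[_ ka]; rewrite /ndist.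
  by rewrite subKn// (_ : (a - k.+1 - a = 0)%N) ?addn0//; lia.
apply: le_trans (mono (n - a)%N (leq_subr _ _)).
rewrite -{1}[a]add0n big_addn; apply: ler_sum => k _.
by rewrite /ndist addnK (_ : (a - (k + a) = 0)%N)//; lia.
Qed.

Lemma energy_le th n a : 0 < th -> th < 1 -> (a < n)%N ->
  \sum_(b < n) (1 + (ndist a b)%:R) `^ (- th) <= 2 / (1 - th) * n%:R `^ (1 - th) :> R.
Proof.
move=> th0 th1 an.
apply: le_trans (sum_ndist_le (f := fun k => (1 + k%:R) `^ (- th)) _ an) _.
  by move=> k; exact: powR_ge0.
by rewrite mulrAC -mulrA ler_wpM2l// sum_powR_le.
Qed.

End energy.

Section compact_target.
Variables (R : realType) (d D : nat).
Context {dsp} {Om : measurableType dsp}.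
Variables (V : 'I_D -> R -> d.-tuple R -> Om -> R) (t0 T M : R) (z : D.-tuple R) (w : Om).
Hypothesis V_continuous : forall i, continuous_paths [set` `[t0, T]] (@box R d M) (V i).

(** The total distance to [z] is continuous on a compact set, so its range is closed and contains
    [0] as soon as it contains arbitrarily small values. *)
Lemma compact_target : (forall e : R, 0 < e -> exists t x,
    [/\ t0 <= t <= T, box M x & forall i, `|V i t x w - tnth z i| <= e]) ->
  exists t x, [/\ t0 <= t <= T, box M x & forall i, V i t x w = tnth z i].
Proof.
move=> h.
pose S := [set p : R * 'rV[R]_d | [set` `[t0, T]] p.1 /\ box M [tuple p.2 ord0 j | j < d]].
pose F i (p : R * 'rV[R]_d) := V i p.1 [tuple p.2 ord0 j | j < d] w.
pose phi (p : R * 'rV[R]_d) : R := \sum_(i < D) `|F i p - tnth z i|.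
have cS : compact S.
  have -> : S = [set` `[t0, T]] `*` [set v : 'rV[R]_d | forall j, [set` `[0, M]] (v ord0 j)].
    apply/seteqP; split=> [p [p1 p2]|p [p1 p2]]; split => //= j.
      by have := p2 j; rewrite tnth_mktuple in_itv.
    by have := p2 j; rewrite tnth_mktuple /= in_itv.
  apply: compact_setX; first exact: segment_compact.
  by apply: (@rV_compact R d (fun=> [set` `[0, M]])) => j; exact: segment_compact.
have cphi : {within S, continuous phi}.
  apply/subspace_continuousP => p Sp; apply: cvg_big => [|i _]; first exact: add_continuous.
  apply: cvg_norm; apply: cvgB; last exact: cvg_cst.
  by have /subspace_continuousP := @V_continuous i w; apply.
have clphi : closed (phi @` S).
  by apply: compact_closed; [exact: Rhausdorff|exact: continuous_compact].
have [p Sp phi0] : (phi @` S) 0.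
  apply: clphi => A /nbhs_ballP[e /= e0 eA].
  (* With [D.+1] in place of [D], the [D] errors sum to strictly less than [e], also when
     [D = 0]. *)
  have D0 : 0 < D.+1%:R :> R by rewrite ltr0n.
  have [t [x [tT xJ Vz]]] := h (e / D.+1%:R) (divr_gt0 e0 D0).
  exists (phi (t, row_of_tuple x)); split.
    by exists (t, row_of_tuple x) => //; split => /=; rewrite ?in_itv// row_of_tupleK.
  apply: eA; rewrite /ball/= sub0r normrN ger0_norm; last by apply: sumr_ge0.
  apply: (@le_lt_trans _ _ (\sum_(i < D) (e / D.+1%:R))).
    by apply: ler_sum => i _; rewrite /F /= row_of_tupleK.
  rewrite sumr_const card_ord -[_ *+ D]mulr_natl mulrCA gtr_pMr//.
  by rewrite ltr_pdivrMr// mul1r ltr_nat.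
case: Sp => p1 p2; rewrite /= in_itv/= in p1.
exists p.1, [tuple p.2 ord0 j | j < d]; split => // i; apply/eqP; rewrite -subr_eq0 -normr_eq0.
have /eqP := phi0; rewrite psumr_eq0//; first by move=> /allP/(_ i (mem_index_enum _)).
Qed.

End compact_target.

Section limsup_event.
Context {dsp} {Om : measurableType dsp} {R : realType} (P : probability Om R).

(** Every tail union has probability at least [p0], and this passes to their decreasing
    intersection. *)
Lemma limsup_not_negligible (U : nat -> set Om) (p0 : R) : 0 < p0 ->
  (forall n, measurable (U n)) -> (forall n, p0 <= fine (P (U n))) ->
  ~ P.-negligible (\bigcap_n \bigcup_m U (n + m)%N).
Proof.
move=> p00 mU hU [N [mN PN sub]].
pose F n := \bigcup_m U (n + m)%N.
have mF n : measurable (F n) by exact: bigcup_measurable.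
have mI : measurable (\bigcap_n F n) by exact: bigcap_measurable.
have niF : nonincreasing_seq F.
  move=> n m nm; apply/subsetPset => w [k _ Uk]; exists (m - n + k)%N => //.
  by rewrite addnA subnKC.
have F0 : (P (F 0%N) < +oo)%E by rewrite -ge0_fin_numE// fin_num_measure.
have cv := nonincreasing_cvg_mu F0 mF mI niF.
have I0 : P (\bigcap_n F n) = 0%E.
  by apply/eqP; rewrite eq_le measure_ge0 andbT -PN le_measure ?inE.
have lim0 : limn (P \o F) = 0%E by rewrite -I0; exact/cvg_lim.
have : (p0%:E <= limn (P \o F))%E.
  apply: lime_ge; first by apply/cvg_ex; eexists; exact: cv.
  apply: nearW => n /=; apply: (@le_trans _ _ (P (U n))).
    by rewrite -[leRHS]fineK ?fin_num_measure// lee_fin.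
  by apply: le_measure; rewrite ?inE// => w Uw; exists 0%N => //; rewrite addn0.
by rewrite lim0 lee_fin leNgt p00.
Qed.

End limsup_event.

(** * Counting hits on a grid with parabolic scaling *)

Section nonpolar_points.
Context {dsp} {Om : measurableType dsp} {R : realType} (P : probability Om R).
Variables (d D : nat) (V : 'I_D -> R -> d.-tuple R -> Om -> R) (t0 T M : R).
Variables (c C k : R) (z : D.-tuple R).
Hypotheses (t00 : 0 < t0) (t0T : t0 < T) (M0 : 0 < M) (c0 : 0 < c) (C0 : 0 < C) (k0 : 0 < k).
Hypotheses (d0 : (0 < d)%N) (d4 : (d < 4)%N) (D0 : (0 < D)%N).
Hypothesis subcritical : ((4 - d) * D < 2 * (4 + d))%N.

Local Notation J := (@box R d M).
Local Notation point i t x e := [set w | (`|V i t x w - tnth z i| <= e)%R].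

Hypothesis mV : forall i t x, t0 <= t <= T -> J x -> measurable_fun setT (V i t x).
Hypothesis V_point : forall t x e, t0 <= t <= T -> J x -> 0 < e -> e <= 1 ->
  (c * e) ^+ D <= fine (P (\bigcap_i point i t x e)).
Hypothesis V_two_points : forall t s x y e rho, t0 <= s <= T -> t0 <= t <= T ->
  J x -> J y -> 0 < e -> 0 <= rho -> rho <= 2^-1 -> 2 * rho ^+ 4 <= t0 ->
  (`|t - s| = rho ^+ 4 \/ exists2 j, `|tnth x j - tnth y j| = rho & `|t - s| <= rho ^+ 4) ->
  fine (P (\bigcap_i (point i t x e `&` point i s y e))) <=
  (C * (e ^+ 2 / Num.sqrt (e ^+ 2 + k * rho ^+ (4 - d)))) ^+ D.
Hypothesis V_continuous : forall i, continuous_paths [set` `[t0, T]] J (V i).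

Let m := (4 - d)%N.
Let m0 : (0 < m)%N. Proof. by rewrite /m subn_gt0. Qed.

(** The singularity of the two-point bound, of order [(4 - d) D / 2], is distributed evenly
    over the space directions and time, the latter counting for four. *)
Let th : R := m%:R * D%:R / (2 * (4 + d)%:R).

Let th0 : 0 < th.
Proof. by rewrite divr_gt0 ?mulr_gt0 ?ltr0n. Qed.

Let th1 : th < 1.
Proof. by rewrite ltr_pdivrMr ?mulr_gt0 ?ltr0n// mul1r -!natrM ltr_nat. Qed.

(** Side of a box in which the two-point estimate applies to all pairs. *)
Let side_ex : exists2 h : R, 0 < h & [/\ h <= 2^-1, 2 * h ^+ 4 <= t0, h ^+ 4 <= T - t0 & h <= M].
Proof.
pose h := Num.min (Num.min 2^-1 M) (Num.min (t0 / 2) (T - t0)).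
have h0 : 0 < h by rewrite !lt_min invr_gt0 ltr0n M0/= divr_gt0//= subr_gt0.
have h1 : h <= 2^-1 by rewrite !ge_min lexx.
have h4 : h ^+ 4 <= h.
  rewrite -[leRHS]mulr1 exprS ler_wpM2l ?(ltW h0)// expr_le1// ?(ltW h0)//.
  by apply: (le_trans h1); lra.
exists h => //; split => //.
- have : h <= t0 / 2 by rewrite !ge_min lexx !orbT.
  by move: h4; lra.
- by apply: (le_trans h4); rewrite !ge_min lexx !orbT.
- by rewrite !ge_min lexx !orbT.
Qed.

Section grid.
Variable h : R.
Hypotheses (h0 : 0 < h) (h1 : h <= 2^-1) (ht0 : 2 * h ^+ 4 <= t0) (hT : h ^+ 4 <= T - t0) (hM : h <= M).
Variable N : nat.
Hypothesis N0 : (0 < N)%N.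

Let NR0 : 0 < N%:R :> R. Proof. by rewrite ltr0n. Qed.

Definition grid : finType := ('I_(N ^ 4) * {ffun 'I_d -> 'I_N})%type.
Definition gtime (g : grid) : R := t0 + (h / N%:R) ^+ 4 * g.1%:R.
Definition gspace (g : grid) : d.-tuple R := [tuple h / N%:R * (g.2 j)%:R | j < d].
(** Chosen so that [radius ^ 2] is comparable to the lower bound [k * rho ^ m] at one mesh,
    [rho = h / N]: a smaller [rho] does not occur between distinct vertices. *)
Definition radius : R := N%:R `^ (- (m%:R / 2)).
Definition hit (g : grid) : set Om := \bigcap_i point i (gtime g) (gspace g) radius.

Let hN0 : 0 < h / N%:R. Proof. by rewrite divr_gt0. Qed.

Lemma gtime_itv g : t0 <= gtime g <= T.
Proof.
rewrite /gtime lerDl mulr_ge0 ?exprn_ge0 ?(ltW hN0)//= -lerBrDl.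
apply: le_trans hT; rewrite expr_div_n -mulrA ler_piMr ?exprn_ge0 ?(ltW h0)//.
rewrite mulrC ler_pdivrMr ?exprn_gt0// mul1r -natrX ler_nat ltnW//.
Qed.

Lemma gspace_box g : J (gspace g).
Proof.
move=> j; rewrite tnth_mktuple mulr_ge0 ?(ltW hN0)//=.
apply: le_trans hM; rewrite -mulrA ler_piMr ?(ltW h0)//.
by rewrite mulrC ler_pdivrMr// mul1r ler_nat ltnW.
Qed.

Lemma radius_gt0 : 0 < radius.
Proof. exact: powR_gt0. Qed.

Lemma radius_sqr : radius ^+ 2 = (N%:R ^+ m)^-1.
Proof.
rewrite -powR_mulrn ?powR_ge0// -powRrM -powR_mulrn ?(ltW NR0)// -powRN.
by congr (_ `^ _); field.
Qed.

Lemma radius_le1 : radius <= 1.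
Proof.
rewrite /radius powRN invf_le1 ?powR_gt0//.
have N1 : 1 <= N%:R :> R by rewrite ler1n.
by have := @ler_powR R N%:R N1 0 (m%:R / 2); rewrite powRr0; apply; rewrite divr_ge0.
Qed.

(** With [card_grid], the number of vertices times [radius ^ D] is [N ^ ((4 + d) (1 - th))], which
    is also the order of the energy of one vertex: [1 - th] for each direction, time counting for
    four. *)
Lemma radiusX : radius ^+ D = N%:R `^ (- ((4 + d)%:R * th)).
Proof.
rewrite -powR_mulrn ?powR_ge0// -powRrM; congr (_ `^ _).
have : (4 + d)%:R != 0 :> R by rewrite pnatr_eq0.
by rewrite /th; move: (4 + d)%:R => a a0; field.
Qed.

Lemma measurable_hit g : measurable (hit g).
Proof.
apply: fin_bigcap_measurable => // i _; apply: measurable_ball; apply: mV.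
  exact: gtime_itv.
exact: gspace_box.
Qed.

(** A product over time and coordinates, so that its sum over the grid factors into one-dimensional
    energies. *)
Let weight (g g' : grid) : R :=
  (1 + (ndist g.1 g'.1)%:R) `^ (- th) * \prod_j (1 + (ndist (g.2 j) (g'.2 j))%:R) `^ (- th).

(** Makes [radius ^ 2 + k rho ^ m] at least [radius ^ 2 * k1 * (1 + X) ^ m] when [rho = (h / N) X],
    through [(1 + X) ^ m <= 2 ^ m (1 + X ^ m)]. *)
Let k1 : R := Num.min 1 (k * h ^+ m) / 2 ^+ m.
Let k10 : 0 < k1.
Proof. by rewrite divr_gt0 ?exprn_gt0// lt_min ltr01 mulr_gt0// exprn_gt0. Qed.

Let K1 : R := (C / Num.sqrt k1) ^+ D.

(** The two-point bound decays like [(1 + X) ^ (- (4 + d) th)]. Four of these powers dominate the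
    time factor, by [1 + dt <= (1 + X) ^ 4], and one goes to each coordinate, by [dx j <= X]. *)
Lemma hit_pair_le g g' : fine (P (hit g `&` hit g')) <= K1 * radius ^+ D * weight g g'.
Proof.
set dt := ndist g.1 g'.1; pose dx j := ndist (g.2 j) (g'.2 j).
have := hN0; set eta := h / N%:R => hN.
(* [X] is the parabolic distance in units of the mesh, the maximum of [dt ^ (1 / 4)] and of all
   [dx j], together with the direction that attains it. *)
have [X [X0 XN Xt Xx rel]] : exists X : R, [/\ 0 <= X, X <= N%:R, dt%:R <= X ^+ 4, forall j, (dx j)%:R <= X &
    dt%:R = X ^+ 4 \/ exists2 j, (dx j)%:R = X & dt%:R <= X ^+ 4].
  have dxN j : (dx j <= N)%N.
    exact: ndist_leq.
  have dtN : (dt <= N ^ 4)%N.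
    exact: ndist_leq.
  have [j0 _ hj0] := @arg_maxnP _ (Ordinal d0) xpredT dx isT.
  have [dtx|dtx] := leqP dt (dx j0 ^ 4).
    exists (dx j0)%:R; split => //.
    - by rewrite ler_nat.
    - by rewrite -natrX ler_nat.
    - by move=> j; rewrite ler_nat; exact: hj0.
    - by right; exists j0 => //; rewrite -natrX ler_nat.
  have X4 : (dt%:R `^ 4^-1) ^+ 4 = dt%:R :> R.
    by rewrite -powR_mulrn ?powR_ge0// -powRrM mulVf// powRr1.
  have le4 a : (a ^ 4 <= dt)%N -> a%:R <= dt%:R `^ 4^-1 :> R.
    move=> h4; rewrite -(@ler_pXn2r _ 4) ?nnegrE ?powR_ge0//.
    by rewrite X4 -natrX ler_nat.
  exists (dt%:R `^ 4^-1); split; [exact: powR_ge0| |by rewrite X4| |by left; rewrite X4].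
    rewrite -(@ler_pXn2r _ 4) ?nnegrE ?powR_ge0//.
    by rewrite X4 -natrX ler_nat.
  move=> j; apply: le4; apply: leq_trans (ltnW dtx).
  by rewrite leq_exp2r//; exact: hj0.
have eta0 : 0 <= eta by exact: ltW hN.
pose rho := eta * X.
have rho0 : 0 <= rho by rewrite mulr_ge0.
have rhoh : rho <= h.
  by rewrite /rho /eta -mulrA ler_piMr ?(ltW h0)// mulrC ler_pdivrMr// mul1r.
have rho4 : 2 * rho ^+ 4 <= t0.
  by apply: le_trans ht0; rewrite ler_wpM2l// lerXn2r ?nnegrE// ltW.
have distt : `|gtime g - gtime g'| = eta ^+ 4 * dt%:R.
  rewrite /gtime opprD addrACA subrr add0r -mulrBr normrM ndistE ger0_norm//.
  exact: exprn_ge0.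
have distx j : `|tnth (gspace g) j - tnth (gspace g') j| = eta * (dx j)%:R.
  by rewrite !tnth_mktuple -mulrBr normrM ndistE ger0_norm.
have := @V_two_points (gtime g) (gtime g') (gspace g) (gspace g') radius rho
  (gtime_itv g') (gtime_itv g) (gspace_box g) (gspace_box g') radius_gt0 rho0 (le_trans rhoh h1) rho4.
have rel' : `|gtime g - gtime g'| = rho ^+ 4 \/
    (exists2 j, `|tnth (gspace g) j - tnth (gspace g') j| = rho & `|gtime g - gtime g'| <= rho ^+ 4).
  rewrite distt /rho [(eta * X) ^+ 4]exprMn; case: rel => [->|[j jX tX]]; [by left|right; exists j].
    by rewrite distx jX.
  by rewrite ler_wpM2l// exprn_ge0.
move=> /(_ rel').
have -> : \bigcap_i (point i (gtime g) (gspace g) radius `&` point i (gtime g') (gspace g') radius) =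
    hit g `&` hit g'.
  by apply/seteqP; split=> [w hw|w [w1 w2] i _]; [split=> i _; have [] := hw i I|split; [exact: w1|exact: w2]].
move/le_trans; apply; rewrite -/m.
set e := radius; have e0 : 0 < e by exact: radius_gt0.
pose y := 1 + X; have y1 : 1 <= y by rewrite lerDl.
have y0 : 0 < y by exact: lt_le_trans y1.
have ym : y ^+ m <= 2 ^+ m * (1 + X ^+ m).
  have [X1|X1] := leP X 1.
    apply: (@le_trans _ _ (2 ^+ m)); first by rewrite lerXn2r ?nnegrE ?(ltW y0)// /y; lra.
    by rewrite ler_peMr ?exprn_ge0// lerDl exprn_ge0.
  apply: (@le_trans _ _ ((2 * X) ^+ m)); first by rewrite lerXn2r ?nnegrE ?(ltW y0) ?mulr_ge0// /y; lra.
  by rewrite exprMn ler_wpM2l ?exprn_ge0// lerDr.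
have low : e ^+ 2 * (k1 * y ^+ m) <= e ^+ 2 + k * rho ^+ m.
  have kh : 0 < k * h ^+ m by rewrite mulr_gt0// exprn_gt0.
  have -> : e ^+ 2 + k * rho ^+ m = e ^+ 2 * (1 + k * h ^+ m * X ^+ m).
    rewrite radius_sqr /rho /eta !exprMn exprVn; ring.
  rewrite ler_wpM2l ?sqr_ge0// /k1; set mn := Num.min _ _.
  have mn0 : 0 <= mn by rewrite le_min ler01 ltW.
  apply: (@le_trans _ _ (mn * (1 + X ^+ m))).
    rewrite -mulrA ler_wpM2l// mulrC ler_pdivrMr ?exprn_gt0// mulrC//.
  rewrite mulrDr mulr1; apply: lerD; first by rewrite ge_min lexx.
  by rewrite ler_wpM2r ?exprn_ge0// ge_min lexx orbT.
have ky0 : 0 < k1 * y ^+ m by rewrite mulr_gt0// exprn_gt0.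
have step1 : e ^+ 2 / Num.sqrt (e ^+ 2 + k * rho ^+ m) <= e / (Num.sqrt k1 * Num.sqrt (y ^+ m)).
  apply: (@le_trans _ _ (e ^+ 2 / Num.sqrt (e ^+ 2 * (k1 * y ^+ m)))).
    rewrite ler_wpM2l ?sqr_ge0// lef_pV2 ?posrE ?sqrtr_gt0 ?ler_wsqrtr//.
      by apply: lt_le_trans low; rewrite mulr_gt0// exprn_gt0.
    by rewrite mulr_gt0// exprn_gt0.
  rewrite sqrtrM ?sqr_ge0// sqrtr_sqr gtr0_norm// sqrtrM ?(ltW k10)//.
  rewrite expr2 invfM mulrA -[e * e / e]mulrA divff ?mulr1// gt_eqF//.
have sq0 : 0 < Num.sqrt (y ^+ m) by rewrite sqrtr_gt0 exprn_gt0.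
have sk0 : 0 < Num.sqrt k1 by rewrite sqrtr_gt0.
apply: (@le_trans _ _ ((C * (e / (Num.sqrt k1 * Num.sqrt (y ^+ m)))) ^+ D)).
  rewrite lerXn2r ?nnegrE ?ler_wpM2l ?(ltW C0)//; apply: mulr_ge0; rewrite ?(ltW C0)//.
    by rewrite divr_ge0 ?sqr_ge0// sqrtr_ge0.
  by rewrite divr_ge0 ?(ltW e0)// mulr_ge0// ltW.
have -> : C * (e / (Num.sqrt k1 * Num.sqrt (y ^+ m))) = C / Num.sqrt k1 * e * (Num.sqrt (y ^+ m))^-1.
  by field; rewrite !gt_eqF.
rewrite exprMn exprMn -/K1; apply: ler_wpM2l.
  by rewrite mulr_ge0 ?exprn_ge0 ?divr_ge0 ?(ltW C0) ?(ltW sk0)// (ltW e0).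
have sqE : (Num.sqrt (y ^+ m))^-1 ^+ D = y `^ (- ((4 + d)%:R * th)).
  rewrite -powR12_sqrt ?exprn_ge0 ?(ltW y0)// -powR_mulrn ?(ltW y0)// -powRrM -powRN -powR_mulrn ?powR_ge0// -powRrM.
  congr (_ `^ _); have : (4 + d)%:R != 0 :> R by rewrite pnatr_eq0.
  by rewrite /th; move: (4 + d)%:R => a a0; field.
rewrite sqE.
have anti (a b : R) : 0 < a -> a <= b -> b `^ (- th) <= a `^ (- th).
  move=> a0 ab; rewrite !powRN lef_pV2 ?posrE ?powR_gt0 ?(lt_le_trans a0)//.
  by rewrite ge0_ler_powR ?nnegrE ?(ltW th0) ?(ltW a0)// (le_trans (ltW a0)).
have -> : y `^ (- ((4 + d)%:R * th)) = (y ^+ 4) `^ (- th) * \prod_(j < d) y `^ (- th).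
  rewrite prodr_const card_ord -powR_mulrn ?(ltW y0)// -powRrM -[in RHS]powR_mulrn ?powR_ge0// -powRrM.
  rewrite -powRD ?(gt_eqF y0) ?implybT//; congr (_ `^ _); rewrite natrD; ring.
rewrite /weight; apply: ler_pM; rewrite ?powR_ge0 ?prodr_ge0//.
- by move=> j _; exact: powR_ge0.
- apply: anti; first by rewrite ltr_pwDl.
  have : 1 + X ^+ 4 <= y ^+ 4.
    have -> : y ^+ 4 = 1 + X ^+ 4 + (4 * X + 6 * X ^+ 2 + 4 * X ^+ 3) by rewrite /y; ring.
    by rewrite lerDl !addr_ge0 ?mulr_ge0 ?exprn_ge0.
  by apply: le_trans; rewrite lerD2l.
- apply: ler_prod => j _; rewrite powR_ge0/=; apply: anti; first by rewrite ltr_pwDl.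
  by rewrite /y lerD2l; exact: Xx.
Qed.

Let L : R := (2 / (1 - th)) ^+ d.+1.

Let L0 : 0 < L.
Proof. by rewrite exprn_gt0// divr_gt0// subr_gt0. Qed.

Let K10 : 0 < K1.
Proof. by rewrite exprn_gt0// divr_gt0// sqrtr_gt0. Qed.

Lemma card_grid : #|{: grid}|%:R = N%:R `^ (4 + d)%:R :> R.
Proof. by rewrite card_prod card_ffun !card_ord -expnD natrX powR_mulrn ?(ltW NR0). Qed.

Lemma sum_weight_le g : \sum_g' weight g g' <= L * (#|{: grid}|%:R * radius ^+ D).
Proof.
pose F (a : 'I_(N ^ 4)) : R := (1 + (ndist g.1 a)%:R) `^ (- th).
pose G j (b : 'I_N) : R := (1 + (ndist (g.2 j) b)%:R) `^ (- th).
have -> : \sum_g' weight g g' = (\sum_a F a) * \prod_j \sum_b G j b.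
  rewrite (bigA_distr_bigA G) big_distrlr/= pair_bigA/=.
  by apply: eq_bigr => -[a b] _.
have F1 : \sum_a F a <= 2 / (1 - th) * (N ^ 4)%:R `^ (1 - th) by exact: energy_le.
have G1 j : \sum_b G j b <= 2 / (1 - th) * N%:R `^ (1 - th) by exact: energy_le.
have F0 : 0 <= \sum_a F a by apply: sumr_ge0 => a _; exact: powR_ge0.
have G0 j : 0 <= \sum_b G j b by apply: sumr_ge0 => b _; exact: powR_ge0.
apply: (@le_trans _ _ (2 / (1 - th) * (N ^ 4)%:R `^ (1 - th) * (2 / (1 - th) * N%:R `^ (1 - th)) ^+ d)).
  apply: ler_pM => //; first exact: prodr_ge0.
  rewrite -[X in _ ^+ X]card_ord -prodr_const; apply: ler_prod => j _.
  by rewrite G0 G1.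
rewrite /L card_grid radiusX exprS exprMn.
rewrite natrX -powR_mulrn ?(ltW NR0)// -[_ `^ (1 - th) ^+ d]powR_mulrn ?powR_ge0//.
rewrite -!powRrM -powRD; last by rewrite (gt_eqF NR0) implybT.
rewrite mulrACA -powRD; last by rewrite (gt_eqF NR0) implybT.
by rewrite le_eqVlt; apply/orP; left; apply/eqP; congr (_ * _ `^ _); rewrite natrD; ring.
Qed.

Lemma hit_some_ge :
  (c ^+ D) ^+ 2 / (K1 * L) <= fine (P (\big[setU/set0]_(g <- enum {: grid}) hit g)).
Proof.
set n : R := #|{: grid}|%:R.
have n0 : 0 < n by rewrite /n card_grid powR_gt0.
have rD : 0 < radius ^+ D by rewrite exprn_gt0// radius_gt0.
have cD : 0 < c ^+ D by rewrite exprn_gt0.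
(* The squared mean and the second moment have the same order, so [n] and [radius] cancel and the
   bound is uniform in [N]. *)
have -> : (c ^+ D) ^+ 2 / (K1 * L) =
    (n * (c * radius) ^+ D) ^+ 2 / (n * (K1 * radius ^+ D * (L * (n * radius ^+ D)))).
  rewrite exprMn [(c * _) ^+ D]exprMn; move: n0 rD K10 L0; move: (radius ^+ D) (c ^+ D) (K1) (L) (n) => r e K l b *.
  by field; rewrite !gt_eqF.
apply: second_moment.
- by move=> g; exact: measurable_hit.
- by rewrite mulr_gt0// exprn_gt0// mulr_gt0// radius_gt0.
- by do !apply: mulr_gt0.
- rewrite /n -sum1_card natr_sum mulr_suml; apply: ler_sum => g _; rewrite mul1r.
  exact: V_point (gtime_itv g) (gspace_box g) radius_gt0 radius_le1.
- rewrite {1}/n -sum1_card natr_sum mulr_suml; apply: ler_sum => g _; rewrite mul1r.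
  apply: (@le_trans _ _ (\sum_g' K1 * radius ^+ D * weight g g')).
    by apply: ler_sum => g' _; exact: hit_pair_le.
  by rewrite -mulr_sumr; apply: ler_wpM2l; [rewrite ltW// mulr_gt0|exact: sum_weight_le].
Qed.

End grid.

Theorem nonpolar_point :
  nonpolar P [set` `[t0, T]] J (fun t x w => [tuple V i t x w | i < D]) [set z].
Proof.
have [h h0 [h1 h2 h3 h4]] := side_ex.
pose U n := \big[setU/set0]_(g <- enum {: grid n.+1}) hit h g.
apply: contra_not (@limsup_not_negligible _ _ _ P U _ _ _ (fun n => hit_some_ge h0 h1 h2 h3 h4 (ltn0Sn n))).
- move=> [N [mN PN sub]]; exists N; split => // w hw; apply: sub => /=.
  have [|t [x [tT xJ Vz]]] := @compact_target R d D _ _ V t0 T M z w V_continuous.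
    move=> e e0.
    (* Since [m >= 1], [radius ^ 2 = N ^ (- m)] is at most [1 / N], so a grid of this fineness
       brings the field within [e]. *)
    have [n ne] : exists n, n.+1%:R^-1 < e ^+ 2.
      exists (Num.truncn (e ^+ 2)^-1).
      rewrite invf_plt ?posrE ?exprn_gt0//.
      exact: truncnS_gt.
    have [k' _] := hw n I.
    rewrite /U -bigcup_seq => -[g _ hg].
    exists (gtime h g), (gspace h g); split; [exact: gtime_itv|exact: gspace_box|move=> i].
    apply: le_trans (hg i I) _.
    rewrite -(@ler_pXn2r _ 2) ?nnegrE ?(ltW e0) ?(ltW (radius_gt0 _))// radius_sqr//.
    apply: le_trans (ltW ne).
    rewrite lef_pV2 ?posrE ?exprn_gt0//.
    apply: (@le_trans _ _ (n + k').+1%:R); first by rewrite ler_nat ltnS leq_addr.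
    by rewrite -[leLHS]expr1 ler_weXn2l// ler1n.
  exists z; split => //; exists (t, x); first by split => //=; rewrite in_itv.
  by apply: eq_from_tnth => i; rewrite tnth_mktuple Vz.
- apply: divr_gt0; first by rewrite !exprn_gt0.
  apply: mulr_gt0; apply: exprn_gt0; apply: divr_gt0 => //; last by rewrite subr_gt0.
  by rewrite sqrtr_gt0 divr_gt0 ?exprn_gt0// lt_min ltr01 mulr_gt0// exprn_gt0.
- by move=> n; apply: bigsetU_measurable => g _; exact: measurable_hit.
Qed.

End nonpolar_points.

(** * The critical dimension *)

Lemma prod_le_expr (R : realType) n (F : 'I_n -> R) a : (forall i, 0 <= F i <= a) ->
  \prod_i F i <= a ^+ n.
Proof.
by move=> Fa; rewrite -[X in _ ^+ X]card_ord -prodr_const; apply: ler_prod => i _; exact: Fa.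
Qed.

Lemma expr_le_prod (R : realType) n (F : 'I_n -> R) a : 0 <= a -> (forall i, a <= F i) ->
  a ^+ n <= \prod_i F i.
Proof.
by move=> a0 Fa; rewrite -[X in _ ^+ X]card_ord -prodr_const; apply: ler_prod => i _; rewrite a0 Fa.
Qed.

Lemma tuple_bounded (R : realType) n (z : n.-tuple R) : exists Z, forall i, `|tnth z i| <= Z.
Proof.
exists (\sum_i `|tnth z i|) => i.
by rewrite (bigD1 i)//= lerDl sumr_ge0.
Qed.

Section critical_dimension.
Variable R : realType.

Lemma critical_dim1 : critical_dim R 1 = 11 / 3.
Proof. by rewrite /critical_dim min_l; [field|lra]. Qed.

Lemma critical_dim2 : critical_dim R 2 = 6.
Proof. by rewrite /critical_dim min_l; [field|lra]. Qed.

Lemma critical_dim3 : critical_dim R 3 = 14.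
Proof. by rewrite /critical_dim min_r; [field|lra]. Qed.

(** For [d = 2] and [d = 3] both conditions have the same threshold, [6] and [14]. For [d = 1] the
    thresholds are [11 / 3] and [10 / 3], but either way [D <= 3]. *)
Lemma subcritical_dim d D : d \in [:: 1; 2; 3]%N -> D%:R < critical_dim R d ->
  ((4 - d) * D < 2 * (4 + d))%N.
Proof.
rewrite !inE => /or3P[]/eqP->.
- by rewrite critical_dim1 ltr_pdivlMr// -natrM ltr_nat; lia.
- by rewrite critical_dim2 ltr_nat; lia.
- by rewrite critical_dim3 ltr_nat; lia.
Qed.

Lemma supercritical_dim d D : d \in [:: 1; 2; 3]%N -> critical_dim R d < D%:R ->
  (d == 1%N) && (4 <= D)%N || (d == 2%N) && (7 <= D)%N || (d == 3%N) && (15 <= D)%N.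
Proof.
rewrite !inE => /or3P[]/eqP->.
- by rewrite critical_dim1 ltr_pdivrMr// -natrM ltr_nat; lia.
- by rewrite critical_dim2 ltr_nat; lia.
- by rewrite critical_dim3 ltr_nat; lia.
Qed.

(** At the critical exponents [al = (4 - d) / 4] and [th = min 1 ((4 - d) / 2)], the condition
    on [p], [q] and [r] is [D > critical_dim]; there is room for slightly smaller
    exponents and for integers. *)
Lemma grid_exponents d D : d \in [:: 1; 2; 3]%N -> critical_dim R d < D%:R ->
  exists p q r : nat, exists al th : R,
  [/\ [/\ (1 < r)%N, (r.-1 <= p)%N, (r.-1 <= q)%N & (p + d * q + 1 <= r.-1 * D)%N],
      [/\ 0 < al, al <= 1, 0 < th & th <= 1],
      al * p%:R = 2 * r%:R, th * q%:R = r%:R &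
      d%:R / 4 + al < 1 /\ d%:R / 4 + th / 2 < 1].
Proof.
move=> hd /(supercritical_dim hd) /orP[/orP[]|] /andP[/eqP-> hD].
(* The exponents are [al = 2 r / p] and [th = r / q], kept at or just below the critical ones:
   [3 / 4] and [1], then [1 / 2] and [1], then [1 / 4] and [1 / 2]. The smallest admissible [D] are
   [4], [7] and [15]; the first two give equality in the condition on [p], [q] and [r]. *)
- exists 85%N, 30%N, 30%N, (60 / 85), 1; split; [split; lia|split; lra|lra|lra|split; lra].
- exists 84%N, 24%N, 20%N, (40 / 84), (20 / 24); split; [split; lia|split; lra|lra|lra|split; lra].
- exists 328%N, 84%N, 40%N, (80 / 328), (40 / 84); split; [split; lia|split; lra|lra|lra|split; lra].
Qed.

End critical_dimension.

Theorem corollary6p2 (R : realType) (d D : nat) (t0 T M : R)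
  (hd : d \in [:: 1; 2; 3]%N) (hD : (1 <= D)%N)
  (ht0 : 0 < t0) (htT : t0 < T) (hM : 0 < M < 2 * pi)
  (v0 : d.-tuple R -> R)
  (hv0 : forall t x, 0 < t <= T -> torus x ->
     (lebesgue_tuple R d).-integrable (@torus R d)
       (fun z => (green t x z * v0 z)%:E))
  (dsp' : measure_display) (Om' : measurableType dsp') (P' : probability Om' R)
  (W : set (measurableTypeR R * d.-tuple (measurableTypeR R))%type -> Om' -> R)
  (hW : white_noise P' T W)
  (v : R -> d.-tuple R -> Om' -> R)
  (hv : biharmonic_field P' T W v0 v)
  (dsp : measure_display) (Om : measurableType dsp) (P : probability Om R)
  (V : 'I_D -> R -> d.-tuple R -> Om -> R)
  (hV : independent_copies P T P' v V)
  (hVc : forall i, continuous_paths [set` `[t0, T]] (@box R d M) (V i)) :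
  let VV := fun t x w => [tuple V i t x w | i < D] in
  (critical_dim R d < D%:R ->
     forall z : D.-tuple R, polar P [set` `[t0, T]] (@box R d M) VV [set z]) /\
  (D%:R < critical_dim R d ->
     forall z : D.-tuple R,
       nonpolar P [set` `[t0, T]] (@box R d M) VV [set z]).
Proof.
move=> VV.
have T0 : 0 < T by exact: lt_trans htT.
have /andP[M0 M2pi] := hM.
have d0 : (0 < d)%N by move: hd; rewrite !inE => /or3P[]/eqP->.
have d4 : (d < 4)%N by move: hd; rewrite !inE => /or3P[]/eqP->.
have hv0T x : torus x -> (lebesgue_tuple R d).-integrable (@torus R d) (fun z => (green T x z * v0 z)%:E).
  by apply: hv0; rewrite T0 lexx.
(* The bound [M < 2 pi] keeps the closed box among the representatives of the torus. *)
have inT x : @box R d M x -> torus x.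
  by move=> bx j; have /andP[-> h] := bx j; exact: le_lt_trans M2pi.
have tT t : t0 <= t <= T -> 0 < t <= T.
  by move=> /andP[h ->]; rewrite (lt_le_trans ht0 h).
have mV i t x : t0 <= t <= T -> box M x -> measurable_fun setT (V i t x).
  by move=> /tT h /inT hx; exact: (measurable_copy hV i h hx).
split=> [/(grid_exponents hd)[p [q [r [al [th [[r1 rp rq pqr] [al0 al1 th0 th1] alp thq [e1 e2]]]]]]] z|
    /(subcritical_dim hd) sub z].
- have [C1 C10 up] := field_point_upper T0 hW hv ht0.
  have [C2 C20 inc] := field_increment T0 d0 hW hv hv0T ht0 al0 al1 th0 th1 e1 e2.
  (* [polar_point] takes one constant for small balls and increments; both estimates weaken as it
     grows. *)
  have C0 : 0 < C1 + C2 by exact: addr_gt0.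
  apply: (polar_point (C := C1 + C2) htT M0 C0 r1 rp rq al0 th0 alp thq pqr mV _ _ hVc).
    move=> t x e ht bx e0; rewrite (copies_point hV)//; [|exact: tT|exact: inT].
    apply: prod_le_expr => i; rewrite fine_ge0//=.
    apply: le_trans (up _ _ _ _ ht (inT _ bx) e0) _.
    by rewrite ler_wpM2r ?(ltW e0)// lerDl ltW.
  move=> i t s x y Q u h1 h2 h3 bx yx Q0 u0 hQ.
  have st : t0 <= s <= T by rewrite h1 (le_trans h2).
  have tt : t0 <= t <= T by rewrite h3 andbT (le_trans h1).
  have ts0 : 0 <= t - s + \sum_j `|tnth x j - tnth y j| by rewrite addr_ge0 ?subr_ge0// sumr_ge0.
  have mon (c : R) : measurable [set w | c < `|V i t x w - V i s y w|].
    have mf : measurable_fun setT (fun w => `|V i t x w - V i s y w|).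
      by apply: measurableT_comp => //; apply: measurable_funB; exact: mV.
    rewrite -[X in measurable X]setTI (_ : [set w | _] = (fun w => `|V i t x w - V i s y w|) @^-1` `]c, +oo[).
      exact: mf.
    by apply/seteqP; split=> w; rewrite /= in_itv/= andbT.
  apply: (@le_trans _ _ (P [set w | u + C2 * (t - s + \sum_j `|tnth x j - tnth y j|) < `|V i t x w - V i s y w|])).
    apply: le_measure; rewrite ?inE; [exact: mon|exact: mon|].
    move=> w /=; apply: le_lt_trans.
    by rewrite lerD2l ler_wpM2r// lerDr ltW.
  rewrite (copy_increment hV); [|exact: tT|exact: inT|exact: tT|exact: inT].
  apply: le_trans (inc _ _ _ _ _ _ h1 h2 h3 (inT _ bx) (inT _ yx) Q0 u0 hQ) _.
  rewrite lee_fin ler_wpM2l// ler_expR lerN2 ler_wpM2l ?sqr_ge0//.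
  by rewrite lef_pV2 ?posrE ?mulr_gt0// ler_wpM2r ?(ltW Q0)// lerDr ltW.
- have [Z hZ] := tuple_bounded z.
  have [c c0 low] := field_point_lower T0 d0 d4 hW hv hv0T ht0 Z.
  have [C [k [C0 k0] two]] := field_two_points T0 d0 d4 hW hv ht0.
  apply: (nonpolar_point ht0 htT M0 c0 C0 k0 d0 d4 hD sub mV _ _ hVc).
    move=> t x e ht bx e0 e1; rewrite (copies_point hV); [|exact: tT|exact: inT].
    apply: expr_le_prod => [|i]; first by rewrite mulr_ge0// ltW.
    exact: low ht (inT _ bx) (hZ i) e0 e1.
  move=> t s x y e rho ht hs bx yx e0 rho0 rho1 rho4 rel.
  rewrite (copies_two_points hV); [|exact: tT|exact: inT|exact: tT|exact: inT].
  apply: prod_le_expr => i; rewrite fine_ge0//=.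
  exact: two ht hs (inT _ bx) (inT _ yx) e0 rho0 rho1 rho4 rel.
Qed.
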